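(* Fix a unital commutative ring $R$. For each pair $(\mathcal{M},\chi)$ consisting of a loopless oriented matroid $\mathcal{M}$ of rank $r\geq 1$ on a finite set $E$ and a chirotope $\chi$ of $\mathcal{M}$, choose any triangulation $\Delta$ of $\mathcal{M}$ and define \[ \overline{\Omega}(\mathcal{M},\chi) := \sum_{B\in \Delta} \chi(B)\,\partial e_B \in \overline{\mathrm{OS}}^{\,r-1}_R(\mathrm{M}), \] where each basis $B$ is ordered arbitrarily (the product $\chi(B)\partial e_B$ does not depend on the ordering). Then $\overline{\Omega}(\mathcal{M},\chi)$ does not depend on the choice of $\Delta$, and the assignment $(\mathcal{M},\chi)\mapsto \overline{\Omega}(\mathcal{M},\chi)$ is the unique way of assigning to every such pair an element of $\overline{\mathrm{OS}}^{\,r-1}_R(\mathrm{M})$ satisfying: (1) if $r=1$: when $\mathcal{M}$ is not acyclic, $\overline{\Omega}(\mathcal{M},\chi)=0$, and when $\mathcal{M}$ is acyclic, $\overline{\Omega}(\mathcal{M},\chi)=\chi(i)\cdot 1\in \overline{\mathrm{OS}}^{\,0}_R(\mathrm{M})=R$ for any $i\in E$; (2) for every atom $a\in\mathfrak{A}(\mathrm{M})$, $\operatorname{Res}_a \overline{\Omega}(\mathcal{M},\chi)=\overline{\Omega}(\mathcal{M}/a,\chi/a)$ if $a$ is acyclic in $\mathcal{M}$, and $\operatorname{Res}_a \overline{\Omega}(\mathcal{M},\chi)=0$ otherwise.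
   Context: Oriented matroid conventions are those of Björner–Las Vergnas–Sturmfels–White–Ziegler. $\mathcal{M}$ is a loopless oriented matroid of rank $r$ on a finite set $E$ with underlying matroid $\mathrm{M}$. For a sign vector $X\in\{+,0,-\}^E$ write $X^+=\{i:X(i)=+\}$, $X^-=\{i:X(i)=-\}$. $\mathcal{M}$ is acyclic if it has no positive circuit (signed circuit $C$ with $C^-=\emptyset$); a subset $S\subseteq E$ is acyclic in $\mathcal{M}$ if the restriction $\mathcal{M}|_S$ is acyclic. A chirotope of $\mathcal{M}$ is an alternating map $\chi:E^r\to\{+,0,-\}$ (values identified with $\pm1,0$) defining $\mathcal{M}$; it is determined by $\mathcal{M}$ up to a global sign. $\mathfrak{A}=\mathfrak{A}(\mathrm{M})$ denotes the set of atoms (rank one flats) of $\mathrm{M}$; a subset $I\subseteq\mathfrak{A}$ is dependent if its rank is less than $|I|$. Orlik–Solomon algebra: $\mathrm{OS}^\bullet_R(\mathrm{M})=\bigwedge^\bullet R^{\mathfrak{A}}/\langle \partial e_S : S\subseteq\mathfrak{A}\text{ dependent}\rangle$, where for a sequence $S=(s_1,\dots,s_k)$ of atoms $e_S=e_{s_1}\wedge\cdots\wedge e_{s_k}$ and $\partial e_S=\sum_{i=0}^{k-1}(-1)^i e_{S\setminus s_{k-i}}$ (here $S\setminus s_j$ is the sequence with $s_j$ removed); $\partial$ descends to a map on $\mathrm{OS}^\bullet_R(\mathrm{M})$. The reduced Orlik–Solomon algebra is $\overline{\mathrm{OS}}^\bullet_R(\mathrm{M})=\ker(\partial:\mathrm{OS}^\bullet_R(\mathrm{M})\to\mathrm{OS}^\bullet_R(\mathrm{M}))$.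 For a sequence $I=(i_1,\dots,i_k)$ of elements of $E$, $e_I$ means $e_{\bar I}$ with $\bar I$ the sequence of atoms (closures) of the $i_j$. For an atom $a$, $\operatorname{Res}_a:\mathrm{OS}^\bullet_R(\mathrm{M})\to\mathrm{OS}^{\bullet-1}_R(\mathrm{M}/a)$ is given by $e_{(i_1,\dots,i_{k-1},a)}\mapsto e_{(i_1,\dots,i_{k-1})}$ (read in the contraction $\mathrm{M}/a$) and $e_I\mapsto 0$ if no entry of $I$ is $a$; it restricts to a map $\overline{\mathrm{OS}}^\bullet_R(\mathrm{M})\to\overline{\mathrm{OS}}^{\bullet-1}_R(\mathrm{M}/a)$. For an atom $a$ and $i\in a$, $(\chi/i)(B):=\chi(B,i)$ for ordered bases $B$ of $\mathcal{M}/a$ defines a chirotope of $\mathcal{M}/a$; when $a$ is acyclic in $\mathcal{M}$ it is independent of $i\in a$ and denoted $\chi/a$. Triangulation (in the sense of F. Santos, Triangulations of oriented matroids, 2002): a nonempty collection $\Delta$ of bases of $\mathcal{M}$ such that (proper intersection) for any $B,B'\in\Delta$ there is no signed circuit $C$ of $\mathcal{M}$ with $C^+\subseteq B$ and $C^-\subseteq B'$, and (pseudo-manifold property) for every $B\in\Delta$ and $b\in B$, either $B\setminus b$ lies in the zero set of a positive cocircuit of $\mathcal{M}$, or there is $B'\in\Delta$, $B'\neq B$, with $B\setminus b\subset B'$.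
   Formalization: The boundary ∂e_S is taken with signs counted from the left (first factor removed with sign +), i.e. (-1)^{|S|-1} times the stated one; with the stated sign, condition (2) fails by a factor -1 already for the rank 2 oriented matroid on {1,2} without circuits. *)

(* Defs.v *)
From HB Require Import structures.
From mathcomp Require Import all_boot all_order all_algebra perm boolp.

Set Implicit Arguments.
Unset Strict Implicit.
Unset Printing Implicit Defensive.

Import GRing.Theory.
Local Open Scope ring_scope.
Local Open Scope quotient_scope.

(* A signed set X is the pair (X^+, X^-). *)
Definition sgset (V : finType) : Type := ({set V} * {set V})%type.
HB.instance Definition _ (V : finType) :=
  Finite.copy (sgset V) ({set V} * {set V})%type.

Section SignedSets.
Variable V : finType.
Implicit Types X Y : sgset V.

Definition pos X : {set V} := X.1.
Definition neg X : {set V} := X.2.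
Definition supp X : {set V} := pos X :|: neg X.
Definition sopp X : sgset V := (neg X, pos X).
Definition sval_at X (i : V) : int := (i \in pos X)%:Z - (i \in neg X)%:Z.

Definition orthogonal X Y : Prop :=
  [disjoint supp X & supp Y] \/
  exists i j, sval_at X i * sval_at Y i = 1 /\ sval_at X j * sval_at Y j = -1.

End SignedSets.

(* The ground set E is a subset of an ambient finite type V, so that
   restrictions and contractions stay over the same V; the axioms are the
   separate predicate [oriented_matroid]. *)
Record sgsystem (V : finType) :=
  SgSystem { ground : {set V}; circuits : {set sgset V} }.

Section OrientedMatroids.
Variable V : finType.
Implicit Types (M : sgsystem V) (S F H B a : {set V}).

Definition oriented_matroid M : Prop :=
  [/\ forall X, X \in circuits M ->
        [disjoint pos X & neg X] && (supp X \subset ground M),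
      (set0, set0) \notin circuits M,
      forall X, X \in circuits M -> sopp X \in circuits M,
      forall X Y, X \in circuits M -> Y \in circuits M ->
        supp X \subset supp Y -> X = Y \/ X = sopp Y
    & forall X Y e, X \in circuits M -> Y \in circuits M -> X <> sopp Y ->
        e \in pos X :&: neg Y ->
        exists Z, [/\ Z \in circuits M,
                      pos Z \subset (pos X :|: pos Y) :\ e
                    & neg Z \subset (neg X :|: neg Y) :\ e]].

Definition indep M S : bool :=
  (S \subset ground M) && [forall X in circuits M, ~~ (supp X \subset S)].

Definition rk M S : nat := \max_(I : {set V} | (I \subset S) && indep M I) #|I|.

Definition mrank M : nat := rk M (ground M).

Definition basis M B : bool := indep M B && (#|B| == mrank M).

Definition closure M S : {set V} := [set i in ground M | rk M (i |: S) == rk M S].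

Definition flat M F : bool := (F \subset ground M) && (closure M F == F).

Definition is_atom M : pred {set V} := [pred a | flat M a && (rk M a == 1)].

Definition loopless M : Prop := forall i, i \in ground M -> indep M [set i].

Definition acyclic M : Prop := forall C, C \in circuits M -> neg C != set0.

Definition restrict M S : sgsystem V :=
  SgSystem (ground M :&: S) [set C in circuits M | supp C \subset S].

Definition acyclic_set M S : Prop := acyclic (restrict M S).

(* The circuits of M/S are the nonempty C \ S, C a circuit of M, of minimal
   support. *)
Definition sdel (C : sgset V) S : sgset V := (pos C :\: S, neg C :\: S).

Definition traces M S : {set sgset V} :=
  [set X in [set sdel C S | C in circuits M] | supp X != set0].

Definition contract M S : sgsystem V :=
  SgSystem (ground M :\: S)
    [set X in traces M S
     | [forall Y in traces M S, ~~ (supp Y \proper supp X)]].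

(* The signed cocircuits are the signatures of the complements of the
   hyperplanes that are orthogonal to all the signed circuits. *)
Definition hyperplane M H : bool := flat M H && ((rk M H).+1 == mrank M).

Definition cocircuit M (D : sgset V) : Prop :=
  [/\ [disjoint pos D & neg D],
      exists2 H, hyperplane M H & supp D = ground M :\: H
    & forall C, C \in circuits M -> orthogonal C D].

Definition positive_cocircuit M (D : sgset V) : Prop :=
  cocircuit M D /\ neg D = set0.

(* A chirotope of M is defined on E^r; here it is extended by 0 to V^r. It
   defines M through its nonzero set, the ordered bases, and the pivoting
   relation between ordered bases and signed circuits. *)
Definition chirotope M (r : nat) (chi : {ffun r.-tuple V -> int}) : Prop :=
  [/\ forall t, chi t \in [:: 0; 1; -1],
      forall t : r.-tuple V,
        (chi t != 0) = uniq t && basis M [set i in tval t],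
      forall (t : r.-tuple V) (s : 'S_r),
        chi [tuple tnth t (s k) | k < r] = (-1) ^+ s * chi t
    & forall (t u : r.-tuple V) (i j : V) (x : seq V) (C : sgset V),
        tval t = i :: x -> tval u = j :: x ->
        chi t != 0 -> chi u != 0 ->
        C \in circuits M -> supp C \subset [set k in i :: j :: x] ->
        chi u = - (sval_at C i * sval_at C j) * chi t].

Definition chi_contract (r : nat) (chi : {ffun r.+1.-tuple V -> int}) (i : V) :
  {ffun r.-tuple V -> int} := [ffun t : r.-tuple V => chi [tuple of rcons t i]].

Definition oriented_pair M (r : nat) (chi : {ffun r.-tuple V -> int}) : Prop :=
  [/\ oriented_matroid M, loopless M, mrank M = r, (0 < r)%N & chirotope M chi].

Definition triangulation M (Delta : {set {set V}}) : Prop :=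
  [/\ Delta != set0,
      forall B, B \in Delta -> basis M B,
      forall B B', B \in Delta -> B' \in Delta ->
        ~ exists2 C, C \in circuits M & (pos C \subset B) && (neg C \subset B')
    & forall B b, B \in Delta -> b \in B ->
        (exists2 D, positive_cocircuit M D & [disjoint B :\ b & supp D]) \/
        (exists B', [/\ B' \in Delta, B' <> B & B :\ b \subset B'])].

End OrientedMatroids.

(* The exterior algebra of R^T: coordinates are taken in the basis of the
   monomials e_S, S a subset of T, whose factors are listed in the order of
   [enum T]. *)
Definition ext (R : comPzRingType) (T : finType) : Type := {ffun {set T} -> R}.
HB.instance Definition _ (R : comPzRingType) (T : finType) :=
  GRing.Lmodule.copy (ext R T) {ffun {set T} -> R^o}.

Section ExteriorAlgebra.
Variables (R : comPzRingType) (T : finType).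
Implicit Types (x y : ext R T) (S U : {set T}) (s : seq T).

Definition mon S : ext R T := [ffun U => (U == S)%:R].

Definition inversions S U : nat :=
  #|[set p in setX S U | (enum_rank p.2 < enum_rank p.1)%N]|.

Definition wedge x y : ext R T :=
  [ffun U : {set T} => \sum_(S : {set T} | S \subset U)
     (-1) ^+ inversions S (U :\: S) * (x S * y (U :\: S))].

Definition emon s : ext R T :=
  foldr (fun a x => wedge (mon [set a]) x) (mon set0) s.

(* The k-th factor from the LEFT (k = 0, 1, ...) is removed with sign (-1)^k:
   with this sign the boundary commutes with the residue, which strips a
   RIGHTMOST factor, whereas counting from the right makes them anticommute. *)
Definition bdry_seq s : ext R T :=
  \sum_(k < size s) (-1) ^+ k *: emon (take k s ++ drop k.+1 s).

Definition bdry x : ext R T := \sum_(S : {set T}) x S *: bdry_seq (enum S).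

Definition homogeneous (k : nat) x : Prop := forall S, x S != 0 -> #|S| = k.

End ExteriorAlgebra.

Section OrlikSolomon.
Variables (R : comPzRingType) (V : finType) (M : sgsystem V).

Definition atom : Type := {a : {set V} | is_atom M a}.
HB.instance Definition _ := Finite.on atom.

Definition atoms_dependent (I : {set atom}) : bool :=
  (rk M (\bigcup_(a in I) val a) < #|I|)%N.

Inductive os_ideal : ext R atom -> Prop :=
| os_gen (I : {set atom}) : atoms_dependent I -> os_ideal (bdry (mon R I))
| os_0 : os_ideal 0
| os_sub x y : os_ideal x -> os_ideal y -> os_ideal (x - y)
| os_mull z x : os_ideal x -> os_ideal (wedge z x)
| os_mulr z x : os_ideal x -> os_ideal (wedge x z).

Definition os_idealb : ext R atom -> bool := fun x => `[< os_ideal x >].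

Lemma os_idealb_closed : zmod_closed os_idealb.
Proof.
split=> [|x y /asboolP Ix /asboolP Iy]; apply/asboolP; first exact: os_0.
exact: os_sub.
Qed.
HB.instance Definition _ :=
  GRing.isZmodClosed.Build (ext R atom) os_idealb os_idealb_closed.

Definition OS : Type :=
  {ideal_quot (GRing.ZmodClosed.clone (ext R atom) os_idealb _)}.
HB.instance Definition _ := GRing.Zmodule.on OS.
HB.instance Definition _ := EqQuotient.on OS.

(* The ideal is stable under the boundary and, in the next section, mapped by
   [ext_res] to the ideal of the contraction, so that the representative chosen
   by [repr] does not matter. *)
Definition os_bdry (w : OS) : OS := \pi_OS (bdry (repr w)).

Definition reduced_OS (k : nat) (w : OS) : Prop :=
  (exists2 x, homogeneous k x & w = \pi_OS x) /\ os_bdry w = 0.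

(* The sequence of the atoms spanned by a sequence of elements of E; elements
   that span no atom, i.e. loops, would be dropped. *)
Definition atom_seq (s : seq V) : seq atom :=
  pmap (fun i => insub (closure M [set i])) s.

Definition os_elt (s : seq V) : OS := \pi_OS (emon R (atom_seq s)).

Definition os_one : OS := os_elt [::].

End OrlikSolomon.

Section Residue.
Variables (R : comPzRingType) (V : finType) (M : sgsystem V) (a : atom M).

Definition contract_atoms (s : seq (atom M)) : seq (atom (contract M (val a))) :=
  pmap (fun b => insub (closure (contract M (val a)) (val b))) s.

(* The sign moves the factor a of the monomial e_S to the last position. *)
Definition ext_res (x : ext R (atom M)) : ext R (atom (contract M (val a))) :=
  \sum_(S : {set atom M} | a \in S)
    (x S * (-1) ^+ #|[set b in S | (enum_rank a < enum_rank b)%N]|) *: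
      emon R (contract_atoms (enum (S :\ a))).

Definition os_res (w : OS R M) : OS R (contract M (val a)) :=
  \pi_(OS R (contract M (val a))) (ext_res (repr w)).

End Residue.

Section CanonicalForms.
Variable R : comPzRingType.

(* Only the values at oriented pairs (M, chi) matter. *)
Definition assignment : Type :=
  forall (V : finType) (M : sgsystem V) (r : nat)
    (chi : {ffun r.-tuple V -> int}), OS R M.

(* [ord B] is the chosen ordering of the basis B. *)
Definition triangulation_form (V : finType) (M : sgsystem V) (r : nat)
    (chi : {ffun r.-tuple V -> int}) (Delta : {set {set V}})
    (ord : {set V} -> r.-tuple V) : OS R M :=
  \sum_(B in Delta) os_bdry (os_elt R M (ord B)) *~ chi (ord B).

Definition rank_one_axiom (Om : assignment) : Prop :=
  forall (V : finType) (M : sgsystem V) (chi : {ffun 1.-tuple V -> int}),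
    oriented_pair M chi ->
    (~ acyclic M -> Om V M 1 chi = 0) /\
    (acyclic M -> forall i, i \in ground M ->
       Om V M 1 chi = os_one R M *~ chi [tuple i]).

(* M/a has rank 0 when M has rank 1: Om is then not defined at M/a, and the
   residue, of degree -1, is just 0. *)
Definition residue_axiom (Om : assignment) : Prop :=
  forall (V : finType) (M : sgsystem V) (r : nat)
    (chi : {ffun r.+1.-tuple V -> int}) (a : atom M),
    oriented_pair M chi ->
    (~ acyclic_set M (val a) -> os_res a (Om V M r.+1 chi) = 0) /\
    (acyclic_set M (val a) -> (0 < r)%N -> forall i, i \in val a ->
       os_res a (Om V M r.+1 chi) =
       Om V (contract M (val a)) r (chi_contract chi i)).

Definition canonical_assignment (Om : assignment) : Prop :=
  [/\ forall (V : finType) (M : sgsystem V) (r : nat)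
        (chi : {ffun r.-tuple V -> int}),
        oriented_pair M chi -> reduced_OS r.-1 (Om V M r chi),
      rank_one_axiom Om
    & residue_axiom Om].

End CanonicalForms.

(* Main.v *)
(* An element of positive degree of the Orlik-Solomon algebra whose residues all vanish is
   zero: write it in no-broken-circuit monomials for a linear order; those containing the
   largest atom a have for residues distinct no-broken-circuit monomials of M/a. This gives
   the uniqueness, by induction on the rank.
   The residue at a of the form of a triangulation Delta is the sum of the forms of the links
   of the elements of a that are vertices of Delta. At most two elements of a are vertices,
   and they are opposite if there are two. A simultaneous induction on the rank then shows
   that the form does not depend on Delta and vanishes if M is not acyclic. The geometric
   input is that an atom with an acyclic contraction has a vertex of Delta in each parallel
   class of its elements; the existence of Delta is witnessed by the lexicographic
   triangulation. *)

From HB Require Import structures.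
From mathcomp Require Import all_boot all_order all_algebra perm boolp.
From mathcomp Require Import zify.
Require Import Defs.

Set Implicit Arguments.
Unset Strict Implicit.
Unset Printing Implicit Defensive.

(** * The underlying matroid *)

(** The conditions on a triangulation are local: nothing in them says that it reaches a given facet
    or extreme vertex. Both facts are proved by one induction on the size of the ground set.
    Independence of the triangulation and vanishing without acyclicity need each other. If an
    acyclic atom a contains no vertex of Delta, the residue at a is zero and has to equal the form
    of M/a, which is then not acyclic. If a contains two vertices, their links triangulate the same
    M/a with opposite chirotopes, and they cancel only because the form of M/a is independent of its
    triangulation. Oriented matroids are given by circuits alone, so cocircuits, the Farkas
    alternative and the axioms for M/a all have to be extracted from circuit elimination. *)

Section Matroid.
Variables (V : finType) (M : sgsystem V).
Hypothesis omM : oriented_matroid M.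
Implicit Types (X Y Z : sgset V) (S T I J B F : {set V}).

Lemma supp_sopp (W : finType) (X : sgset W) : supp (sopp X) = supp X.
Proof. by rewrite /supp setUC. Qed.

Lemma soppK (W : finType) : involutive (@sopp W).
Proof. by case. Qed.

Lemma mem_supp (W : finType) (X : sgset W) i :
  (i \in supp X) = (i \in pos X) || (i \in neg X).
Proof. by rewrite inE. Qed.

Lemma sgset_eq (W : finType) (X Y : sgset W) : pos X = pos Y -> neg X = neg Y -> X = Y.
Proof. by case: X Y => [p n] [p' n'] /= -> ->. Qed.

Lemma circ_ground X : X \in circuits M -> supp X \subset ground M.
Proof. by case: omM => h _ _ _ _ /h /andP[]. Qed.

Lemma circ_disj X : X \in circuits M -> [disjoint pos X & neg X].
Proof. by case: omM => h _ _ _ _ /h /andP[]. Qed.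

Lemma circ_posN X i : X \in circuits M -> i \in pos X -> i \notin neg X.
Proof. by move=> /circ_disj /disjointFr h /h ->. Qed.

Lemma circ_negP X i : X \in circuits M -> i \in neg X -> i \notin pos X.
Proof. by move=> /circ_disj /disjointFl h /h ->. Qed.

Lemma circ_neq0 X : X \in circuits M -> supp X != set0.
Proof.
case: omM => _ h _ _ _ hX; apply: contraNneq h => /eqP.
by rewrite /supp setU_eq0 => /andP[/eqP p0 /eqP n0]; case: X hX p0 n0 => p n /= hX p0 n0; rewrite p0 n0 in hX.
Qed.

Lemma circ_opp X : X \in circuits M -> sopp X \in circuits M.
Proof. by case: omM => _ _ h _ _; exact: h. Qed.

Lemma circ_eq X Y : X \in circuits M -> Y \in circuits M ->
  supp X \subset supp Y -> X = Y \/ X = sopp Y.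
Proof. by case: omM => _ _ _ h _; exact: h. Qed.

Lemma circ_supp_eq X Y : X \in circuits M -> Y \in circuits M ->
  supp X \subset supp Y -> supp X = supp Y.
Proof. by move=> hX hY /(circ_eq hX hY) [->|->] //; rewrite supp_sopp. Qed.

Lemma circ_elim e X Y : X \in circuits M -> Y \in circuits M ->
    e \in pos X -> e \in neg Y -> X <> sopp Y ->
  exists Z, [/\ Z \in circuits M, pos Z \subset (pos X :|: pos Y) :\ e
              & neg Z \subset (neg X :|: neg Y) :\ e].
Proof.
by case: omM => _ _ _ _ h hX hY eX eY ne; apply: h => //; rewrite inE eX.
Qed.

(** Passing to opposites makes the signs at e differ; unequal supports exclude the case X = -Y in
    which signed elimination says nothing. *)
Lemma circ_elim_supp e X Y : X \in circuits M -> Y \in circuits M ->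
    e \in supp X -> e \in supp Y -> supp X != supp Y ->
  exists2 Z, Z \in circuits M & supp Z \subset (supp X :|: supp Y) :\ e.
Proof.
have main X' Y' : X' \in circuits M -> Y' \in circuits M -> e \in pos X' ->
    e \in neg Y' -> supp X' != supp Y' ->
    exists2 Z, Z \in circuits M & supp Z \subset (supp X' :|: supp Y') :\ e.
  move=> hX hY eX eY ne.
  have [|Z [hZ p n]] := circ_elim hX hY eX eY.
    by move=> eq; move: ne; rewrite eq supp_sopp eqxx.
  exists Z => //; rewrite {1}/supp subUset; apply/andP; split.
    by apply: subset_trans p (setSD _ _); rewrite setUSS // subsetUl.
  by apply: subset_trans n (setSD _ _); rewrite setUSS // subsetUr.
move=> hX hY; rewrite !mem_supp => /orP[eX|eX] /orP[eY|eY] ne.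
- by have := main X (sopp Y) hX (circ_opp hY) eX eY; rewrite supp_sopp; apply.
- exact: main.
- have := main (sopp X) (sopp Y) (circ_opp hX) (circ_opp hY) eX eY.
  by rewrite !supp_sopp; apply.
- by have := main (sopp X) Y (circ_opp hX) hY eX eY; rewrite supp_sopp; apply.
Qed.

Lemma indepP S : reflect (S \subset ground M /\
  forall X, X \in circuits M -> ~~ (supp X \subset S)) (indep M S).
Proof. by apply: (iffP andP) => -[-> /forall_inP]. Qed.

Lemma indep_ground S : indep M S -> S \subset ground M.
Proof. by case/andP. Qed.

Lemma indep_circ S X : indep M S -> X \in circuits M -> ~~ (supp X \subset S).
Proof. by move=> /indepP[_]; apply. Qed.

Lemma depP S : S \subset ground M -> ~~ indep M S ->
  exists2 X, X \in circuits M & supp X \subset S.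
Proof.
rewrite /indep => -> /=; rewrite negb_forall_in => /exists_inP[X hX].
by rewrite negbK; exists X.
Qed.

Lemma indepS S T : S \subset T -> indep M T -> indep M S.
Proof.
move=> sST /indepP[gT hT]; apply/indepP; split; first exact: subset_trans gT.
by move=> X /hT; apply: contra => /subset_trans; apply.
Qed.

Lemma indep0 : indep M set0.
Proof.
apply/indepP; split=> [|X hX]; first exact: sub0set.
by rewrite subset0; exact: circ_neq0.
Qed.

Lemma circ_mem_ext I e X : indep M I -> X \in circuits M ->
  supp X \subset e |: I -> e \in supp X.
Proof.
move=> hI hX sX; apply: contraT => neX.
have/negP[] := indep_circ hI hX.
by apply/subsetP => x xX; have /setU1P[xe|//] := subsetP sX x xX; rewrite -xe xX in neX.
Qed.

(** Both circuits contain e; if their supports differed, eliminating e would leave a circuit inside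
    I. *)
Lemma circ_ext_supp_uniq I e X Y : indep M I -> X \in circuits M -> Y \in circuits M ->
  supp X \subset e |: I -> supp Y \subset e |: I -> supp X = supp Y.
Proof.
move=> hI hX hY sX sY; apply/eqP; apply: contraT => ne.
have eX := circ_mem_ext hI hX sX; have eY := circ_mem_ext hI hY sY.
have [Z hZ sZ] := circ_elim_supp hX hY eX eY ne.
have/negP[] := indep_circ hI hZ.
apply: (subset_trans sZ); apply/subsetP=> x; rewrite !inE => /andP[xe].
by move=> /orP[] /orP[] h; [have := subsetP sX x|have := subsetP sX x
  |have := subsetP sY x|have := subsetP sY x]; rewrite !inE h ?orbT (negPf xe) => /(_ isT).
Qed.

Lemma circ_ext_uniq I e X Y : indep M I -> X \in circuits M -> Y \in circuits M ->
    supp X \subset e |: I -> supp Y \subset e |: I ->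
  X = Y \/ X = sopp Y.
Proof.
by move=> hI hX hY sX sY; apply: circ_eq => //; rewrite (circ_ext_supp_uniq hI hX hY sX sY).
Qed.

Lemma indep_exchange I e f X : indep M I -> e \in ground M -> X \in circuits M ->
  supp X \subset e |: I -> f \in supp X -> indep M ((e |: I) :\ f).
Proof.
move=> hI ge hX sX fX.
have gI: e |: I \subset ground M by rewrite subUset sub1set ge indep_ground.
apply: contraT => /depP[|Y hY sY].
  by apply: subset_trans gI; rewrite subD1set.
have sY': supp Y \subset e |: I by apply: subset_trans sY _; rewrite subD1set.
by move: (subsetP sY f); rewrite -(circ_ext_supp_uniq hI hX hY sX sY') fX !inE eqxx => /(_ isT).
Qed.

(** Induction on the part of I outside J. If j in J does not extend I, exchange it for some f
    outside J on the circuit of j; the set I' obtained is closer to J and extends by some j'. This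
    j' extends I as well: a circuit in j' and I would, after elimination of f, give one in j' and
    I'. *)
Lemma indep_aug I J : indep M I -> indep M J -> #|I| < #|J| ->
  exists2 j, j \in J :\: I & indep M (j |: I).
Proof.
have [n] := ubnP #|I :\: J|; elim: n I => // n IHn I ltn hI hJ ltIJ.
have [j jJI]: exists j, j \in J :\: I.
  apply/set0Pn; rewrite setD_eq0; apply: contraL ltIJ => /subset_leq_card.
  by rewrite -leqNgt.
have [jJ jI] : j \in J /\ j \notin I by move: jJI; rewrite inE => /andP[].
have [|nind] := boolP (indep M (j |: I)); first by exists j.
have gj : j \in ground M by apply: (subsetP (indep_ground hJ)).
have [|X hX sX] := depP _ nind.
  by rewrite subUset sub1set gj indep_ground.
have jX : j \in supp X by exact: circ_mem_ext sX.
have [f fX fJ] : exists2 f, f \in supp X & f \notin J.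
  by apply/subsetPn; exact: indep_circ.
have fI : f \in I.
  by have := subsetP sX f fX; case/setU1P => // ef; rewrite ef jJ in fJ.
have jf : j != f by apply: contraNneq fJ => <-.
pose I' := (j |: I) :\ f.
have hI' : indep M I' by exact: indep_exchange hX sX fX.
have cI' : #|I'| = #|I|.
  by have := cardsD1 f (j |: I); rewrite !inE fI orbT cardsU1 jI add1n => -[->].
have [||||j' j'J hj'] := IHn I' => //.
- rewrite ltnS in ltn; apply: leq_trans ltn; apply/proper_card/properP; split.
    by apply/subsetP => x; rewrite !inE => /andP[xJ /andP[_ /predU1P[xj|->]]]; [rewrite xj jJ in xJ|rewrite xJ].
  by exists f; rewrite !inE ?eqxx ?andbF // fI fJ.
- by rewrite cI'.
have j'I : j' \notin I.
  move: j'J; rewrite !inE negb_and negbK => /andP[/orP[/eqP->|]].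
    by rewrite (negPf fJ).
  by rewrite negb_or => /andP[].
have j'J' : j' \in J by move: j'J; rewrite inE => /andP[].
exists j'; first by rewrite inE j'I.
apply: contraT => /depP[|Y hY sY].
  by rewrite subUset sub1set indep_ground // (subsetP (indep_ground hJ)).
have j'j : j' != j by apply: contraTneq j'J => ->; rewrite !inE eqxx jf.
have [fY|fY] := boolP (f \in supp Y).
  have [|Z hZ sZ] := circ_elim_supp hX hY fX fY.
    apply: contraTneq jX => ->; apply: contra jI => /(subsetP sY).
    by rewrite !inE eq_sym (negPf j'j).
  have/negP[] := indep_circ hj' hZ; apply: (subset_trans sZ).
  apply/subsetP => x; rewrite in_setD1 in_setU => /andP[xf /orP[/(subsetP sX)|/(subsetP sY)]].
    by rewrite !inE xf => ->; rewrite orbT.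
  by rewrite !inE xf => /orP[->|->]; rewrite ?orbT.
have/negP[] := indep_circ hj' hY.
apply/subsetP => x xY; have := subsetP sY x xY; rewrite !inE => /orP[->//|->].
by rewrite orbT andbT; apply/orP; right; apply: contraNneq fY => <-.
Qed.

Lemma rk_ge I S : I \subset S -> indep M I -> #|I| <= rk M S.
Proof. by move=> sI hI; rewrite /rk (bigD1 I) ?sI //= leq_maxl. Qed.

Lemma rk_ex S : exists I, [/\ I \subset S, indep M I & #|I| = rk M S].
Proof.
have P0 : (set0 \subset S) && indep M set0 by rewrite sub0set indep0.
rewrite /rk; case: (@eq_bigmax_cond _ (fun I : {set V} => (I \subset S) && indep M I)
   (fun I => #|I|)) => [|I PI ->]; first by apply/card_gt0P; exists set0.
by have /andP[sI hI] : (I \subset S) && indep M I := PI; exists I.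
Qed.

Lemma basis_ext I S : I \subset S -> indep M I ->
  exists J, [/\ I \subset J, J \subset S, indep M J & #|J| = rk M S].
Proof.
have [n] := ubnP (rk M S - #|I|); elim: n I => // n IHn I ltn sI hI.
have [K [sK hK cK]] := rk_ex S.
have := rk_ge sI hI; rewrite leq_eqVlt => /orP[/eqP e|lt]; first by exists I.
have [|j jK hj] := indep_aug hI hK; first by rewrite cK.
have [jS jI] : j \in S /\ j \notin I.
  by move: jK; rewrite inE => /andP[-> /(subsetP sK)].
have [|||J [s1 s2 h c]] := IHn (j |: I).
- by rewrite cardsU1 jI add1n; move: ltn; lia.
- by rewrite subUset sub1set jS.
- by [].
by exists J; split=> //; apply: subset_trans s1; rewrite subsetUr.
Qed.

Lemma rkS S T : S \subset T -> rk M S <= rk M T.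
Proof.
by move=> sST; have [I [sI hI <-]] := rk_ex S; apply: rk_ge => //; apply: subset_trans sST.
Qed.

Lemma rk_card S : rk M S <= #|S|.
Proof. by have [I [sI _ <-]] := rk_ex S; exact: subset_leq_card. Qed.

Lemma rk_indep I : indep M I -> rk M I = #|I|.
Proof. by move=> hI; apply/eqP; rewrite eqn_leq rk_card rk_ge. Qed.

Lemma rk_max I S : indep M I -> I \subset S -> (forall e, e \in S -> e \in ground M ->
  e \notin I -> ~~ indep M (e |: I)) -> rk M S = #|I|.
Proof.
move=> hI sI max; have [J [sJ sJS hJ cJ]] := basis_ext sI hI.
apply/eqP; rewrite eqn_leq rk_ge // andbT -cJ leqNgt; apply/negP => lt.
have [j] := indep_aug hI hJ lt; rewrite inE => /andP[jI jJ]; apply/negP.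
by apply: max => //; [exact: (subsetP sJS)|exact: (subsetP (indep_ground hJ))].
Qed.

Lemma rk_ground S : rk M (S :&: ground M) = rk M S.
Proof.
apply/eqP; rewrite eqn_leq rkS ?subsetIl //=.
have [I [sI hI <-]] := rk_ex S; apply: rk_ge => //.
by rewrite subsetI sI indep_ground.
Qed.

Lemma rkU1 e S : rk M (e |: S) <= (rk M S).+1.
Proof.
have [I [sI hI <-]] := rk_ex (e |: S).
have: #|I :\ e| <= rk M S.
  apply: rk_ge; last by apply: indepS hI; rewrite subD1set.
  by apply/subsetP => x; rewrite !inE => /andP[xe /(subsetP sI)]; rewrite !inE (negPf xe).
by rewrite (cardsD1 e I); case: (e \in I) => /=; lia.
Qed.

Lemma mem_closure S I e : I \subset S -> indep M I -> #|I| = rk M S ->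
  (e \in closure M S) = (e \in ground M) && ((e \in I) || ~~ indep M (e |: I)).
Proof.
move=> sI hI cI; rewrite inE; have [ge /=|//] := boolP (e \in ground M).
apply/eqP/idP => [eq|].
  case: (boolP (e \in I)) => //= eI; apply/negP => hi.
  have := rk_ge (setUS [set e] sI) hi; by rewrite eq -cI cardsU1 eI add1n ltnn.
move=> h; rewrite -cI; apply: rk_max => //; first exact: subset_trans (subsetUr _ _).
move=> x; rewrite !inE => /orP[/eqP->|xS gx xI].
  by move=> _ eI; move: h; rewrite (negPf eI).
apply/negP => hi; have: #|x |: I| <= rk M S.
  by apply: rk_ge => //; rewrite subUset sub1set xS.
by rewrite cardsU1 xI -cI add1n ltnn.
Qed.

Lemma mem_closure_indep I e : indep M I ->
  (e \in closure M I) = (e \in ground M) && ((e \in I) || ~~ indep M (e |: I)).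
Proof. by move=> hI; apply: mem_closure => //; rewrite rk_indep. Qed.

Lemma closure_ground S : closure M S \subset ground M.
Proof. by apply/subsetP => x; rewrite inE => /andP[]. Qed.

Lemma sub_closure S : S \subset ground M -> S \subset closure M S.
Proof.
move=> gS; apply/subsetP => x xS; rewrite inE (subsetP gS) //=.
by have /setUidPr -> : [set x] \subset S by rewrite sub1set.
Qed.

(** A basis of S extended to one of the union with T stays maximal when S is replaced by its
    closure, because elements of the closure already depend on the part in S. Idempotence and
    monotonicity of the closure are read off from this. *)
Lemma rkU_closure S T : rk M (closure M S :|: T) = rk M (S :|: T).
Proof.
have [I [sI hI cI]] := rk_ex S.
have [J [sIJ sJ hJ cJ]] := basis_ext (subset_trans sI (subsetUl S T)) hI.
rewrite -cJ; have sIc : I \subset closure M S.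
  apply/subsetP => x xI; rewrite (mem_closure x sI hI cI) xI andbT.
  exact: (subsetP (indep_ground hI)).
apply: rk_max => //.
  apply/subsetP => x xJ; have := subsetP sJ x xJ; rewrite !in_setU => /orP[xS|->]; last by rewrite orbT.
  apply/orP; left; rewrite inE (subsetP (indep_ground hJ)) //=.
  by have /setUidPr -> : [set x] \subset S by rewrite sub1set.
move=> e eST ge eJ; apply/negP => hi.
have : #|e |: J| <= rk M (S :|: T) \/ e \in closure M S.
  move: eST; rewrite in_setU => /orP[eS|eT]; [by right|left].
  by apply: rk_ge hi; rewrite subUset sJ sub1set inE eT orbT.
case; first by rewrite cardsU1 eJ cJ add1n ltnn.
rewrite (mem_closure e sI hI cI) ge /= => /orP[eI|/negP[]].
  by rewrite (subsetP sIJ) in eJ.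
by apply: indepS hi; apply: setUS.
Qed.

Lemma rk_closure S : rk M (closure M S) = rk M S.
Proof. by rewrite -[closure M S]setU0 rkU_closure setU0. Qed.

Lemma closure_idem S : closure M (closure M S) = closure M S.
Proof.
apply/setP => x; rewrite [LHS]inE [RHS]inE; congr (_ && _).
by rewrite setUC rkU_closure rk_closure setUC.
Qed.

Lemma closureS S T : S \subset T -> closure M S \subset closure M T.
Proof.
move=> sST; apply/subsetP => x xS; rewrite inE (subsetP (closure_ground S)) //=.
rewrite eqn_leq [X in _ && X]rkS ?subsetUr // andbT.
have <-: rk M (closure M S :|: T) = rk M T by rewrite rkU_closure (setUidPr sST).
by rewrite rkS // setSU // sub1set.
Qed.

Lemma closure_flat S : flat M (closure M S).
Proof. by rewrite /flat closure_ground closure_idem eqxx. Qed.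

Lemma flat_closure F : flat M F -> closure M F = F.
Proof. by case/andP=> _ /eqP. Qed.

Lemma flat_ground F : flat M F -> F \subset ground M.
Proof. by case/andP. Qed.

Lemma flat_sub F S : flat M F -> S \subset F -> closure M S \subset F.
Proof. by move=> fF /closureS; rewrite (flat_closure fF). Qed.

Lemma closure_rk_eq S F : S \subset F -> flat M F -> rk M F <= rk M S -> closure M S = F.
Proof.
move=> sSF fF le; apply/eqP; rewrite eqEsubset flat_sub //=.
apply/subsetP => x xF; rewrite inE (subsetP (flat_ground fF)) //=.
rewrite eqn_leq [X in _ && X]rkS ?subsetUr // andbT (leq_trans _ le) // rkS //.
by rewrite subUset sub1set xF.
Qed.

Lemma ext_circ I e : indep M I -> e \in ground M -> ~~ indep M (e |: I) ->
  exists X, [/\ X \in circuits M, supp X \subset e |: I & e \in pos X].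
Proof.
move=> hI ge nh; have [|X hX sX] := depP _ nh.
  by rewrite subUset sub1set ge indep_ground.
have := circ_mem_ext hI hX sX; rewrite mem_supp => /orP[eX|eX].
  by exists X.
by exists (sopp X); rewrite supp_sopp circ_opp.
Qed.

Lemma basis_indep B : basis M B -> indep M B.
Proof. by case/andP. Qed.

Lemma basis_card B : basis M B -> #|B| = mrank M.
Proof. by case/andP => _ /eqP. Qed.

Lemma basis_ext_dep B e : basis M B -> e \notin B -> ~~ indep M (e |: B).
Proof.
move=> hB eB; apply/negP => hi.
have := rk_ge (indep_ground hi) hi.
by rewrite -/(mrank M) -(basis_card hB) cardsU1 eB add1n ltnn.
Qed.

Lemma fund_circ B e : basis M B -> e \in ground M -> e \notin B ->
  exists X, [/\ X \in circuits M, supp X \subset e |: B & e \in pos X].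
Proof. by move=> hB ge eB; apply: ext_circ (basis_ext_dep hB eB); rewrite ?basis_indep. Qed.

Lemma rk_mrank S : rk M S <= mrank M.
Proof. by rewrite -rk_ground rkS // subsetIr. Qed.

End Matroid.

(** * Relative signs of two signed sets *)

Definition agree (V : finType) (C D : sgset V) (i : V) : bool :=
  (i \in pos C) && (i \in pos D) || (i \in neg C) && (i \in neg D).
(** Together with [agree] this records the sign of the product C(i)D(i) as a boolean. Going through
    [sopp] lets each fact about agreement serve for opposition too. *)
Definition oppose (V : finType) (C D : sgset V) (i : V) : bool := agree (sopp C) D i.

Section Agree.
Variable V : finType.
Implicit Types C D X Y Z : sgset V.

Lemma agree_sopp C D : agree (sopp C) D =1 oppose C D.
Proof. by []. Qed.

Lemma oppose_sopp C D : oppose (sopp C) D =1 agree C D.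
Proof. by move=> i; rewrite /oppose soppK. Qed.

Lemma agreeC C D i : agree C D i = agree D C i.
Proof. by rewrite /agree andbC [(_ \in neg _) && _]andbC. Qed.

Lemma agree_soppr C D i : agree C (sopp D) i = oppose C D i.
Proof. by rewrite /oppose /agree /= orbC. Qed.

Lemma agree_supp C D i : agree C D i -> (i \in supp C) && (i \in supp D).
Proof. by rewrite !mem_supp => /orP[] /andP[-> ->]; rewrite ?orbT. Qed.

Lemma oppose_supp C D i : oppose C D i -> (i \in supp C) && (i \in supp D).
Proof. by move/agree_supp; rewrite supp_sopp. Qed.

Lemma supp_agree C D i : i \in supp C -> i \in supp D -> agree C D i || oppose C D i.
Proof.
by rewrite !mem_supp /oppose /agree /= => /orP[] -> /orP[] ->; rewrite ?orbT.
Qed.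

Lemma disj_posF C i : [disjoint pos C & neg C] -> i \in pos C -> (i \in neg C) = false.
Proof. by move=> d ip; rewrite (disjointFr d ip). Qed.

Lemma disj_negF C i : [disjoint pos C & neg C] -> i \in neg C -> (i \in pos C) = false.
Proof. by move=> d ip; rewrite (disjointFl d ip). Qed.

Lemma disj_sopp C : [disjoint pos C & neg C] -> [disjoint pos (sopp C) & neg (sopp C)].
Proof. by rewrite disjoint_sym. Qed.

Lemma agree_oppose C D i : [disjoint pos C & neg C] -> [disjoint pos D & neg D] ->
  agree C D i -> ~~ oppose C D i.
Proof.
move=> dC dD; rewrite /oppose /agree /= => /orP[] /andP[h1 h2].
  by rewrite h1 h2 !(disj_posF _ h1, disj_posF _ h2).
by rewrite h1 h2 !(disj_negF _ h1, disj_negF _ h2).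
Qed.

Lemma agreeE C D i : [disjoint pos C & neg C] -> [disjoint pos D & neg D] ->
  agree C D i = (sval_at C i * sval_at D i == 1)%R.
Proof.
move=> dC dD; rewrite /sval_at /agree.
have := @disj_posF C i dC; have := @disj_posF D i dD.
by do 4![case: (i \in _) => /=] => // h1 h2; rewrite ?(h1 isT) ?(h2 isT).
Qed.

Lemma opposeE C D i : [disjoint pos C & neg C] -> [disjoint pos D & neg D] ->
  oppose C D i = (sval_at C i * sval_at D i == - 1)%R.
Proof.
move=> dC dD; rewrite /oppose agreeE ?disj_sopp //.
have -> : sval_at (sopp C) i = (- sval_at C i)%R by rewrite /sval_at GRing.opprB.
by rewrite GRing.mulNr GRing.eqr_oppLR.
Qed.

Lemma orth_agree C D i : [disjoint pos C & neg C] -> [disjoint pos D & neg D] ->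
  orthogonal C D -> agree C D i -> exists j, oppose C D j.
Proof.
move=> dC dD [d /agree_supp/andP[iC]|[_ [j [_ h]]] _].
  by rewrite (disjointFr d iC).
by exists j; rewrite opposeE // h.
Qed.

Lemma orth_oppose C D i : [disjoint pos C & neg C] -> [disjoint pos D & neg D] ->
  orthogonal C D -> oppose C D i -> exists j, agree C D j.
Proof.
move=> dC dD [d /oppose_supp/andP[iC]|[j [_ [h _]]] _].
  by rewrite (disjointFr d iC).
by exists j; rewrite agreeE // h.
Qed.

Lemma orth_intro C D : [disjoint pos C & neg C] -> [disjoint pos D & neg D] ->
  (forall i, agree C D i -> exists j, oppose C D j) ->
  (forall i, oppose C D i -> exists j, agree C D j) -> orthogonal C D.
Proof.
move=> dC dD h1 h2; have [d|] := boolP [disjoint supp C & supp D]; first by left.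
case/pred0Pn => i /andP[iC iD]; right.
have /orP[/[dup] a /h1[j o]|/[dup] o /h2[j a]] := supp_agree iC iD.
  by exists i, j; move: a o; rewrite agreeE ?opposeE // => /eqP -> /eqP ->.
by exists j, i; move: a o; rewrite agreeE ?opposeE // => /eqP -> /eqP ->.
Qed.

Lemma no_oppose_eq X Y : [disjoint pos X & neg X] -> [disjoint pos Y & neg Y] ->
  supp X = supp Y -> (forall i, ~~ oppose X Y i) -> X = Y.
Proof.
move=> dX dY eS no.
have key (A B : sgset V) : [disjoint pos A & neg A] -> [disjoint pos B & neg B] -> supp A = supp B ->
    (forall i, ~~ oppose A B i) -> (pos A \subset pos B) && (neg A \subset neg B).
  move=> dA dB e n; have inB x : x \in supp A -> (x \in pos B) || (x \in neg B).
    by rewrite e mem_supp.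
  apply/andP; split; apply/subsetP => x xA; have := n x; rewrite /oppose /agree /= xA /=.
    by rewrite negb_or; have := inB x; rewrite mem_supp xA => /(_ isT) /orP[//|->]; rewrite andbF.
  by rewrite negb_or; have := inB x; rewrite mem_supp xA orbT => /(_ isT) /orP[->|//].
have /andP[p1 n1] := key X Y dX dY eS no.
have /andP[p2 n2] : (pos Y \subset pos X) && (neg Y \subset neg X).
  by apply: key => // i; rewrite /oppose agreeC agree_soppr.
rewrite [X]surjective_pairing [Y]surjective_pairing; congr pair; apply/eqP.
  by rewrite eqEsubset p1.
by rewrite eqEsubset n1.
Qed.

(** Each sign of Z is a sign of X or of Y, so every relation to a third signed set D is inherited; D
    is mostly a cocircuit, and sometimes Z itself. *)
Lemma elim_agree X Y Z D b i : pos Z \subset (pos X :|: pos Y) :\ b ->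
  neg Z \subset (neg X :|: neg Y) :\ b -> agree Z D i ->
  (i != b) && (agree X D i || agree Y D i).
Proof.
move=> /subsetP p /subsetP n; rewrite /agree => /orP[] /andP[].
  by move=> /p; rewrite !inE => /andP[-> /orP[->|->]] ->; rewrite ?orbT.
by move=> /n; rewrite !inE => /andP[-> /orP[->|->]] ->; rewrite ?orbT.
Qed.

Lemma elim_oppose X Y Z D b i : pos Z \subset (pos X :|: pos Y) :\ b ->
  neg Z \subset (neg X :|: neg Y) :\ b -> oppose Z D i ->
  (i != b) && (oppose X D i || oppose Y D i).
Proof.
by move=> p n; rewrite -agree_soppr => /(elim_agree p n); rewrite !agree_soppr.
Qed.

Lemma agree_trans X Y D i : [disjoint pos D & neg D] ->
  agree X D i -> oppose Y D i -> oppose X Y i.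
Proof.
move=> dD; rewrite /oppose /agree /= => /orP[] /andP[-> iD].
  by rewrite (disj_posF dD iD) andbF orbF => /andP[->]; rewrite orbT.
by rewrite (disj_negF dD iD) andbF /= => /andP[->].
Qed.

Lemma agree_refl X i : i \in supp X -> agree X X i.
Proof. by rewrite mem_supp /agree !andbb. Qed.

Lemma elim_supp X Y Z b : pos Z \subset (pos X :|: pos Y) :\ b ->
  neg Z \subset (neg X :|: neg Y) :\ b -> supp Z \subset (supp X :|: supp Y) :\ b.
Proof.
move=> p n; rewrite subUset (subset_trans p) ?(subset_trans n) // setSD // /supp.
  by rewrite setUSS // subsetUr.
by rewrite setUSS // subsetUl.
Qed.

End Agree.

(** * Cocircuits *)

Section Cocircuits.
Variables (V : finType) (M : sgsystem V).
Hypothesis omM : oriented_matroid M.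
Implicit Types (X Y Z C D : sgset V) (S T I J B F : {set V}).

Lemma circ_agree C D i : C \in circuits M -> cocircuit M D -> agree C D i ->
  exists j, oppose C D j.
Proof. by move=> hC [dD _ o]; exact: orth_agree (circ_disj omM hC) dD (o _ hC). Qed.

Lemma circ_oppose C D i : C \in circuits M -> cocircuit M D -> oppose C D i ->
  exists j, agree C D j.
Proof. by move=> hC [dD _ o]; exact: orth_oppose (circ_disj omM hC) dD (o _ hC). Qed.

Lemma cocircuit_opp D : cocircuit M D -> cocircuit M (sopp D).
Proof.
move=> [dD [H hH sH] o]; split; first by rewrite disj_sopp.
  by exists H; rewrite ?supp_sopp.
move=> C hC; have dC := circ_disj omM hC; apply: orth_intro; rewrite ?disj_sopp //.
  by move=> i; rewrite agree_soppr => /(orth_oppose dC dD (o _ hC))[j h]; exists j;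
     rewrite /oppose agree_soppr oppose_sopp.
by move=> i; rewrite /oppose agree_soppr oppose_sopp => /(orth_agree dC dD (o _ hC))[j h];
   exists j; rewrite agree_soppr.
Qed.

Lemma cocircuit_ground D : cocircuit M D -> supp D \subset ground M.
Proof. by case=> _ [H _ ->] _; exact: subsetDl. Qed.

Lemma closure_nin_indep I e : indep M I -> e \in ground M -> e \notin closure M I ->
  (e \notin I) && indep M (e |: I).
Proof. by move=> hI ge; rewrite mem_closure_indep // ge negb_or negbK. Qed.

(** Any element of a circuit depends on the others. Hence a circuit cannot leave a flat in exactly
    one element. *)
Lemma circ_closure2 I X e : indep M I -> X \in circuits M -> e \in supp X ->
  e \notin closure M I -> exists f, [/\ f \in supp X, f != e & f \notin closure M I].
Proof.
move=> hI hX eX eI.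
have ge : e \in ground M := subsetP (circ_ground omM hX) e eX.
have /subsetPn[f fX] : ~~ (supp X \subset e |: closure M I).
  apply/negP => sX.
  have hr : indep M (supp X :\ e).
    apply: contraT => /(depP); rewrite (subset_trans (subD1set _ _)) ?(circ_ground omM) // => /(_ isT).
    case=> Y hY sY; have := circ_supp_eq omM hY hX (subset_trans sY (subD1set _ _)).
    by move=> eq; move: (subsetP sY e); rewrite eq eX !inE eqxx => /(_ isT).
  have: e \in closure M (supp X :\ e).
    rewrite mem_closure_indep // ge setD1K //; apply/orP; right.
    by apply/negP => /indep_circ -/(_ _ hX) /negP[].
  have sub: closure M (supp X :\ e) \subset closure M I.
    rewrite -(closure_idem omM I); apply: closureS => //.
    by apply/subsetP => x /setD1P[xe /(subsetP sX)]; rewrite in_setU1 (negPf xe).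
  by move/(subsetP sub); rewrite (negPf eI).
by rewrite in_setU1 negb_or => /andP[fe fI]; exists f.
Qed.

Lemma circ_elim_oppose X Y i : X \in circuits M -> Y \in circuits M -> X <> sopp Y ->
  oppose X Y i -> exists Z, [/\ Z \in circuits M,
    pos Z \subset (pos X :|: pos Y) :\ i & neg Z \subset (neg X :|: neg Y) :\ i].
Proof.
move=> hX hY ne /orP[] /andP[iX iY]; last exact: circ_elim.
rewrite setUC [neg X :|: _]setUC; apply: circ_elim => //.
by move=> eq; apply: ne; rewrite eq soppK.
Qed.

Section Construction.
Variables (I0 : {set V}) (b : V).
Hypotheses (hI0 : indep M I0) (cI0 : #|I0|.+1 = mrank M).
Hypotheses (gb : b \in ground M) (bI0 : b \notin closure M I0).
Let H := closure M I0.

(* Orthogonality to the circuit in e |: (b |: I0) forces the sign at e. *)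
Definition coc_neg : {set V} := [set e in ground M :\: H | (e != b) &&
  [exists X in circuits M, [&& supp X \subset e |: (b |: I0), b \in pos X & e \in pos X]]].
Definition coc : sgset V := (ground M :\: H :\: coc_neg, coc_neg).

Lemma coc_disj : [disjoint pos coc & neg coc].
Proof. by rewrite /= disjoint_sym disjoints_subset setCD subsetUr. Qed.

Lemma coc_supp : supp coc = ground M :\: H.
Proof.
apply/setP => x; rewrite mem_supp /= in_setD; case xn: (x \in coc_neg) => //=.
  by move: xn; rewrite inE => /andP[].
by rewrite orbF.
Qed.

Lemma coc_b : b \in pos coc.
Proof. by rewrite /= in_setD [b \in coc_neg]inE eqxx andbF in_setD bI0 gb. Qed.

Let basis_of_H I := [/\ indep M I, I \subset H & #|I| = #|I0|].

Lemma basisH_closure I : basis_of_H I -> closure M I = H.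
Proof.
case=> hI sI cI; apply: closure_rk_eq => //; first exact: closure_flat.
by rewrite rk_closure // !rk_indep // cI.
Qed.

Lemma basisH_ext I e : basis_of_H I -> e \in supp coc ->
  [/\ e \notin I, indep M (e |: I) & basis M (e |: I)].
Proof.
move=> hb; rewrite coc_supp inE -(basisH_closure hb) => /andP[eI ge].
have [hI sI cI] := hb; have /andP[nI hi] := closure_nin_indep hI ge eI.
by rewrite /basis hi cardsU1 nI add1n cI cI0 eqxx.
Qed.

Lemma basisH_circ I e f X : basis_of_H I -> X \in circuits M ->
  supp X \subset e |: (f |: I) -> e \in supp coc -> f \in supp coc -> e != f ->
  (e \in supp X) && (f \in supp X).
Proof.
move=> hb hX sX he hf ef.
have [_ hi _] := basisH_ext hb he; have [_ hi' _] := basisH_ext hb hf.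
by rewrite (circ_mem_ext hi' hX sX) /= (circ_mem_ext hi hX) // setUCA.
Qed.

(** Orthogonality for the circuits with only two elements off H. It is first obtained for I0, then
    carried to all bases of H by exchanges, and general circuits are reduced to it. *)
Let pairs I := forall e f X, e \in supp coc -> f \in supp coc -> e != f ->
  X \in circuits M -> supp X \subset e |: (f |: I) -> agree X coc e -> oppose X coc f.

Lemma basisH0 : basis_of_H I0.
Proof. by split => //; apply: sub_closure => //; apply: indep_ground. Qed.

(** The circuit in e, b and I0 is unique up to sign, so fixing its sign at b fixes the one at e: the
    choice made in [coc_neg] does not matter. *)
Lemma coc_sign e X : e \in supp coc -> e != b -> X \in circuits M ->
  supp X \subset e |: (b |: I0) -> b \in pos X -> (e \in neg coc) = (e \in pos X).
Proof.
move=> he eb hX sX bX.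
have eH : e \in ground M :\: H by rewrite -coc_supp.
have bs : b \in supp coc by rewrite mem_supp coc_b.
have [_ hi _] := basisH_ext basisH0 bs.
rewrite [LHS]inE eH eb /=; apply/exists_inP/idP => [[Y hY /and3P[sY bY eY]]|eX].
  have [<-//|e2] := circ_ext_uniq omM hi hY hX sY sX.
  by move: bY; rewrite e2 /= => /(circ_negP omM hX); rewrite bX.
by exists X => //; rewrite sX bX.
Qed.

Lemma pairs0_b f X : f \in supp coc -> f != b -> X \in circuits M ->
  supp X \subset f |: (b |: I0) -> agree X coc b -> oppose X coc f.
Proof.
move=> hf fb hX sX.
have bneg : (b \in neg coc) = false by rewrite (disj_posF coc_disj coc_b).
rewrite /agree bneg andbF orbF => /andP[bX _].
have := coc_sign hf fb hX sX bX.
have: f \in supp X.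
  have bs : b \in supp coc by rewrite mem_supp coc_b.
  by have /andP[] := basisH_circ basisH0 hX sX hf bs fb.
move: hf; rewrite !mem_supp /oppose /agree /=.
case fp: (f \in pos coc); case fn: (f \in neg coc) => //= _.
- by rewrite (disj_posF coc_disj fp) in fn.
- by case/orP => -> //; case: (f \in neg X).
- by move=> _ <-; rewrite orbT.
Qed.

Lemma pairs0_bC f X : f \in supp coc -> f != b -> X \in circuits M ->
  supp X \subset f |: (b |: I0) -> agree X coc f -> oppose X coc b.
Proof.
move=> hf fb hX sX a; have bs : b \in supp coc by rewrite mem_supp coc_b.
have /andP[fX bX] := basisH_circ basisH0 hX sX hf bs fb.
have /orP[ab|//] := supp_agree bX bs.
have := pairs0_b hf fb hX sX ab; have dX := circ_disj omM hX.
by rewrite (negPf (agree_oppose dX coc_disj a)).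
Qed.

Lemma pairs0 : pairs I0.
Proof.
move=> e f X he hf ef hX sX a.
have [eb|eb] := eqVneq e b.
  by rewrite eb in a sX ef; apply: pairs0_b; rewrite // 1?eq_sym // setUCA.
have [fb|fb] := eqVneq f b; first by rewrite fb in sX *; apply: pairs0_bC a.
have bs : b \in supp coc by rewrite mem_supp coc_b.
have /andP[eX fX] := basisH_circ basisH0 hX sX he hf ef.
have /orP[af|//] := supp_agree fX hf; exfalso.
have nin g : g \in supp coc -> g \notin I0 by case/(basisH_ext basisH0).
have ex g : g \in supp coc -> g != b -> exists Y, [/\ Y \in circuits M,
    supp Y \subset g |: (b |: I0), b \in pos Y & oppose Y coc g].
  move=> hg gb'; have [_ hB _] := basisH_ext basisH0 bs.
  have [_ _ hB'] := basisH_ext basisH0 hg.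
  have [|Y [hY sY bY]] := fund_circ omM hB' gb.
    by rewrite !inE eq_sym (negPf gb') (negPf (nin _ bs)).
  rewrite setUCA in sY; exists Y; split=> //.
  by apply: pairs0_b => //; rewrite /agree bY coc_b.
have [Ye [hYe sYe bYe oe]] := ex e he eb.
have [Yf [hYf sYf bYf of_]] := ex f hf fb.
(* Eliminating b between the circuits that define the signs at e and at f leaves the circuit on e, f
   and I0, with the required opposite behaviour at the two elements; X is this circuit up to
   sign. *)
have [|Z [hZ pZ nZ]] := circ_elim omM hYe (circ_opp omM hYf) bYe (bYf : b \in neg (sopp Yf)).
  rewrite soppK => eq; have := subsetP sYf e.
  have -> : e \in supp Yf by rewrite -eq; case/andP: (oppose_supp oe).
  by rewrite !inE (negPf ef) (negPf eb) (negPf (nin _ he)) => /(_ isT).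
have sZ : supp Z \subset e |: (f |: I0).
  apply: subset_trans (elim_supp pZ nZ) _; apply/subsetP => x.
  rewrite in_setD1 in_setU supp_sopp => /andP[xb /orP[/(subsetP sYe)|/(subsetP sYf)]];
  by rewrite !inE (negPf xb) /= => /orP[]->; rewrite ?orbT.
have /andP[eZ fZ] := basisH_circ basisH0 hZ sZ he hf ef.
have dZ := circ_disj omM hZ.
have oZ : oppose Z coc e.
  have /orP[h|//] := supp_agree eZ he.
  have /andP[_ /orP[h1|h1]] := elim_agree pZ nZ h.
    by rewrite (negPf (agree_oppose (circ_disj omM hYe) coc_disj h1)) in oe.
  have /andP[] := agree_supp h1; rewrite supp_sopp => /(subsetP sYf).
  by rewrite !inE (negPf ef) (negPf eb) (negPf (nin _ he)).
have aZ : agree Z coc f.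
  have /orP[//|h] := supp_agree fZ hf.
  have /andP[_ /orP[h1|h1]] := elim_oppose pZ nZ h.
    have /andP[] := oppose_supp h1 => /(subsetP sYe).
    by rewrite !inE (eq_sym f) (negPf ef) (negPf fb) (negPf (nin _ hf)).
  rewrite oppose_sopp in h1.
  by rewrite (negPf (agree_oppose (circ_disj omM hYf) coc_disj h1)) in of_.
have [_ hi _] := basisH_ext basisH0 hf.
have [eq|eq] := circ_ext_uniq omM hi hX hZ sX sZ.
  by rewrite eq in a; rewrite (negPf (agree_oppose dZ coc_disj a)) in oZ.
rewrite eq in af; have := agree_oppose (disj_sopp dZ) coc_disj af.
by rewrite oppose_sopp aZ.
Qed.

(* The union of the circuits for I and for h |: (I :\ g) has nullity 2, where weak
   elimination determines the result. *)
Lemma pairs_step I g h : basis_of_H I -> g \in I -> h \notin I ->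
  basis_of_H (h |: (I :\ g)) -> pairs I -> pairs (h |: (I :\ g)).
Proof.
set I' := h |: (I :\ g) => bI gI hI bI' PI e f X' he hf ef hX' sX' a'.
have /andP[eX' fX'] := basisH_circ bI' hX' sX' he hf ef.
have /orP[af'|//] := supp_agree fX' hf; exfalso.
have [eI hieI beI] := basisH_ext bI he; have [fI hifI bfI] := basisH_ext bI hf.
have [eI' hieI' beI'] := basisH_ext bI' he; have [fI' hifI' bfI'] := basisH_ext bI' hf.
have [X [hX sX a]] : exists X, [/\ X \in circuits M, supp X \subset e |: (f |: I) & agree X coc e].
  have [||Y [hY sY _]] := fund_circ omM bfI (_ : e \in ground M).
  - by move: he; rewrite coc_supp => /setDP[].
  - by rewrite !inE (negPf ef).
  have /andP[eY _] := basisH_circ bI hY sY he hf ef.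
  have /orP[|o] := supp_agree eY he; first by exists Y.
  by exists (sopp Y); rewrite circ_opp // supp_sopp.
have o : oppose X coc f by apply: (PI e f).
have dX := circ_disj omM hX; have dX' := circ_disj omM hX'.
have gI' : g \notin I' by rewrite !inE eqxx /= orbF; apply: contraNneq hI => <-.
have hnin x : x \in I -> (x \in e |: (f |: I)) by rewrite !inE => ->; rewrite !orbT.
have XX' : X' <> X /\ X' <> sopp X.
  split=> eq.
    by rewrite eq in af'; rewrite (negPf (agree_oppose dX coc_disj af')) in o.
  rewrite eq in a'; have := agree_oppose (disj_sopp dX) coc_disj a'.
  by rewrite oppose_sopp a.
have hX'in : h \in supp X'.
  apply: contraT => nh; have sX2 : supp X' \subset e |: (f |: I).
    apply/subsetP => x xX; have := subsetP sX' x xX; rewrite !inE.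
    case: (eqVneq x h) => [xh|_ /=]; first by rewrite -xh xX in nh.
    by case/or3P => [->|->|/andP[_ ->]]; rewrite ?orbT.
  by case: (circ_ext_uniq omM hifI hX' hX sX2 sX) => eq; case: XX'; rewrite eq.
have gXin : g \in supp X.
  apply: contraT => ng; have sX2 : supp X \subset e |: (f |: I').
    apply/subsetP => x xX; have := subsetP sX x xX; rewrite !inE.
    case: (eqVneq x g) => [xg|_ /=]; first by rewrite -xg xX in ng.
    by case/or3P => [->|->|->]; rewrite ?orbT.
  by case: (circ_ext_uniq omM hifI' hX' hX sX' sX2) => eq; case: XX'; rewrite eq.
have hX0 : h \notin supp X.
  apply/negP => /(subsetP sX); rewrite !inE (negPf hI) orbF.
  by move=> /orP[] /eqP eq; [move: eI'|move: fI']; rewrite -eq !inE eqxx.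
have gX0 : g \notin supp X'.
  apply/negP => /(subsetP sX'); rewrite in_setU1 in_setU1 (negPf gI') orbF.
  by move=> /orP[] /eqP eq; [move: eI|move: fI]; rewrite -eq gI.
have [iI sIH _] := bI; have [iI' sIH' _] := bI'.
(* The circuit leaves H in at most the element x, hence not at all. *)
have inH Z x : Z \in circuits M -> x \in supp coc -> supp Z \subset x |: (h |: I) -> supp Z \subset h |: I.
  move=> hZ hx sZ; have xH : x \notin closure M I.
    by rewrite basisH_closure //; move: hx; rewrite coc_supp inE => /andP[].
  have [xZ|xZ] := boolP (x \in supp Z); last first.
    by apply/subsetP => y yZ; case/setU1P: (subsetP sZ y yZ) => // yx; rewrite -yx yZ in xZ.
  have [y [yZ yx]] := circ_closure2 iI hZ xZ xH; rewrite basisH_closure //.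
  have : y \in h |: I by case/setU1P: (subsetP sZ y yZ) => // eq; rewrite eq eqxx in yx.
  by case/setU1P => [->|/(subsetP sIH) ->//]; rewrite (subsetP sIH') // !inE eqxx.
have dc := coc_disj.
(* [Z1] eliminates f from X' and X, [Z2] eliminates e from X' and -X. Both lie in h and I, so they
   are equal up to sign. At h both have the sign of X', since X misses h; at g one has the sign of X
   and the other that of -X, since X' misses g. This is impossible. *)
have [Z1 [hZ1 pZ1 nZ1]] := circ_elim_oppose hX' hX (proj2 XX') (agree_trans dc af' o).
have oX' : oppose (sopp X) coc e by rewrite oppose_sopp.
have [|Z2 [hZ2 pZ2 nZ2]] := circ_elim_oppose hX' (circ_opp omM hX) _ (agree_trans dc a' oX').
  by rewrite soppK; exact: (proj1 XX').
have sZ1 : supp Z1 \subset h |: I.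
  apply: (inH _ e) => //; apply: (subset_trans (elim_supp pZ1 nZ1)).
  apply/subsetP => x; rewrite in_setD1 in_setU => /andP[xf /orP[/(subsetP sX')|/(subsetP sX)]];
  rewrite !inE (negPf xf) /=; first by case/or3P => [->|->|/andP[_ ->]]; rewrite ?orbT.
  by case/orP => ->; rewrite ?orbT.
have sZ2 : supp Z2 \subset h |: I.
  apply: (inH _ f) => //; apply: (subset_trans (elim_supp pZ2 nZ2)).
  apply/subsetP => x; rewrite in_setD1 in_setU supp_sopp => /andP[xe /orP[/(subsetP sX')|/(subsetP sX)]];
  rewrite !inE (negPf xe) /=; first by case/or3P => [->|->|/andP[_ ->]]; rewrite ?orbT.
  by case/orP => ->; rewrite ?orbT.
have hgI : h |: I = g |: I' by rewrite /I' [RHS]setUCA setD1K.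
have hZ1in : h \in supp Z1 := circ_mem_ext iI hZ1 sZ1.
have gZ1in : g \in supp Z1 by rewrite hgI in sZ1; exact: (circ_mem_ext iI' hZ1 sZ1).
have hZ2in : h \in supp Z2 := circ_mem_ext iI hZ2 sZ2.
have gZ2in : g \in supp Z2 by rewrite hgI in sZ2; exact: (circ_mem_ext iI' hZ2 sZ2).
have notin W x Y : x \notin supp W -> ~~ agree W Y x by apply: contra => /agree_supp/andP[].
have := elim_agree pZ1 nZ1 (agree_refl hZ1in); rewrite (negPf (notin _ _ _ hX0)) orbF => /andP[_ h1].
have := elim_agree pZ1 nZ1 (agree_refl gZ1in); rewrite (negPf (notin _ _ _ gX0)) /= => /andP[_ g1].
have hX0' : h \notin supp (sopp X) by rewrite supp_sopp.
have := elim_agree pZ2 nZ2 (agree_refl hZ2in); rewrite (negPf (notin _ _ _ hX0')) orbF => /andP[_ h2].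
have := elim_agree pZ2 nZ2 (agree_refl gZ2in); rewrite (negPf (notin _ _ _ gX0)) /= => /andP[_ g2].
case: (circ_ext_uniq omM iI hZ1 hZ2 sZ1 sZ2) => eq.
  rewrite eq in g1; have := agree_oppose dX (circ_disj omM hZ2) g1.
  by rewrite -agree_sopp g2.
rewrite eq agree_soppr in h1; have := agree_oppose dX' (circ_disj omM hZ2) h2.
by rewrite h1.
Qed.

(** Exchanging an element of I outside I0 for one of I0 brings I closer to I0 among the bases of H,
    and [pairs_step] goes back along the exchange. *)
Lemma pairs_all I : basis_of_H I -> pairs I.
Proof.
have [n] := ubnP #|I :\: I0|; elim: n I => // n IHn I ltn bI.
have [hI sI cI] := bI.
have [/eqP|[h]] := set_0Vmem (I :\: I0).
  rewrite setD_eq0 => s; have /eqP -> : I == I0 by rewrite eqEcard s cI leqnn.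
  exact: pairs0.
rewrite inE => /andP[hI0' hIn].
have ltc : #|I :\ h| < #|I0| by rewrite -cI (cardsD1 h I) hIn add1n.
have [g gD hg] := indep_aug omM (indepS (subD1set _ _) hI) hI0 ltc.
have [gI0 gIh] : g \in I0 /\ g \notin I :\ h by move: gD; rewrite inE => /andP[].
have gh : g != h by apply: contraNneq hI0' => <-.
have gI : g \notin I by move: gIh; rewrite !inE gh.
pose I1 := g |: (I :\ h).
have bI1 : basis_of_H I1.
  split=> //; first last.
  - by rewrite cardsU1 gIh -cI (cardsD1 h I) hIn.
  - rewrite subUset sub1set (subset_trans (subD1set _ _) sI) andbT.
    by have [_ s _] := basisH0; rewrite (subsetP s).
have eq : I = h |: (I1 :\ g) by rewrite setU1K // setD1K.
rewrite eq; apply: pairs_step => //.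
- by rewrite !inE eqxx.
- by rewrite !inE eqxx /= orbF eq_sym.
- by rewrite -eq.
apply: IHn bI1; rewrite ltnS in ltn; apply: leq_trans ltn; apply/proper_card/properP; split.
  apply/subsetP => x; rewrite !inE => /andP[xI0 /predU1P[xg|/andP[_ ->]]]; last by rewrite xI0.
  by rewrite xg gI0 in xI0.
exists h; first by rewrite inE hI0' hIn.
by rewrite !inE [h == g]eq_sym (negPf gh) eqxx andbF.
Qed.

(** Suppose nothing opposes. Then C leaves H in two agreeing elements e and f. A circuit on e, f and
    a basis of H that contains the part of C in H agrees at e and opposes at f; eliminating f gives
    a circuit that still has no opposing element but meets the support of [coc] in fewer
    elements. *)
Lemma coc_orth_agree C e : C \in circuits M -> agree C coc e -> exists j, oppose C coc j.
Proof.
have [n] := ubnP #|supp C :&: supp coc|; elim: n C e => // n IHn C e ltn hC a.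
have [/existsP //|] := boolP [exists j, oppose C coc j].
rewrite negb_exists => /forallP no; exfalso.
have /andP[eC ed] := agree_supp a.
have eH : e \notin closure M I0 by move: ed; rewrite coc_supp inE => /andP[].
have [f [fC fe fH]] := circ_closure2 hI0 hC eC eH.
have fd : f \in supp coc by rewrite coc_supp inE fH (subsetP (circ_ground omM hC)).
have hCH : indep M (supp C :&: H).
  apply: contraT => /(depP) [|Y hY sY].
    by apply: (subset_trans (subsetIl _ _)); exact: circ_ground.
  have eq := circ_supp_eq omM hY hC (subset_trans sY (subsetIl _ _)).
  by move: (subsetP sY e); rewrite eq eC inE (negPf eH) andbF => /(_ isT).
have [I [sCI sIH hI cI]] := basis_ext omM (subsetIr _ _) hCH.
have bI : basis_of_H I by split=> //; rewrite cI rk_closure // rk_indep.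
have [eI hieI beI] := basisH_ext bI ed; have [fI hifI bfI] := basisH_ext bI fd.
have ef : e != f by rewrite eq_sym.
have dc := coc_disj; have dC := circ_disj omM hC.
have af : agree C coc f by have := supp_agree fC fd; rewrite (negPf (no f)) orbF.
have [X [hX sX oX]] : exists X, [/\ X \in circuits M, supp X \subset f |: (e |: I) & oppose X coc f].
  have [||Y [hY sY _]] := fund_circ omM beI (_ : f \in ground M).
  - exact: subsetP (circ_ground omM hC) f fC.
  - by rewrite !inE (negPf fe).
  have /andP[fY _] := basisH_circ bI hY sY fd ed fe.
  have /orP[o|] := supp_agree fY fd; last by exists Y.
  by exists (sopp Y); rewrite circ_opp // supp_sopp oppose_sopp.
have aX : agree X coc e.
  have := pairs_all bI fd ed fe (circ_opp omM hX); rewrite supp_sopp => /(_ sX).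
  by rewrite oppose_sopp; apply.
have [|Z [hZ pZ nZ]] := circ_elim_oppose hC hX _ (agree_trans dc af oX).
  move=> eq; rewrite eq in a; have := agree_oppose (disj_sopp (circ_disj omM hX)) dc a.
  by rewrite oppose_sopp aX.
have sZ : supp Z \subset (supp C :|: supp X) :\ f := elim_supp pZ nZ.
have noZ j : ~~ oppose Z coc j.
  apply/negP => oj; have /andP[jf /orP[o|o]] := elim_oppose pZ nZ oj; first by rewrite (negPf (no j)) in o.
  have /andP[jX jc] := oppose_supp o; have := subsetP sX j jX; rewrite !inE (negPf jf) /=.
  case/predU1P => [je|jI].
    by rewrite je in o; rewrite (negPf (agree_oppose (circ_disj omM hX) dc aX)) in o.
  by move: jc; rewrite coc_supp inE (subsetP sIH j jI).
(* Otherwise Z would lie in H, and therefore in the independent set I. *)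
have [j jZ] : exists j, j \in supp Z :&: supp coc.
  apply/set0Pn; apply: contraT; rewrite negbK => /eqP s0.
  have /negP[] := indep_circ hI hZ; apply/subsetP => x xZ.
  have xH : x \in H.
    apply: contraT => xH; have : x \in supp Z :&: supp coc.
      by rewrite inE xZ coc_supp inE xH (subsetP (circ_ground omM hZ)).
    by rewrite s0 inE.
  have := subsetP sZ x xZ; rewrite in_setD1 in_setU => /andP[xf /orP[xC|/(subsetP sX)]].
    by rewrite (subsetP sCI) // inE xC xH.
  rewrite !inE (negPf xf) /= => /predU1P[xe|//].
  by rewrite xe (negPf eH) in xH.
have /setIP[jZ1 jc] := jZ; have := supp_agree jZ1 jc; rewrite (negPf (noZ j)) orbF => aj.
have [|k] := IHn Z j _ hZ aj; last by rewrite (negPf (noZ k)).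
rewrite ltnS in ltn; apply: leq_trans ltn; apply/proper_card/properP; split; last first.
  exists f; first by rewrite inE fC fd.
  by rewrite inE negb_and; apply/orP; left; apply/negP => /(subsetP sZ); rewrite !inE eqxx.
apply/subsetP => x /setIP[xZ xc]; rewrite inE xc andbT.
have := subsetP sZ x xZ; rewrite in_setD1 in_setU => /andP[xf /orP[//|/(subsetP sX)]].
rewrite !in_setU1 (negPf xf) /= => /predU1P[->//|xI].
by move: xc; rewrite coc_supp inE (subsetP sIH x xI).
Qed.

Lemma coc_cocircuit : cocircuit M coc.
Proof.
split; first exact: coc_disj.
  exists H; last exact: coc_supp.
  by rewrite /hyperplane closure_flat // rk_closure // rk_indep // cI0 eqxx.
move=> C hC; apply: orth_intro; [exact: (circ_disj omM hC)|exact: coc_disj| |].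
  by move=> i; exact: coc_orth_agree.
move=> i oi; have [j] := coc_orth_agree (circ_opp omM hC) (oi : agree (sopp C) coc i).
by rewrite oppose_sopp; exists j.
Qed.

End Construction.

Lemma cocircuit_exists I b : indep M I -> #|I|.+1 = mrank M -> b \in ground M ->
  b \notin closure M I ->
  exists D, [/\ cocircuit M D, supp D = ground M :\: closure M I & b \in pos D].
Proof.
move=> hI cI gb bI; exists (coc I b); split; [exact: coc_cocircuit|exact: coc_supp|exact: coc_b].
Qed.

End Cocircuits.

(** * The painting lemma *)

Section Painting.
Variables (V : finType) (M : sgsystem V).
Hypothesis omM : oriented_matroid M.
Implicit Types (X Y Z C D : sgset V) (S T I J B F : {set V}).

Lemma cocircuit_disj D : cocircuit M D -> [disjoint pos D & neg D].
Proof. by case. Qed.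

Lemma basisD1 B b : basis M B -> b \in B ->
  [/\ indep M (B :\ b), #|B :\ b|.+1 = mrank M & b \notin closure M (B :\ b)].
Proof.
move=> hB bB; have hI : indep M (B :\ b) by apply: indepS (basis_indep hB); rewrite subD1set.
split=> //; first by rewrite -(basis_card hB) (cardsD1 b B) bB.
by rewrite mem_closure_indep // setD1K // (basis_indep hB) orbF !inE eqxx andbF.
Qed.

Lemma basis_ground B b : basis M B -> b \in B -> b \in ground M.
Proof. by move/basis_indep/indep_ground/subsetP => h /h. Qed.

Lemma fund_cocircuit B b : basis M B -> b \in B ->
  exists D, [/\ cocircuit M D, supp D = ground M :\: closure M (B :\ b) & b \in pos D].
Proof.
move=> hB bB; have [hI cI bc] := basisD1 hB bB.
by apply: cocircuit_exists => //; apply: basis_ground bB.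
Qed.

Lemma fund_cocircuitP B b D x : basis M B -> b \in B ->
  supp D = ground M :\: closure M (B :\ b) -> x \in B -> (x \in supp D) = (x == b).
Proof.
move=> hB bB ->; have [hI _ bc] := basisD1 hB bB.
move=> xB; rewrite inE (basis_ground hB xB) andbT.
have [->|xb] := eqVneq x b; first by rewrite bc.
by apply/negbF/(subsetP (sub_closure (indep_ground hI))); rewrite !inE xb.
Qed.

Lemma cocircuit_hyper D : cocircuit M D ->
  exists I, [/\ indep M I, #|I|.+1 = mrank M & supp D = ground M :\: closure M I].
Proof.
case=> _ [H /andP[fH /eqP rH] sD] _; have [I [sI hI cI]] := rk_ex omM H.
exists I; split=> //; first by rewrite cI.
by rewrite (closure_rk_eq omM sI fH) // (rk_indep omM hI) cI.
Qed.

Lemma cocircuit_supp D I : cocircuit M D -> indep M I -> #|I|.+1 = mrank M ->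
  [disjoint I & supp D] -> supp D = ground M :\: closure M I.
Proof.
case=> _ [H /andP[fH /eqP rH] sD] _ hI cI dI.
rewrite sD (closure_rk_eq omM _ fH) //; last first.
  by move: rH; rewrite (rk_indep omM hI) -cI => -[->].
apply/subsetP => x xI; apply: contraT => xH.
by have := disjointFr dI xI; rewrite sD inE xH (subsetP (indep_ground hI)).
Qed.

(** The Farkas alternative. On P only the sign + is allowed, on N only -; K is free for the circuit
    and zero for the cocircuit, and the remaining elements conversely. In the induction an element f
    of P or N is first moved to the remaining elements, then to K. If neither choice settles the
    matter, the first gives a cocircuit and the second a circuit, both with the forbidden sign at
    f. *)
Lemma painting (P N K : {set V}) e :
    P \subset ground M -> N \subset ground M -> K \subset ground M ->
    [disjoint P & N] -> [disjoint P & K] -> [disjoint N & K] -> e \in P ->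
  (exists C, [/\ C \in circuits M, e \in pos C, supp C \subset P :|: N :|: K,
     [disjoint neg C & P] & [disjoint pos C & N]]) \/
  (exists D, [/\ cocircuit M D, e \in pos D, [disjoint supp D & K],
     [disjoint neg D & P] & [disjoint pos D & N]]).
Proof.
have [n] := ubnP #|P :|: N|; elim: n P N K => // n IHn P N K ltn gP gN gK dPN dPK dNK eP.
have ge : e \in ground M := subsetP gP e eP.
have [/eqP|[f]] := set_0Vmem ((P :|: N) :\ e).
  rewrite setD_eq0 subUset => /andP[sP sN].
  have eqP' : P = [set e] by apply/eqP; rewrite eqEsubset sP sub1set eP.
  have eqN : N = set0.
    apply/eqP; rewrite -subset0; apply/subsetP => x xN.
    have := subsetP sN x xN; rewrite inE => /eqP xe.
    by have := disjointFr dPN eP; rewrite -xe xN.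
  have [I [sI hI cI]] := rk_ex omM K.
  have clI : closure M I = closure M K.
    apply: closure_rk_eq => //; last by rewrite rk_closure // (rk_indep omM hI) cI.
      by apply: subset_trans sI _; apply: sub_closure.
    exact: closure_flat.
  have [eK|eK] := boolP (e \in closure M I).
    left; have eI : e \notin I.
      by apply/negP => /(subsetP sI) eK'; have := disjointFr dPK eP; rewrite eK'.
    move: eK; rewrite mem_closure_indep // ge (negPf eI) /= => /(ext_circ omM hI ge) [X [hX sX eX]].
    exists X; rewrite eqP' eqN setU0; split=> //.
    - by apply: subset_trans sX _; exact: setUS.
    - rewrite disjoint_sym; apply/pred0P => x /=; rewrite inE.
      by case: eqP => //= ->; rewrite (negPf (circ_posN omM hX eX)).
    - by rewrite disjoint_sym disjoints_subset sub0set.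
  right; have /andP[eI hi] := closure_nin_indep omM hI ge eK.
  have [B [sB _ hB cB]] := basis_ext omM (indep_ground hi) hi.
  have bB : basis M B by rewrite /basis hB cB eqxx.
  have eB : e \in B by apply: (subsetP sB); rewrite !inE eqxx.
  have [D [hD sD eD]] := fund_cocircuit bB eB; have dD := cocircuit_disj hD.
  exists D; rewrite eqP' eqN; split=> //.
  - rewrite disjoint_sym; apply/pred0P => x /=; rewrite sD inE; apply/negP => /andP[xK /andP[/negP nx _]]; apply: nx.
    have xI : x \in closure M I.
      by rewrite clI; apply: (subsetP (sub_closure gK)).
    have sIB : I \subset B :\ e.
      by rewrite subsetD1 eI andbT (subset_trans _ sB) // subsetUr.
    exact: subsetP (closureS omM sIB) x xI.
  - rewrite disjoint_sym; apply/pred0P => x /=; rewrite inE.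
    by case: eqP => //= ->; rewrite (disj_posF dD eD).
  - by rewrite disjoint_sym disjoints_subset sub0set.
rewrite in_setD1 => /andP[fe fPN].
have gf : f \in ground M by move: fPN; rewrite inE => /orP[/(subsetP gP)|/(subsetP gN)].
have fK : f \notin K.
  by move: fPN; rewrite inE => /orP[/(disjointFr dPK)->|/(disjointFr dNK)->].
have gP' : P :\ f \subset ground M := subset_trans (subD1set _ _) gP.
have gN' : N :\ f \subset ground M := subset_trans (subD1set _ _) gN.
have dPN' : [disjoint P :\ f & N :\ f].
  by apply: disjointWl (subD1set _ _) (disjointWr (subD1set _ _) dPN).
have dPK' : [disjoint P :\ f & K] := disjointWl (subD1set _ _) dPK.
have dNK' : [disjoint N :\ f & K] := disjointWl (subD1set _ _) dNK.
have eP' : e \in P :\ f by rewrite !inE eq_sym fe eP.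
have ltn' : #|P :\ f :|: N :\ f| < n.
  by move: ltn; rewrite -setDUl (cardsD1 f (P :|: N)) fPN.
have djU (S : {set V}) : [disjoint S & K] -> [disjoint S :\ f & f |: K].
  move=> d; apply/pred0P => x /=; rewrite in_setD1 in_setU1.
  by case: eqP => //= _; apply/negP => /andP[xS]; rewrite (disjointFr d xS).
have dfP : [disjoint P :\ f & f |: K] := djU _ dPK.
have dfN : [disjoint N :\ f & f |: K] := djU _ dNK.
have gfK : f |: K \subset ground M by rewrite subUset sub1set gf.
have split_ A (S : {set V}) : [disjoint A & S :\ f] -> ~~ ((f \in S) && (f \in A)) -> [disjoint A & S].
  move=> d nf; apply/pred0P => x /=; apply/negP => /andP[xA xS].
  have [xf|xf] := eqVneq x f; first by rewrite xf in xA xS; rewrite xA xS in nf.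
  by have := disjointFr d xA; rewrite !inE xf xS.
have [[C [hC eC sC nC pC]]|[X [hX eX dX nX pX]]] := IHn (P :\ f) (N :\ f) K ltn' gP' gN' gK dPN' dPK' dNK' eP'.
  have fC : f \notin supp C.
    by apply/negP => /(subsetP sC); rewrite !inE eqxx (negPf fK).
  move: (fC); rewrite mem_supp negb_or => /andP[fp fn].
  left; exists C; split=> //.
  - apply: subset_trans sC _; rewrite setSU // -setDUl; exact: subD1set.
  - by apply: split_ => //; rewrite (negPf fn) andbF.
  - by apply: split_ => //; rewrite (negPf fp) andbF.
case fX: ((f \in P) && (f \in neg X) || (f \in N) && (f \in pos X)); last first.
  right; exists X; move: fX => /norP[h1 h2]; by split=> //; exact: split_.
have [[Z [hZ eZ sZ nZ pZ]]|[Y [hY eY dY nY pY]]] := IHn (P :\ f) (N :\ f) (f |: K) ltn' gP' gN' gfK dPN' dfP dfN eP'.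
  case fZ: ((f \in P) && (f \in neg Z) || (f \in N) && (f \in pos Z)); last first.
    left; exists Z; move: fZ => /norP[h1 h2]; split=> //; try exact: split_.
    apply: subset_trans sZ _; apply/subsetP => x; rewrite !inE.
    case/orP=> [/orP[/andP[_ ->]|/andP[_ ->]]|/predU1P[->|->]]; rewrite ?orbT //.
    by move: fPN; rewrite inE => /orP[->|->]; rewrite ?orbT.
  (* The circuit and the cocircuit have equal signs at e and at f, and on the rest of their common
     support both have the allowed sign, against orthogonality. *)
  have ae : agree Z X e by rewrite /agree eZ eX.
  have [j oj] := circ_agree omM hZ hX ae.
  have /andP[jZ jX] := oppose_supp oj; exfalso.
  have jK : j \notin K by rewrite (disjointFr dX jX).
  have dZ := circ_disj omM hZ; have dX' := cocircuit_disj hX.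
  have := subsetP sZ j jZ; rewrite in_setU in_setU in_setU1 (negPf jK) orbF => /orP[/orP[jP|jN]|/eqP jf].
  - move: oj; rewrite /oppose /agree /=.
    by rewrite (disjointFl nZ jP) (disjointFl nX jP) !andbF.
  - move: oj; rewrite /oppose /agree /=.
    by rewrite (disjointFl pZ jN) (disjointFl pX jN) !andbF.
  - rewrite jf in oj; move: oj; apply/negP; apply: agree_oppose => //; rewrite /agree.
    case/orP: fX => /andP[fP fX']; case/orP: fZ => /andP[fP' fZ'].
    + by rewrite fX' fZ' orbT.
    + by have := disjointFr dPN fP; rewrite fP'.
    + by have := disjointFr dPN fP'; rewrite fP.
    + by rewrite fX' fZ'.
have fY : f \notin supp Y by apply/negP => /(disjointFr dY); rewrite !inE eqxx.
move: (fY); rewrite mem_supp negb_or => /andP[fp fn].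
right; exists Y; split=> //.
- by apply: disjointWr dY; exact: subsetUr.
- by apply: split_ => //; rewrite (negPf fn) andbF.
- by apply: split_ => //; rewrite (negPf fp) andbF.
Qed.

(** The painting with every element in P: its first alternative would be a positive circuit. *)
Lemma acyclic_cocircuit e : acyclic M -> e \in ground M ->
  exists2 D, positive_cocircuit M D & e \in pos D.
Proof.
move=> ac ge.
have d0 (A : {set V}) : [disjoint A & set0] by rewrite disjoint_sym disjoints_subset sub0set.
have [[C [hC eC _ nC _]]|[D [hD eD _ nD _]]] :=
    @painting (ground M) set0 set0 e (subxx _) (sub0set _) (sub0set _) (d0 _) (d0 _) (d0 _) ge.
  case/negP: (ac C hC); rewrite -subset0; apply/subsetP => x xn.
  have := disjointFr nC xn; rewrite (subsetP (circ_ground omM hC)) //.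
  by rewrite mem_supp xn orbT.
exists D => //; split=> //; apply/eqP; rewrite -subset0; apply/subsetP => x xn.
have := disjointFr nD xn; rewrite (subsetP (cocircuit_ground hD)) //.
by rewrite mem_supp xn orbT.
Qed.

End Painting.

(** * Restriction and contraction *)

Section Restriction.
Variables (V : finType) (M : sgsystem V).
Hypothesis omM : oriented_matroid M.
Implicit Types (X Y Z C D : sgset V) (S T I J B F : {set V}).

Lemma restrict_circ S X :
  (X \in circuits (restrict M S)) = (X \in circuits M) && (supp X \subset S).
Proof. by rewrite inE. Qed.

Lemma restrict_om S : oriented_matroid (restrict M S).
Proof.
split=> [X|||X Y|X Y e].
- rewrite restrict_circ => /andP[hX sX]; rewrite (circ_disj omM hX) /=.
  by rewrite subsetI sX (circ_ground omM hX).
- by case: omM => _ h _ _ _; rewrite restrict_circ negb_and h.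
- by move=> X; rewrite !restrict_circ supp_sopp => /andP[/(circ_opp omM) -> ->].
- by rewrite !restrict_circ => /andP[hX _] /andP[hY _]; exact: (circ_eq omM hX hY).
- rewrite !restrict_circ => /andP[hX sX] /andP[hY sY] ne /setIP[eX eY].
  have [Z [hZ pZ nZ]] := circ_elim omM hX hY eX eY ne.
  exists Z; split=> //; rewrite restrict_circ hZ (subset_trans (elim_supp pZ nZ)) //.
  by rewrite (subset_trans (subD1set _ _)) // subUset sX sY.
Qed.

Lemma restrict_indep S T : indep (restrict M S) T = indep M T && (T \subset S).
Proof.
apply/idP/andP => [/indepP[/=]|[/indepP[gT hT] sT]].
  rewrite subsetI => /andP[gT sT] hT; split=> //; apply/indepP; split=> // X hX.
  apply/negP => sX; have hX' : X \in circuits (restrict M S).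
    by rewrite restrict_circ hX (subset_trans sX).
  by case/negP: (hT X hX').
apply/indepP; rewrite /= subsetI gT sT; split=> // X.
by rewrite restrict_circ => /andP[/hT].
Qed.

Lemma restrict_rk S T : T \subset S -> rk (restrict M S) T = rk M T.
Proof.
move=> sTS; apply: eq_bigl => I; rewrite restrict_indep.
by case sI: (I \subset T) => //=; rewrite (subset_trans sI) ?andbT.
Qed.

Lemma restrict_mrank S : mrank (restrict M S) = rk M S.
Proof. by rewrite /mrank /= restrict_rk ?subsetIr // setIC rk_ground. Qed.

Lemma restrict_loopless S : loopless M -> loopless (restrict M S).
Proof. by move=> ll i /setIP[gi iS]; rewrite restrict_indep ll // sub1set. Qed.

Lemma restrict_basis S B : rk M S = mrank M ->
  basis (restrict M S) B = basis M B && (B \subset S).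
Proof.
by move=> rS; rewrite /basis restrict_indep restrict_mrank rS andbAC.
Qed.

Lemma restrict_closure S I : indep M I -> I \subset S ->
  closure (restrict M S) I = closure M I :&: S.
Proof.
move=> hI sI; have hI' : indep (restrict M S) I by rewrite restrict_indep hI.
apply/setP => x; rewrite (mem_closure_indep (restrict_om S) x hI') restrict_indep.
rewrite in_setI [x \in ground _]inE mem_closure_indep //.
case xS: (x \in S); last by rewrite !andbF.
by rewrite subUset sub1set xS sI !andbT.
Qed.

Definition capS (D : sgset V) S : sgset V := (pos D :&: S, neg D :&: S).

Lemma supp_capS D S : supp (capS D S) = supp D :&: S.
Proof. by rewrite /supp setIUl. Qed.

Lemma agree_capS C D S i : i \in S -> agree C (capS D S) i = agree C D i.
Proof. by move=> iS; rewrite /agree !inE iS !andbT. Qed.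

(** The set I witnesses that the hyperplane of D is spanned by elements of S. Without this the trace
    of the hyperplane on S could have too small a rank. *)
Lemma restrict_cocircuit S I D : rk M S = mrank M -> cocircuit M D -> indep M I ->
    I \subset S -> #|I|.+1 = mrank M -> [disjoint I & supp D] ->
  cocircuit (restrict M S) (capS D S).
Proof.
move=> rS hD hI sI cI dI; have dD := cocircuit_disj hD.
have dD' : [disjoint pos (capS D S) & neg (capS D S)].
  exact: disjointWl (subsetIl _ _) (disjointWr (subsetIl _ _) dD).
have hI' : indep (restrict M S) I by rewrite restrict_indep hI.
split=> //.
  exists (closure (restrict M S) I).
    rewrite /hyperplane closure_flat ?rk_closure ?(rk_indep _ hI'); try exact: restrict_om.
    by rewrite cI restrict_mrank rS eqxx.
  rewrite supp_capS (cocircuit_supp omM hD hI cI dI) restrict_closure //=.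
  by apply/setP => x; rewrite !inE; case: (x \in S); rewrite ?andbT ?andbF.
move=> C; rewrite restrict_circ => /andP[hC sC]; have dC := circ_disj omM hC.
apply: orth_intro => // i.
  move=> a; have /andP[iC _] := agree_supp a.
  rewrite agree_capS ?(subsetP sC) // in a.
  have [j o] := circ_agree omM hC hD a; exists j; rewrite -agree_sopp agree_capS //.
  by have /andP[jC _] := oppose_supp o; exact: subsetP jC.
move=> a; have /andP[iC _] := oppose_supp a.
rewrite -agree_sopp agree_capS ?(subsetP sC) // in a.
have [j o] := circ_oppose omM hC hD a; exists j; rewrite agree_capS //.
by have /andP[jC _] := agree_supp o; exact: subsetP jC.
Qed.

Lemma restrict_acyclic S : acyclic M -> acyclic (restrict M S).
Proof. by move=> ac C; rewrite restrict_circ => /andP[/ac]. Qed.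

End Restriction.

(** * Atoms of a loopless oriented matroid *)

Section Atoms.
Variables (V : finType) (M : sgsystem V).
Hypotheses (omM : oriented_matroid M) (ll : loopless M).
Implicit Types (X Y Z C D : sgset V) (S T I J B F a b : {set V}).

Lemma atom_ground a : is_atom M a -> a \subset ground M.
Proof. by case/andP => /andP[]. Qed.

Lemma mem_atom_ground a i : is_atom M a -> i \in a -> i \in ground M.
Proof. by move/atom_ground/subsetP; apply. Qed.

Lemma atom_rk a : is_atom M a -> rk M a = 1.
Proof. by case/andP => _ /eqP. Qed.

Lemma closure1_atom i : i \in ground M -> is_atom M (closure M [set i]).
Proof.
by move=> gi; rewrite /is_atom inE closure_flat // rk_closure // rk_indep ?cards1 ?ll.
Qed.

Lemma mem_closure1 i : i \in ground M -> i \in closure M [set i].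
Proof. by move=> gi; apply: (subsetP (sub_closure _)); rewrite ?sub1set ?set11. Qed.

Lemma atom_closure a i : is_atom M a -> i \in a -> closure M [set i] = a.
Proof.
move=> ha ia; have gi := mem_atom_ground ha ia.
apply: closure_rk_eq => //; first by rewrite sub1set.
  by case/andP: ha.
by rewrite (atom_rk ha) (rk_indep omM (ll gi)) cards1.
Qed.

Lemma atom_neq0 a : is_atom M a -> exists i, i \in a.
Proof.
move=> ha; apply/set0Pn; apply/negP => /eqP e; have := atom_rk ha.
by rewrite e rk_indep ?cards0 // indep0.
Qed.

Lemma atoms_eq a b i : is_atom M a -> is_atom M b -> i \in a -> i \in b -> a = b.
Proof. by move=> ha hb ia ib; rewrite -(atom_closure ha ia) (atom_closure hb ib). Qed.

Lemma atom_pair a i j : is_atom M a -> i \in a -> j \in a -> i != j ->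
  exists P, [/\ P \in circuits M, supp P = [set i; j] & i \in pos P].
Proof.
move=> ha ia ja ij; have [gi gj] := (mem_atom_ground ha ia, mem_atom_ground ha ja).
have: i \in closure M [set j] by rewrite (atom_closure ha ja).
rewrite mem_closure_indep ?ll // gi inE (negPf ij) /= => /(ext_circ omM (ll gj) gi).
case=> P [hP sP iP]; exists P; split=> //; apply/eqP; rewrite eqEsubset sP /=.
rewrite subUset !sub1set (circ_mem_ext (ll gj) hP sP) /=.
by apply: (circ_mem_ext (ll gi) hP); rewrite setUC.
Qed.

Lemma nonatom_pair a i j : is_atom M a -> i \in a -> j \in ground M -> j \notin a ->
  indep M [set i; j].
Proof.
move=> ha ia gj ja; apply: contraT => nh; case/negP: ja.
rewrite -(atom_closure ha ia) mem_closure_indep ?ll ?(mem_atom_ground ha ia) // gj.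
by rewrite setUC nh orbT.
Qed.

(** Two elements of an atom form a circuit, which a larger circuit cannot contain. *)
Lemma circ_atom1 a C i j : is_atom M a -> C \in circuits M -> ~~ (supp C \subset a) ->
  i \in supp C -> j \in supp C -> i \in a -> j \in a -> i = j.
Proof.
move=> ha hC nC iC jC ia ja; apply/eqP; apply: contraNT nC => ij.
have [P [hP sP _]] := atom_pair ha ia ja ij.
rewrite -(circ_supp_eq omM hP hC) sP; by rewrite subUset !sub1set ?ia ?iC.
Qed.

Lemma indep_atom1 a I i j : is_atom M a -> indep M I -> i \in I -> j \in I ->
  i \in a -> j \in a -> i = j.
Proof.
move=> ha hI iI jI ia ja; apply/eqP; apply: contraT => ij.
have [P [hP sP _]] := atom_pair ha ia ja ij.
by case/negP: (indep_circ hI hP); rewrite sP subUset !sub1set iI.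
Qed.

Lemma loopless_circ1 C i : C \in circuits M -> ~~ (supp C \subset [set i]).
Proof.
move=> hC; apply/negP => sC.
have [gi|gi] := boolP (i \in ground M); first by case/negP: (indep_circ (ll gi) hC).
case/set0Pn: (circ_neq0 omM hC) => x xC; have := subsetP sC x xC.
by rewrite inE => /eqP xi; case/negP: gi; rewrite -xi (subsetP (circ_ground omM hC)).
Qed.

End Atoms.

Section Contraction.
Variables (V : finType) (M : sgsystem V).
Hypotheses (omM : oriented_matroid M) (ll : loopless M).
Variable (a : {set V}).
Hypothesis ha : is_atom M a.
Implicit Types (X Y Z C D : sgset V) (S T I J B F : {set V}) (i : V).
Let Ma := contract M a.

Lemma supp_sdel C S : supp (sdel C S) = supp C :\: S.
Proof. by rewrite /supp setDUl. Qed.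

Lemma traceP S X : reflect (exists C, [/\ C \in circuits M, X = sdel C S & supp X != set0])
  (X \in traces M S).
Proof.
rewrite inE; apply: (iffP andP) => [[/imsetP[C hC eX] nX]|[C [hC eX nX]]].
  by exists C.
by split=> //; apply/imsetP; exists C.
Qed.

(** C meets the atom in at most one element j, and elimination with the circuit on i and j puts i in
    its place without touching the signs off the atom. So all circuits of the contraction can be
    lifted through one chosen element i. *)
Lemma circ_swap C i : C \in circuits M -> i \in a -> ~~ (supp C \subset a) ->
  exists C', [/\ C' \in circuits M, sdel C' a = sdel C a & supp C' \subset i |: (supp C :\: a)].
Proof.
move=> hC ia nC.
have [/eqP|[j /setIP[jC ja]]] := set_0Vmem (supp C :&: a).
  rewrite setI_eq0 => d; exists C; split=> //.
  by apply/subsetP => x xC; rewrite in_setU1 in_setD xC (disjointFr d xC) orbT.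
have uj x : x \in supp C -> x \in a -> x = j.
  by move=> xC xa; exact: (circ_atom1 omM ll ha hC nC xC jC xa ja).
have [ij|ij] := eqVneq i j.
  exists C; split=> //; rewrite ij; apply/subsetP => x xC; rewrite in_setU1 in_setD xC andbT.
  by case xa: (x \in a); rewrite ?orbT // (uj x xC xa) eqxx.
have iC : i \notin supp C by apply/negP => iC; rewrite (uj i iC ia) eqxx in ij.
have [P [hP sP oP]] : exists P, [/\ P \in circuits M, supp P = [set i; j] & oppose C P j].
  have [P [hP sP _]] := atom_pair omM ll ha ia ja ij.
  have jP : j \in supp P by rewrite sP !inE eqxx orbT.
  have /orP[|] := supp_agree jC jP; last by exists P.
  by exists (sopp P); rewrite circ_opp // supp_sopp -agree_sopp agree_soppr oppose_sopp.
have nPC Q : supp Q = [set i; j] -> C <> sopp Q.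
  by move=> sQ eq; case/negP: iC; rewrite eq supp_sopp sQ !inE eqxx.
have [Z [hZ pZ nZ]] := circ_elim_oppose omM hC hP (nPC P sP) oP.
have sZ : supp Z \subset i |: (supp C :\ j).
  apply: subset_trans (elim_supp pZ nZ) _; rewrite sP; apply/subsetP => x.
  rewrite in_setD1 in_setU in_set2 in_setU1 in_setD1 => /andP[xj].
  by rewrite xj (negPf xj) orbF => /orP[->|->]; rewrite ?orbT.
have sCja : supp C :\ j = supp C :\: a.
  apply/setP => x; rewrite in_setD1 in_setD; case xC: (x \in supp C); rewrite ?andbT ?andbF //.
  by case xa: (x \in a); [rewrite (uj x) // eqxx|apply: contraFN xa => /eqP->].
have iZ : i \in supp Z.
  apply: contraT => niZ; have sZC : supp Z \subset supp C :\ j.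
    by apply/subsetP => x xZ; have := subsetP sZ x xZ; case/setU1P => // xi; rewrite -xi xZ in niZ.
  have eq := circ_supp_eq omM hZ hC (subset_trans sZC (subD1set _ _)).
  by have := subsetP sZC j; rewrite eq jC !inE eqxx => /(_ isT).
(* Eliminating i again returns a circuit inside C, hence with the same support; so Z has lost no
   element of C off the atom. *)
have supZ : supp C :\: a \subset supp Z.
  have [Q [hQ sQ oQ]] : exists Q, [/\ Q \in circuits M, supp Q = [set i; j] & oppose Z Q i].
    have iP : i \in supp P by rewrite sP !inE eqxx.
    have /orP[|] := supp_agree iZ iP; last by exists P.
    by exists (sopp P); rewrite circ_opp // supp_sopp -agree_sopp agree_soppr oppose_sopp.
  have [|W [hW pW nW]] := circ_elim_oppose omM hZ hQ _ oQ.
    move=> eq; have jZ : j \in supp Z by rewrite eq supp_sopp sQ in_set2 eqxx orbT.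
    by have := subsetP sZ j jZ; rewrite in_setU1 in_setD1 eqxx [j == i]eq_sym (negPf ij).
  have sW : supp W \subset supp C :&: (j |: supp Z).
    apply: subset_trans (elim_supp pW nW) _; apply/subsetP => x.
    rewrite in_setD1 in_setU sQ in_set2 in_setI in_setU1 => /andP[xi].
    rewrite (negPf xi) /= => /orP[xZ|/eqP->]; last by rewrite jC eqxx.
    rewrite xZ orbT andbT; have := subsetP sZ x xZ.
    by rewrite in_setU1 (negPf xi) in_setD1 => /andP[].
  have eW := circ_supp_eq omM hW hC (subset_trans sW (subsetIl _ _)).
  apply/subsetP => x /setDP[xC xa]; rewrite -eW in xC; have := subsetP sW x xC.
  rewrite in_setI in_setU1 => /andP[_ /predU1P[xj|//]].
  by rewrite xj ja in xa.
have dZ := circ_disj omM hZ; have dC := circ_disj omM hC.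
have pZC x : x \notin a -> x \in pos Z -> x \in pos C.
  move=> xa xZ; have := subsetP pZ x xZ; rewrite in_setD1 in_setU => /andP[_ /orP[//|xP]].
  have : x \in supp P by rewrite mem_supp xP.
  by rewrite sP !inE => /orP[] /eqP xx; rewrite xx ?ia ?ja in xa.
have nZC x : x \notin a -> x \in neg Z -> x \in neg C.
  move=> xa xZ; have := subsetP nZ x xZ; rewrite in_setD1 in_setU => /andP[_ /orP[//|xP]].
  have : x \in supp P by rewrite mem_supp xP orbT.
  by rewrite sP !inE => /orP[] /eqP xx; rewrite xx ?ia ?ja in xa.
exists Z; split=> //; last by rewrite -sCja.
have inZ x : x \notin a -> x \in supp C -> (x \in pos Z) || (x \in neg Z).
  by move=> xa xC; rewrite -mem_supp (subsetP supZ) // inE xa.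
congr pair; apply/setP => x; rewrite !in_setD; case xa: (x \in a) => //=; move/negbT: xa => xa.
  apply/idP/idP => [/pZC -> //|xp].
  have := inZ x xa; rewrite mem_supp xp => /(_ isT) /orP[//|/(nZC x xa)].
  by rewrite (disj_posF dC xp).
apply/idP/idP => [/nZC -> //|xp].
have := inZ x xa; rewrite mem_supp xp orbT => /(_ isT) /orP[/(pZC x xa)|//].
by rewrite (disj_negF dC xp).
Qed.

Lemma contract_lift X i : X \in circuits Ma -> i \in a ->
  exists C, [/\ C \in circuits M, X = sdel C a, ~~ (supp C \subset a)
    & supp C \subset i |: supp X].
Proof.
rewrite inE => /andP[/traceP[C [hC eX nX]] _] ia.
have nC : ~~ (supp C \subset a) by rewrite -setD_eq0 -supp_sdel -eX.
have [C' [hC' eC' sC']] := circ_swap hC ia nC.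
exists C'; split=> //; first by rewrite eC'.
  by rewrite -setD_eq0 -supp_sdel eC' -eX.
by rewrite eX supp_sdel.
Qed.

Lemma contract_min X Y : X \in circuits Ma -> Y \in circuits M -> ~~ (supp Y \subset a) ->
  supp Y :\: a \subset supp X -> supp Y :\: a = supp X.
Proof.
rewrite inE => /andP[_ /forall_inP min] hY nY sYX.
apply/eqP; rewrite eqEproper sYX -supp_sdel; apply: min.
by apply/traceP; exists Y; rewrite supp_sdel setD_eq0.
Qed.

(** A smaller trace, lifted through the same i, would be a circuit inside C. *)
Lemma contract_thru C i : C \in circuits M -> ~~ (supp C \subset a) -> i \in a ->
  i \in supp C -> sdel C a \in circuits Ma.
Proof.
move=> hC nC ia iC; rewrite inE; apply/andP; split.
  by apply/traceP; exists C; rewrite supp_sdel setD_eq0.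
apply/forall_inP => Y /traceP[C2 [hC2 eY nY]].
have nC2 : ~~ (supp C2 \subset a) by rewrite -setD_eq0 -supp_sdel -eY.
have [C2' [hC2' eC2' sC2']] := circ_swap hC2 ia nC2.
rewrite properE; apply/nandP; case: (boolP (supp Y \subset _)) => [sY|]; [right|by left].
rewrite negbK; have s2 : supp C2' \subset supp C.
  apply: subset_trans sC2' _; rewrite subUset sub1set iC -supp_sdel -eY.
  by apply: subset_trans sY _; rewrite supp_sdel subsetDl.
by rewrite eY -eC2' !supp_sdel (circ_supp_eq omM hC2' hC s2).
Qed.

(** The trace of a circuit that avoids the atom need not be minimal. In that case some circuit
    through i lies in i and C, and removing its oppositions to C one at a time makes its trace
    conformal to C. This is what transfers signs from M to M/a. *)
Lemma contract_conformal C0 : C0 \in circuits M -> ~~ (supp C0 \subset a) ->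
  exists X, [/\ X \in circuits Ma, pos X \subset pos C0 :\: a & neg X \subset neg C0 :\: a].
Proof.
move=> hC0 nC0; have [i ia] := atom_neq0 omM ha.
have [C [hC eC sC]] := circ_swap hC0 ia nC0.
have nC : ~~ (supp C \subset a) by rewrite -setD_eq0 -supp_sdel eC supp_sdel setD_eq0.
have [-> ->] : pos C0 :\: a = pos C :\: a /\ neg C0 :\: a = neg C :\: a by case: eC.
have [iC|iC] := boolP (i \in supp C).
  by exists (sdel C a); rewrite (contract_thru hC nC ia iC).
have dCa : [disjoint supp C & a].
  apply/pred0P => x /=; apply/negP => /andP[xC xa]; have := subsetP sC x xC.
  rewrite in_setU1 in_setD xa orbF => /eqP xi; by rewrite xi (negPf iC) in xC.
have [hmin|] := boolP (sdel C a \in circuits Ma); first by exists (sdel C a).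
rewrite inE negb_and => /orP[/traceP[]|].
  by exists C; rewrite supp_sdel setD_eq0.
rewrite negb_forall_in => /exists_inP[Y /traceP[W [hW eY nY]]]; rewrite negbK => sY.
have nW : ~~ (supp W \subset a) by rewrite -setD_eq0 -supp_sdel -eY.
have [W1 [hW1 eW1 sW1]] := circ_swap hW ia nW.
have sYC : supp Y \subset supp C.
  by apply: subset_trans (proper_sub sY) _; rewrite supp_sdel subsetDl.
(* If it avoided i, this circuit would lie in the trace of W and hence in C; it would have the
   support of C, and the trace of W would not be smaller. *)
have iW1 : i \in supp W1.
  apply: contraT => niW; have s1 : supp W1 \subset supp Y.
    apply/subsetP => x xW; have := subsetP sW1 x xW; rewrite -supp_sdel -eY.
    by case/setU1P => // xi; rewrite -xi xW in niW.
  have eq := circ_supp_eq omM hW1 hC (subset_trans s1 sYC).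
  have := proper_sub_trans sY (subset_trans _ s1); rewrite properxx => -> //.
  by rewrite eq supp_sdel subsetDl.
have {W1 eW1 hW1 sW1 iW1} [W1 [hW1 sW1 iW1]] : exists W1, [/\ W1 \in circuits M,
    supp W1 \subset i |: supp C & i \in pos W1].
  have s1 : supp W1 \subset i |: supp C.
    apply: subset_trans sW1 _; rewrite -supp_sdel -eY; exact: setUS.
  move: iW1; rewrite mem_supp => /orP[ip|ip]; first by exists W1.
  by exists (sopp W1); rewrite circ_opp // supp_sopp.
have {W1 hW1 sW1 iW1} [W1 [hW1 sW1 iW1 no]] : exists W1, [/\ W1 \in circuits M,
    supp W1 \subset i |: supp C, i \in pos W1 & forall f, ~~ oppose W1 C f].
  (* Eliminating at an opposing element f creates no new opposition to C, and i survives, since a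
     circuit in C without f cannot exist. *)
  have [n] := ubnP #|[set f | oppose W1 C f]|.
  elim: n W1 hW1 sW1 iW1 => // n IHn W1 hW1 sW1 iW1 ltn.
  have [/eqP s0|[f]] := set_0Vmem [set f | oppose W1 C f].
    exists W1; split=> // f; apply/negP => o; have : f \in set0 by rewrite -(eqP s0) inE.
    by rewrite inE.
  rewrite inE => of1.
  have fC : f \in supp C by case/andP: (oppose_supp of1).
  have fi : f != i by apply: contraNneq iC => <-.
  have [|Z [hZ pZ nZ]] := circ_elim_oppose omM hW1 hC _ of1.
    by move=> eq; move: iC; rewrite -supp_sopp -eq mem_supp iW1.
  have sZ : supp Z \subset (i |: supp C) :\ f.
    apply: subset_trans (elim_supp pZ nZ) _; rewrite setSD // subUset sW1 /=; exact: subsetUr.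
  have iZ : i \in supp Z.
    apply: contraT => niZ; have s1 : supp Z \subset supp C :\ f.
      apply/subsetP => x xZ; have := subsetP sZ x xZ; rewrite !in_setD1 in_setU1.
      by case/andP=> -> /predU1P[xi|//]; rewrite -xi xZ in niZ.
    have eq := circ_supp_eq omM hZ hC (subset_trans s1 (subD1set _ _)).
    by have := subsetP s1 f; rewrite eq fC !inE eqxx => /(_ isT).
  have ipZ : i \in pos Z.
    move: iZ; rewrite mem_supp => /orP[//|/(subsetP nZ)].
    rewrite in_setD1 in_setU => /andP[_ /orP[|iC']].
      by rewrite (negPf (circ_posN omM hW1 iW1)).
    by rewrite mem_supp iC' orbT in iC.
  apply: (IHn Z) => //; first exact: subset_trans sZ (subD1set _ _).
  rewrite ltnS in ltn; apply: leq_trans ltn; apply/proper_card/properP; split.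
    apply/subsetP => x; rewrite !inE => /(elim_oppose pZ nZ) /andP[_ /orP[//|]].
    move=> o; have /andP[xC _] := oppose_supp o.
    by have := agree_oppose (circ_disj omM hC) (circ_disj omM hC) (agree_refl xC); rewrite o.
  exists f; rewrite inE //; apply/negP => /(elim_oppose pZ nZ).
  by rewrite eqxx.
have nW1 : ~~ (supp W1 \subset a).
  apply/negP => sW1a; case/negP: (loopless_circ1 omM ll i hW1).
  apply/subsetP => x xW; have := subsetP sW1 x xW; rewrite in_setU1 => /predU1P[->|xC].
    by rewrite set11.
  by have := disjointFr dCa xC; rewrite (subsetP sW1a).
have iW : i \in supp W1 by rewrite mem_supp iW1.
exists (sdel W1 a); split; first exact: contract_thru iW.
all: apply/subsetP => x; rewrite !in_setD => /andP[xa xW]; rewrite xa /=.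
all: have xs : x \in supp W1 by rewrite mem_supp xW ?orbT.
all: have xC : x \in supp C
  by have := subsetP sW1 x xs; rewrite in_setU1 => /predU1P[xi|//]; rewrite xi ia in xa.
all: have := supp_agree xs xC; rewrite (negPf (no x)) orbF /agree xW.
  by rewrite (disj_posF (circ_disj omM hW1) xW) /= orbF.
by rewrite (disj_negF (circ_disj omM hW1) xW) /=.
Qed.

(** For comparable supports, lifts through i that agree at one element and oppose at another would
    eliminate to a circuit with a strictly smaller trace, against minimality. For elimination,
    eliminate between the lifts and choose a conformal circuit of the contraction below the
    result. *)
Lemma contract_om : oriented_matroid Ma.
Proof.
have [i ia] := atom_neq0 omM ha.
have lift X (hX : X \in circuits Ma) := contract_lift hX ia.
split=> [X|||X Y hX hY sXY|X Y e hX hY ne /setIP[eX eY]].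
- case/lift => C [hC -> nC sC]; rewrite supp_sdel /= setSD ?(circ_ground omM hC) // andbT.
  exact: disjointWl (subsetDl _ _) (disjointWr (subsetDl _ _) (circ_disj omM hC)).
- apply/negP; rewrite inE => /andP[/traceP[C [_ _]]].
  by rewrite /supp /= setU0 eqxx.
- move=> X; rewrite [X \in _]inE [sopp X \in _]inE => /andP[/traceP[C [hC eX nX]] min]; apply/andP; split.
    apply/traceP; exists (sopp C); split; rewrite ?circ_opp //; first by rewrite eX.
    by rewrite supp_sopp.
  apply/forall_inP => Y /(forall_inP min); by rewrite supp_sopp.
- have [C1 [hC1 eX nC1 sC1]] := lift X hX; have [C2 [hC2 eY nC2 sC2]] := lift Y hY.
  have eS : supp X = supp Y by rewrite eX supp_sdel; apply: contract_min; rewrite // -supp_sdel -eX.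
  have sXD : supp X \subset ~: a by rewrite eX supp_sdel setDE subsetIr.
  have dX : [disjoint pos X & neg X].
    by rewrite eX; apply: disjointWl (subsetDl _ _) (disjointWr (subsetDl _ _) (circ_disj omM hC1)).
  have dY : [disjoint pos Y & neg Y].
    by rewrite eY; apply: disjointWl (subsetDl _ _) (disjointWr (subsetDl _ _) (circ_disj omM hC2)).
  have sXx x : x \in supp X -> x \notin a by move/(subsetP sXD); rewrite inE.
  have agC x : x \in supp X -> agree C1 C2 x = agree X Y x.
    by move=> /sXx xa; rewrite eX eY /agree /= !in_setD xa.
  have opC x : x \in supp X -> oppose C1 C2 x = oppose X Y x.
    by move=> /sXx xa; rewrite eX eY /oppose /agree /= !in_setD xa.
  case: (pickP (oppose X Y)) => [f of1|no]; last first.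
    by left; apply: no_oppose_eq => // x; rewrite no.
  case: (pickP (agree X Y)) => [e ae|na]; last first.
    right; apply: no_oppose_eq; rewrite ?supp_sopp ?disj_sopp // => x.
    by rewrite /oppose agree_soppr oppose_sopp na.
  have /andP[fX _] := oppose_supp of1; have /andP[eX' _] := agree_supp ae.
  rewrite -opC // in of1; rewrite -agC // in ae.
  have [|Z [hZ pZ nZ]] := circ_elim_oppose omM hC1 hC2 _ of1.
    move=> eq; rewrite eq agree_sopp in ae; have /andP[e2 _] := oppose_supp ae.
    by have d := circ_disj omM hC2; have := agree_oppose d d (agree_refl e2); rewrite ae.
  have sZ : supp Z \subset (i |: supp X) :\ f.
    by apply: subset_trans (elim_supp pZ nZ) _; rewrite setSD // subUset sC1 eS sC2.
  have nZa : ~~ (supp Z \subset a).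
    apply/negP => sZa; case/negP: (loopless_circ1 omM ll i hZ).
    apply/subsetP => x xZ; have := subsetP sZ x xZ; rewrite in_setD1 in_setU1 in_set1.
    by case/andP => _ /predU1P[->|/sXx]; rewrite ?eqxx // (subsetP sZa).
  have sZX : supp Z :\: a \subset supp X :\ f.
    apply/subsetP => x /setDP[/(subsetP sZ)]; rewrite in_setD1 in_setU1 in_setD1.
    by case/andP => -> /predU1P[->|->] //; rewrite ia.
  have := contract_min hX hZ nZa (subset_trans sZX (subD1set _ _)) => eq.
  by have := subsetP sZX f; rewrite eq fX !inE eqxx => /(_ isT).
have [C1 [hC1 eqX nC1 sC1]] := lift X hX; have [C2 [hC2 eqY nC2 sC2]] := lift Y hY.
have [eC1 ea] : e \in pos C1 /\ e \notin a by move: eX; rewrite eqX inE => /andP[].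
have eC2 : e \in neg C2 by move: eY; rewrite eqY inE => /andP[].
have neC : C1 <> sopp C2 by move=> eq; apply: ne; rewrite eqX eqY eq.
have [Z [hZ pZ nZ]] := circ_elim omM hC1 hC2 eC1 eC2 neC.
have nZa : ~~ (supp Z \subset a).
  apply/negP => sZa; case/negP: (loopless_circ1 omM ll i hZ).
  apply/subsetP => x xZ; have xa := subsetP sZa x xZ.
  have := subsetP (elim_supp pZ nZ) x xZ; rewrite in_setD1 in_setU => /andP[_ /orP[/(subsetP sC1)|/(subsetP sC2)]].
    by rewrite eqX supp_sdel in_setU1 in_setD xa orbF in_set1.
  by rewrite eqY supp_sdel in_setU1 in_setD xa orbF in_set1.
have [W [hW pW nW]] := contract_conformal hZ nZa.
exists W; split=> //.
  apply: subset_trans pW _; apply/subsetP => x /setDP[/(subsetP pZ)].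
  by rewrite eqX eqY !in_setD1 !in_setU !in_setD => /andP[-> /orP[->|->]] ->; rewrite ?orbT.
apply: subset_trans nW _; apply/subsetP => x /setDP[/(subsetP nZ)].
by rewrite eqX eqY !in_setD1 !in_setU !in_setD => /andP[-> /orP[->|->]] ->; rewrite ?orbT.
Qed.

End Contraction.

Section ContractionRank.
Variables (V : finType) (M : sgsystem V).
Hypotheses (omM : oriented_matroid M) (ll : loopless M).
Variable (a : {set V}).
Hypothesis ha : is_atom M a.
Implicit Types (X Y Z C D : sgset V) (S T I J B F : {set V}) (i : V).
Let Ma := contract M a.

Let circ_ia C i S : C \in circuits M -> supp C \subset i |: S -> [disjoint S & a] ->
  ~~ (supp C \subset a).
Proof.
move=> hC sC dS; apply/negP => sCa; case/negP: (loopless_circ1 omM ll i hC).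
apply/subsetP => x xC; have := subsetP sC x xC; rewrite in_setU1 in_set1 => /predU1P[->|xS].
  by rewrite eqxx.
by have := disjointFr dS xS; rewrite (subsetP sCa).
Qed.

Lemma contract_indep S i : i \in a ->
  indep Ma S = (S \subset ground M :\: a) && indep M (i |: S).
Proof.
move=> ia; apply/idP/andP => [/indepP[/= gS hS]|[gS hS]].
  split=> //; apply: contraT => /(depP) [|C hC sC].
    by rewrite subUset sub1set (mem_atom_ground ha ia) (subset_trans gS) // subsetDl.
  have dS : [disjoint S & a].
    by rewrite disjoints_subset; apply: subset_trans gS _; rewrite setDE subsetIr.
  have nC := circ_ia hC sC dS.
  have [X [hX pX nX]] := contract_conformal omM ll ha hC nC.
  case/negP: (hS X hX); apply/subsetP => x xX.
  have /setDP[xC xa] : x \in supp C :\: a.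
    by move: xX; rewrite mem_supp !inE => /orP[/(subsetP pX)|/(subsetP nX)];
       rewrite inE => /andP[-> ->]; rewrite ?orbT.
  by case/setU1P: (subsetP sC x xC) => // xi; rewrite xi ia in xa.
apply/indepP; split=> // X /(contract_lift omM ll ha) -/(_ i ia) [C [hC eX nC sC]].
apply: contra (indep_circ hS hC) => sX; apply: subset_trans sC _; exact: setUS.
Qed.

Lemma contract_loopless : loopless Ma.
Proof.
have [i ia] := atom_neq0 omM ha; move=> j /setDP[gj ja].
rewrite (contract_indep _ ia) sub1set inE ja gj /=.
exact: nonatom_pair ja.
Qed.

Lemma contract_rk T i : i \in a -> T \subset ground M :\: a -> (rk Ma T).+1 = rk M (i |: T).
Proof.
move=> ia gT; have omMa := contract_om omM ll ha.
have nia S : S \subset ground M :\: a -> i \notin S.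
  by move=> s; apply/negP => /(subsetP s); rewrite inE ia.
apply/eqP; rewrite eqn_leq; apply/andP; split.
  have [I [sI hI <-]] := rk_ex omMa T; rewrite (contract_indep _ ia) in hI.
  case/andP: hI => gI hI; apply: leq_trans (rk_ge (setUS _ sI) hI).
  by rewrite cardsU1 nia.
have hi : indep M [set i] := ll (mem_atom_ground ha ia).
have [J [siJ sJ hJ <-]] := basis_ext omM (subsetUl [set i] T) hi.
have iJ : i \in J by rewrite -sub1set.
have sJT : J :\ i \subset T by rewrite subDset.
rewrite (cardsD1 i J) iJ ltnS; apply: rk_ge => //.
by rewrite (contract_indep _ ia) (subset_trans sJT gT) setD1K.
Qed.

Lemma contract_mrank : (mrank Ma).+1 = mrank M.
Proof.
have [i ia] := atom_neq0 omM ha; rewrite /mrank (contract_rk ia) //=.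
have eq : a :|: (ground M :\: a) = ground M.
  apply/setP => x; rewrite in_setU in_setD; case xa: (x \in a) => //=.
  by rewrite (mem_atom_ground ha xa).
by rewrite -(rkU_closure omM) (atom_closure omM ll ha ia) eq.
Qed.

Lemma contract_basis B i : i \in a ->
  basis Ma B = (B \subset ground M :\: a) && basis M (i |: B).
Proof.
move=> ia; rewrite /basis (contract_indep _ ia) -contract_mrank.
case: (boolP (B \subset _)) => //= gB; case: (indep M _) => //=.
have -> : #|i |: B| = #|B|.+1; last by rewrite eqSS.
by rewrite cardsU1; case: (boolP (i \in B)) => // /(subsetP gB); rewrite inE ia.
Qed.

Lemma basis_contract B i : basis M B -> i \in B -> i \in a -> basis Ma (B :\ i).
Proof.
move=> hB iB ia; rewrite (contract_basis _ ia) setD1K // hB andbT.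
apply/subsetP => x /setD1P[xi xB]; rewrite inE (basis_ground hB xB) andbT.
by apply: contra xi => xa; rewrite (indep_atom1 omM ll ha (basis_indep hB) xB iB xa ia).
Qed.

Lemma contract_closure T i : i \in a -> T \subset ground M :\: a ->
  closure Ma T = closure M (i |: T) :\: a.
Proof.
move=> ia gT; apply/setP => x; rewrite in_setD [LHS]inE [x \in closure M _]inE /= in_setD.
case: (boolP (x \in a)) => //= xa; case: (boolP (x \in ground M)) => //= gx.
have gxT : x |: T \subset ground M :\: a by rewrite subUset sub1set inE xa gx.
by rewrite -[LHS]eqSS (contract_rk ia gxT) (contract_rk ia gT) setUCA.
Qed.

(** The zero set of a cocircuit is a flat, so with i it contains the whole atom of i. *)
Lemma cocircuit_atom D i : cocircuit M D -> i \in a -> i \notin supp D -> [disjoint supp D & a].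
Proof.
move=> hD ia iD; have [I [hI cI sD]] := cocircuit_hyper omM hD.
have iI : i \in closure M I.
  by apply: contraNT iD => iI; rewrite sD inE iI (mem_atom_ground ha ia).
rewrite disjoint_sym disjoints_subset -(atom_closure omM ll ha ia) sD setCD.
apply: subset_trans (subsetUr _ _).
by rewrite -(closure_idem omM I); apply: closureS => //; rewrite sub1set.
Qed.

(** A basis of the hyperplane chosen to pass through i becomes, without i, a basis of the contracted
    hyperplane; orthogonality only concerns elements off the atom, where a circuit and its lift have
    the same signs. *)
Lemma contract_cocircuit D : cocircuit M D -> [disjoint supp D & a] -> cocircuit Ma D.
Proof.
move=> hD dDa; have omMa := contract_om omM ll ha; have [i ia] := atom_neq0 omM ha.
have dD := cocircuit_disj hD; have gi := mem_atom_ground ha ia.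
have [J [hJ cJ sD]] := cocircuit_hyper omM hD.
have iJ : [set i] \subset closure M J.
  rewrite sub1set; apply: contraT => nJ; have : i \in supp D by rewrite sD inE nJ.
  by move/(disjointFr dDa); rewrite ia.
have [I [siI sI hI cI]] := basis_ext omM iJ (ll gi).
have iI : i \in I by rewrite -sub1set.
have clI : closure M I = closure M J.
  by apply: closure_rk_eq => //; [exact: closure_flat|rewrite (rk_indep omM hI) cI].
have cI' : #|I| = #|J| by rewrite cI rk_closure // rk_indep.
have gI : I :\ i \subset ground M :\: a.
  apply/subsetP => x /setD1P[xi xI]; rewrite inE (subsetP (indep_ground hI)) // andbT.
  by apply: contra xi => xa; rewrite (indep_atom1 omM ll ha hI xI iI xa ia).
have hI' : indep Ma (I :\ i) by rewrite (contract_indep _ ia) gI setD1K.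
split=> //.
  exists (closure Ma (I :\ i)).
    rewrite /hyperplane closure_flat ?rk_closure ?(rk_indep omMa hI') //=.
    by rewrite -eqSS contract_mrank -cJ -cI' (cardsD1 i I) iI.
  rewrite (contract_closure ia) // setD1K // clI /= sD.
  apply/setP => x; rewrite !in_setD; case xa: (x \in a) => //=.
  apply/negP => /andP[xJ gx].
  have : x \in supp D by rewrite sD inE xJ.
  by move/(disjointFr dDa); rewrite xa.
move=> X /(contract_lift omM ll ha) -/(_ i ia) [C [hC eX nC _]].
have dC := circ_disj omM hC.
have dX : [disjoint pos X & neg X].
  by rewrite eX; exact: disjointWl (subsetDl _ _) (disjointWr (subsetDl _ _) dC).
have agX x : x \in supp D -> agree X D x = agree C D x.
  by move=> xD; rewrite eX /agree !in_setD (disjointFr dDa xD).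
have opX x : x \in supp D -> oppose X D x = oppose C D x.
  by move=> xD; rewrite eX /oppose /agree /= !in_setD (disjointFr dDa xD).
apply: orth_intro => // x xx.
  have /andP[_ xD] := agree_supp xx; rewrite agX // in xx.
  have [j oj] := circ_agree omM hC hD xx; exists j; rewrite opX //.
  by case/andP: (oppose_supp oj).
have /andP[_ xD] := oppose_supp xx; rewrite opX // in xx.
have [j oj] := circ_oppose omM hC hD xx; exists j; rewrite agX //.
by case/andP: (agree_supp oj).
Qed.

(** A circuit of M/a conformal to the trace of C has no negative element. *)
Lemma contract_nonacyclic C : C \in circuits M -> ~~ (supp C \subset a) -> neg C \subset a ->
  ~ acyclic Ma.
Proof.
move=> hC nC nCa ac; have [X [hX _ nX]] := contract_conformal omM ll ha hC nC.
case/negP: (ac X hX); rewrite -subset0; apply: subset_trans nX _.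
by rewrite subset0 setD_eq0.
Qed.

Lemma nonacyclicP N : ~ acyclic N -> exists2 C : sgset V, C \in circuits N & neg C = set0.
Proof.
move=> nac; have [/exists_inP[C hC /eqP nC]|] := boolP [exists C in circuits N, neg C == set0].
  by exists C.
by rewrite negb_exists_in => /forall_inP h; case: nac => C /h.
Qed.

Lemma nonacyclic_contract : ~ acyclic M -> acyclic_set M a -> ~ acyclic Ma.
Proof.
move/nonacyclicP => [C hC nC] ac; apply: (contract_nonacyclic hC); last by rewrite nC sub0set.
apply/negP => sC; have hC' : C \in circuits (restrict M a) by rewrite restrict_circ hC.
by have := ac C hC'; rewrite nC eqxx.
Qed.

End ContractionRank.

(** * Links and facets of triangulations *)

Section Triangulations.
Variable V : finType.
Implicit Types (M : sgsystem V) (X Y Z C D : sgset V) (S T I J B F a : {set V}).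
Implicit Types (Delta : {set {set V}}).

(** Only e and b can lie in both supports. With S a ridge and D its cocircuit, this determines on
    which side of the ridge an element lies from the circuit that links it to b. *)
Lemma cocircuit_two M D C S e b : oriented_matroid M -> cocircuit M D -> C \in circuits M ->
  supp C \subset e |: (b |: S) -> [disjoint S & supp D] -> agree C D e -> oppose C D b.
Proof.
move=> omM hD hC sC dS ae; have [k ok] := circ_agree omM hC hD ae.
have /andP[kC kD] := oppose_supp ok.
have := subsetP sC k kC; rewrite !in_setU1 => /or3P[/eqP ke|/eqP <- //|kS].
  by have := agree_oppose (circ_disj omM hC) (cocircuit_disj hD) ae; rewrite -ke ok.
by have := disjointFr dS kS; rewrite kD.
Qed.

Definition link Delta (i : V) : {set {set V}} :=
  [set B :\ i | B : {set V} in [set B in Delta | i \in B]].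

Lemma linkP Delta i T :
  reflect (exists B, [/\ B \in Delta, i \in B & T = B :\ i]) (T \in link Delta i).
Proof.
apply: (iffP imsetP) => [[B]|[B [h1 h2 ->]]]; first by rewrite inE => /andP[]; exists B.
by exists B; rewrite // inE h1.
Qed.

(** A circuit of M/a lifts to M through i, and i belongs to both simplices, so an improper
    intersection in the link would be one in Delta. The ridges considered contain i, hence a
    cocircuit vanishing on one vanishes on the whole atom and descends to M/a. *)
Lemma link_triangulation M a i Delta : oriented_matroid M -> loopless M -> is_atom M a ->
  triangulation M Delta -> i \in a -> (exists2 B, B \in Delta & i \in B) ->
  triangulation (contract M a) (link Delta i).
Proof.
move=> omM ll ha [_ hB hP hM] ia [B0 hB0 iB0]; split.
- by apply/set0Pn; exists (B0 :\ i); apply/linkP; exists B0.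
- by move=> _ /linkP[B [/hB bB iB ->]]; exact: (basis_contract omM ll ha bB iB ia).
- move=> _ _ /linkP[B [hBD iB ->]] /linkP[B' [hBD' iB' ->]] [X hX /andP[pX nX]].
  have [C [hC eX _ sC]] := contract_lift omM ll ha hX ia.
  have inC x : x \in supp C -> x \notin a \/ x = i.
    move/(subsetP sC); rewrite in_setU1 eX supp_sdel in_setD.
    by case/predU1P => [->|/andP[]]; [right|left].
  apply: (hP B B') => //; exists C => //; apply/andP; split; apply/subsetP => x xC.
    have [xa|->//] : x \notin a \/ x = i by apply: inC; rewrite mem_supp xC.
    by have /setD1P[] : x \in B :\ i; [apply: (subsetP pX); rewrite eX inE xa|].
  have [xa|->//] : x \notin a \/ x = i by apply: inC; rewrite mem_supp xC orbT.
  by have /setD1P[] : x \in B' :\ i; [apply: (subsetP nX); rewrite eX inE xa|].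
- move=> _ b /linkP[B [hBD iB ->]] /setD1P[bi bB].
  have iBb : i \in B :\ b by rewrite !inE eq_sym bi.
  have sub : B :\ i :\ b \subset B :\ b by rewrite setSD // subD1set.
  have [[D [hD nD] dD]|[B' [hB' neB sB]]] := hM B b hBD bB; [left|right].
    exists D; last exact: disjointWl dD.
    split=> //; apply: contract_cocircuit => //; apply: (cocircuit_atom omM ll ha hD ia).
    by rewrite (disjointFr dD iBb).
  have iB' : i \in B' := subsetP sB i iBb.
  exists (B' :\ i); split; first by apply/linkP; exists B'.
    by move=> eq; apply: neB; rewrite -(setD1K iB) -eq setD1K.
  by rewrite setDDl setUC -setDDl setSD.
Qed.

Lemma restrict_triangulation M S Delta : oriented_matroid M -> triangulation M Delta ->
  (forall B, B \in Delta -> B \subset S) -> triangulation (restrict M S) Delta.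
Proof.
move=> omM [n0 hB hP hM] hS.
have [B0 hB0] := set0Pn _ n0.
have rS : rk M S = mrank M.
  apply/eqP; rewrite eqn_leq rk_mrank //= -(basis_card (hB _ hB0)).
  by apply: rk_ge (hS _ hB0) _; apply: basis_indep (hB _ hB0).
split=> //.
- by move=> B hBD; rewrite restrict_basis // hB // hS.
- move=> B B' hBD hBD' [C]; rewrite restrict_circ => /andP[hC _] h.
  by apply: (hP B B' hBD hBD'); exists C.
- move=> B b hBD bB; have [[D [hD nD] dD]|] := hM B b hBD bB; [left|by right].
  have [hI cI _] := basisD1 omM (hB _ hBD) bB.
  have sI : B :\ b \subset S := subset_trans (subD1set _ _) (hS _ hBD).
  exists (capS D S); last by rewrite supp_capS; exact: disjointWr (subsetIl _ _) dD.
  split; first exact: restrict_cocircuit dD.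
  by rewrite /= nD set0I.
Qed.

Definition parallel M (i j : V) : bool := (i == j) || (([set i], [set j]) \in circuits M).

Definition has_ridge Delta D : Prop :=
  exists B b, [/\ B \in Delta, b \in B & [disjoint B :\ b & supp D]].

(* Delete the elements on the side of i: a facet of the remaining matroid visible from i
   contains a ridge of the triangulation, which has no continuation across that facet. *)
Lemma extreme_used M Delta a i : oriented_matroid M -> loopless M ->
    (forall M', oriented_matroid M' -> loopless M' -> acyclic M' ->
       #|ground M'| < #|ground M| -> forall Delta D,
       triangulation M' Delta -> positive_cocircuit M' D -> has_ridge Delta D) ->
    is_atom M a -> i \in a -> acyclic (contract M a) -> triangulation M Delta ->
  exists B j, [/\ B \in Delta, j \in B, j \in a & parallel M i j].
Proof.
move=> omM ll IH ha ia ac hT; have [n0 hB hP hM] := hT.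
pose A := [set j in a | parallel M i j].
have [/exists_inP[B hBD /exists_inP[j jB jA]]|none] :=
    boolP [exists B in Delta, exists j in B, j \in A].
  by exists B, j; move: jA; rewrite inE => /andP[ja pj].
exfalso; pose S := ground M :\: A.
have iA : i \in A by rewrite inE ia /parallel eqxx.
have gi : i \in ground M := mem_atom_ground ha ia.
have iS : i \notin S by rewrite inE iA.
have hS B : B \in Delta -> B \subset S.
  move=> hBD; apply/subsetP => x xB; rewrite inE (basis_ground (hB B hBD) xB) andbT.
  apply: contra none => xA; apply/exists_inP; exists B => //.
  by apply/exists_inP; exists x.
have [B0 hB0] := set0Pn _ n0.
have rS : rk M S = mrank M.
  apply/eqP; rewrite eqn_leq rk_mrank //= -(basis_card (hB _ hB0)).
  by apply: rk_ge (hS _ hB0) _; apply: basis_indep (hB _ hB0).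
have pair C x y : C \in circuits M -> supp C \subset a -> x \in supp C -> y \in supp C ->
    x != y -> supp C = [set x; y].
  move=> hC sC xC yC xy; have [xa ya] := (subsetP sC x xC, subsetP sC y yC).
  have [P [hP' sP _]] := atom_pair omM ll ha xa ya xy.
  by rewrite -(circ_supp_eq omM hP' hC) sP // subUset !sub1set xC.
have two C x : C \in circuits M -> x \in supp C -> exists2 y, y \in supp C & x != y.
  move=> hC xC; have /subsetPn[y yC] := loopless_circ1 omM ll x hC.
  by rewrite inE eq_sym; exists y.
(* Since M/a is acyclic, a positive circuit in S lies in a and consists of two elements x and y.
   Neither is parallel to i, so i and x are opposite; eliminating x shows that i and y are parallel,
   which puts y outside S. *)
have acS : acyclic (restrict M S).
  move=> C; rewrite restrict_circ => /andP[hC sC]; apply/negP => /eqP nC.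
  have sCa : supp C \subset a.
    apply: contraT => nCa; case: (contract_nonacyclic omM ll ha hC nCa _ ac).
    by rewrite nC sub0set.
  have [x xC] := set0Pn _ (circ_neq0 omM hC); have [y yC xy] := two C x hC xC.
  have xa := subsetP sCa x xC; have ya := subsetP sCa y yC.
  have xp : x \in pos C by move: xC; rewrite mem_supp nC inE orbF.
  have yp : y \in pos C by move: yC; rewrite mem_supp nC inE orbF.
  have ix : i != x by apply: contraTneq (subsetP sC x xC) => <-.
  have iy : i != y by apply: contraTneq (subsetP sC y yC) => <-.
  have nA z : z \in supp C -> i != z -> exists P, [/\ P \in circuits M, supp P = [set i; z],
      i \in pos P & z \in pos P].
    move=> zC iz; have za := subsetP sCa z zC.
    have [P [hP' sP iP]] := atom_pair omM ll ha ia za iz; exists P; split=> //.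
    have : z \in supp P by rewrite sP !inE eqxx orbT.
    rewrite mem_supp => /orP[//|zn].
    have eqP : P = ([set i], [set z]).
      apply: sgset_eq; apply/setP => t; rewrite inE;
      apply/idP/eqP => [tP|->//];
      have: t \in supp P by [rewrite mem_supp tP ?orbT]; rewrite sP !inE.
        by case/orP => /eqP // tz; move: tP; rewrite tz (negPf (circ_negP omM hP' zn)).
      by case/orP => /eqP // tz; move: tP; rewrite tz (negPf (circ_posN omM hP' iP)).
    by have := subsetP sC z zC; rewrite inE [z \in A]inE za /parallel -eqP hP' orbT.
  have [P [hP' sP iP xP]] := nA x xC ix.
  have [|Z [hZ pZ nZ]] := circ_elim omM hC (circ_opp omM hP') xp (xP : x \in neg (sopp P)).
    rewrite soppK => eq; have := iP; rewrite -eq => iC.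
    by have := subsetP sC i; rewrite mem_supp iC (negPf iS) => /(_ isT).
  have sCxy := pair C x y hC sCa xC yC xy.
  have posC t : t \in pos C -> t = x \/ t = y.
    move=> tC; have : t \in supp C by rewrite mem_supp tC.
    by rewrite sCxy !inE => /orP[] /eqP; [left|right].
  have nP : neg P = set0.
    apply/eqP; rewrite -subset0; apply/subsetP => t tP.
    have : t \in supp P by rewrite mem_supp tP orbT.
    by rewrite sP !inE => /orP[] /eqP ett; move: tP; rewrite ett (negPf (circ_posN omM hP' _)).
  have pZy : pos Z \subset [set y].
    apply/subsetP => t /(subsetP pZ); rewrite in_setD1 in_setU /= nP in_set0 orbF.
    by case/andP => tx /posC[etx|->]; [rewrite etx eqxx in tx|rewrite inE].
  have nZi : neg Z \subset [set i].
    apply/subsetP => t /(subsetP nZ); rewrite in_setD1 in_setU nC in_set0 /= => /andP[tx tP].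
    have : t \in supp P by rewrite mem_supp tP.
    by rewrite sP !inE (negPf tx) orbF.
  have sZ : supp Z \subset [set i; y] by rewrite /supp setUC setUSS.
  have [z zZ] := set0Pn _ (circ_neq0 omM hZ); have [t tZ zt] := two Z z hZ zZ.
  have iZ : i \in supp Z /\ y \in supp Z.
    have := subsetP sZ z zZ; have := subsetP sZ t tZ; rewrite !in_set2.
    by case/orP => /eqP et /orP[] /eqP ez; move: zt zZ tZ; rewrite ez et ?eqxx // => _ h1 h2; split.
  case: iZ; rewrite !mem_supp => iZ yZ.
  have eZ : sopp Z = ([set i], [set y]).
    apply: sgset_eq; apply/eqP; rewrite eqEsubset ?pZy ?nZi sub1set.
      case/orP: iZ => // /(subsetP pZy); by rewrite inE (negPf iy).
    case/orP: yZ => // /(subsetP nZi); by rewrite inE eq_sym (negPf iy).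
  have := subsetP sC y yC; rewrite inE [y \in A]inE ya /parallel -eZ circ_opp //.
  by rewrite orbT.
have gS : S \subset ground M := subsetDl _ _.
(* A circuit positive only at i would make M/a not acyclic or exhibit an element of S parallel to i.
   What remains is a cocircuit with i on one side and no element of S on that side. *)
have [[C [hC iC sC _ pC]]|[D [hD iD _ _ pD]]] : (exists C, [/\ C \in circuits M, i \in pos C,
      supp C \subset [set i] :|: S :|: set0, [disjoint neg C & [set i]] & [disjoint pos C & S]]) \/
    (exists D, [/\ cocircuit M D, i \in pos D, [disjoint supp D & set0],
      [disjoint neg D & [set i]] & [disjoint pos D & S]]).
  apply: painting => //; rewrite ?sub1set ?sub0set ?set11 //.
  - by rewrite disjoints1.
  - by rewrite disjoint_sym disjoints_subset sub0set.
  - by rewrite disjoint_sym disjoints_subset sub0set.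
- rewrite setU0 in sC.
  have posC : pos C \subset [set i].
    apply/subsetP => x xC; have : x \in supp C by rewrite mem_supp xC.
    by move/(subsetP sC); rewrite in_setU (disjointFr pC xC) orbF.
  have [sCa|nCa] := boolP (supp C \subset a); last first.
    have nCa' : ~~ (supp (sopp C) \subset a) by rewrite supp_sopp.
    apply: (contract_nonacyclic omM ll ha (circ_opp omM hC) nCa' _ ac).
    by apply: subset_trans posC _; rewrite sub1set.
  have iC' : i \in supp C by rewrite mem_supp iC.
  have [y yC iy] := two C i hC iC'.
  have sCy := pair C i y hC sCa iC' yC iy.
  have yS : y \in S.
    by have := subsetP sC y yC; rewrite !in_setU in_set1 eq_sym (negPf iy).
  have eC : C = ([set i], [set y]).
    apply: sgset_eq; apply/eqP; rewrite eqEsubset ?posC ?sub1set //.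
    apply/andP; split; last first.
      by move: yC; rewrite mem_supp => /orP[/(subsetP posC)|//]; rewrite inE eq_sym (negPf iy).
    apply/subsetP => t tC; have : t \in supp C by rewrite mem_supp tC orbT.
    by rewrite sCy !inE => /orP[/eqP ti|//]; move: tC; rewrite ti (negPf (circ_posN omM hC iC)).
  by move: yS; rewrite inE [y \in A]inE (subsetP sCa y yC) /parallel -eC hC orbT.
pose X := sopp D; have hX : cocircuit M X := cocircuit_opp omM hD.
have AX : A \subset supp X.
  apply/subsetP => j; rewrite inE /parallel => /andP[ja /predU1P[<-|hC]].
    by rewrite supp_sopp mem_supp iD.
  have [|k ak] := circ_agree omM hC hD (_ : agree _ D i).
    by rewrite /agree /= set11 iD.
  have /andP[kC kD] := oppose_supp ak.
  have [ki|ki] := eqVneq k i.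
    move: ak; rewrite ki /oppose /agree /= set11 !inE.
    have dC := circ_disj omM hC; have -> : (i == j) = false.
      by have := disj_posF dC (set11 i); rewrite /= inE.
    by rewrite (disj_posF (cocircuit_disj hD) iD).
  by move: kC; rewrite mem_supp /= !in_set1 (negPf ki) /= => /eqP <-; rewrite supp_sopp.
have posX x : x \in S -> x \in supp X -> x \in pos X.
  by move=> xS; rewrite mem_supp /= => /orP[//|xD]; have := disjointFr pD xD; rewrite xS.
have [I [hI cI sX]] := cocircuit_hyper omM hX.
have dI : [disjoint I & supp X].
  rewrite disjoints_subset sX setCD; apply: subset_trans (subsetUr _ _).
  exact: sub_closure (indep_ground hI).
have sI : I \subset S.
  apply/subsetP => x xI; rewrite inE (subsetP (indep_ground hI) x xI) andbT.
  by apply/negP => /(subsetP AX); rewrite (disjointFr dI xI).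
have hX' : positive_cocircuit (restrict M S) (capS X S).
  split; first exact: restrict_cocircuit dI.
  apply/eqP; rewrite -subset0; apply/subsetP => x /setIP[xD xS].
  by have := disjointFr pD xD; rewrite xS.
(* The hyperplane of X supports a facet of the restriction to S, to which the facet statement for
   smaller ground sets applies. *)
have [B [b [hBD bB dB]]] : has_ridge Delta (capS X S).
  apply: IH hX' => //; [exact: restrict_om|exact: restrict_loopless| |].
    apply/proper_card/properP; split; first exact: subsetIl.
    by exists i => //; rewrite inE (negPf iS) andbF.
  exact: restrict_triangulation.
have dBX : [disjoint B :\ b & supp X].
  apply/pred0P => x /=; apply/negP => /andP[xB xX].
  have xS : x \in S by apply: (subsetP (hS B hBD)); case/setD1P: xB.
  by have := disjointFr dB xB; rewrite supp_capS inE xX xS.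
have hbB := hB B hBD; have [hs cs bs] := basisD1 omM hbB bB.
have suX := cocircuit_supp omM hX hs cs dBX.
have bX : b \in pos X.
  by apply: posX; [exact: (subsetP (hS B hBD))|rewrite suX inE bs (basis_ground hbB bB)].
have iB : i \notin B by apply: contra iS; exact: (subsetP (hS B hBD)).
(* The ridge cannot be on the boundary of M: Y has the same support as X but equal signs at i and b,
   where X has opposite ones, and the circuit in i and B is orthogonal to both. *)
have [[Y [hY nY] dY]|[B' [hBD' neB sB]]] := hM B b hBD bB.
  have suY := cocircuit_supp omM hY hs cs dY.
  have posY x : x \in supp X -> x \in pos Y.
    by rewrite suX -suY mem_supp nY inE orbF.
  have iY : i \in pos Y by apply: posY; rewrite supp_sopp mem_supp iD.
  have bY : b \in pos Y by apply: posY; rewrite mem_supp bX.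
  have [Z [hZ sZ iZ]] := fund_circ omM hbB gi iB.
  have sZ' : supp Z \subset i |: (b |: B :\ b) by rewrite setD1K.
  have sZ'' : supp (sopp Z) \subset i |: (b |: B :\ b) by rewrite supp_sopp.
  have aY : agree Z Y i by rewrite /agree iZ iY.
  have aX : agree (sopp Z) X i by rewrite /agree /= iZ iD orbT.
  have oY := cocircuit_two omM hY hZ sZ' dY aY.
  have := cocircuit_two omM hX (circ_opp omM hZ) sZ'' dBX aX; rewrite oppose_sopp => oX.
  move: oY oX; rewrite /oppose /agree [b \in pos X]bX bY nY in_set0 !andbF !andbT /= orbF.
  rewrite (disj_posF (cocircuit_disj hX) bX) andbF orbF => bn.
  by rewrite (negPf (circ_negP omM hZ bn)).
(* The neighbour across the ridge adds some b' of S, on the same side of X as b. The circuit through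
   b and b' then has opposite signs at them, which is an improper intersection of B and B'. *)
have hbB' := hB B' hBD'.
have [b' b'B' b's] : exists2 b', b' \in B' & b' \notin B :\ b.
  apply/subsetPn/negP => s; have := subset_leq_card s.
  by rewrite (basis_card hbB') -cs ltnn.
have eB' : B' :\ b' = B :\ b.
  apply/eqP; rewrite eq_sym eqEcard subsetD1 sB b's /=.
  by have := basis_card hbB'; rewrite -cs (cardsD1 b' B') b'B' add1n => -[->].
have bb' : b' \notin B.
  apply/negP => b'B; apply: neB; have eb : b' = b.
    by apply/eqP; move: b's; rewrite !inE b'B andbT negbK.
  by rewrite -(setD1K b'B') eB' eb setD1K.
have b'X : b' \in pos X.
  apply: posX; first exact: (subsetP (hS B' hBD')).
  have [_ _] := basisD1 omM hbB' b'B'; rewrite eB' suX in_setD => ->.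
  exact: (basis_ground hbB' b'B').
have [Z [hZ sZ iZ]] := fund_circ omM hbB (basis_ground hbB' b'B') bb'.
have sZ' : supp Z \subset b' |: (b |: B :\ b) by rewrite setD1K.
have aX : agree Z X b' by rewrite /agree iZ b'X.
have := cocircuit_two omM hX hZ sZ' dBX aX; rewrite /oppose /agree [b \in pos X]bX.
rewrite andbT (disj_posF (cocircuit_disj hX) bX) andbF orbF => bn.
apply: (hP B B' hBD hBD'); exists (sopp Z); first exact: circ_opp.
apply/andP; split; apply/subsetP => x /= xZ.
  have : x \in supp Z by rewrite mem_supp xZ orbT.
  move/(subsetP sZ); case/setU1P => // xb; move: xZ.
  by rewrite xb (negPf (circ_posN omM hZ iZ)).
have : x \in supp Z by rewrite mem_supp xZ.
move/(subsetP sZ'); rewrite !in_setU1 => /or3P[/eqP->//|/eqP xb|xs].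
  by move: xZ; rewrite xb (negPf (circ_negP omM hZ bn)).
by move: xs; rewrite -eB' => /setD1P[].
Qed.

End Triangulations.

(** * Facets and extreme atoms *)

Section Facets.
Variable V : finType.
Implicit Types (M : sgsystem V) (X Y Z C D : sgset V) (S T I J B F a : {set V}).
Implicit Types (Delta : {set {set V}}).

(** A positive circuit of M/a lifts to a circuit that is positive off a, and orthogonality to the
    nonnegative D confines it to the facet, where it contradicts the acyclicity of the contracted
    facet. *)
Lemma facet_extreme M D a : oriented_matroid M -> loopless M -> positive_cocircuit M D ->
    let F := ground M :\: supp D in is_atom (restrict M F) a ->
    acyclic (contract (restrict M F) a) ->
  [/\ is_atom M a, [disjoint supp D & a] & acyclic (contract M a)].
Proof.
move=> omM ll [hD nD] F ha ac.
have omF := restrict_om omM F; have llF := restrict_loopless (S := F) ll.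
have [I [hI cI sD]] := cocircuit_hyper omM hD.
have eF : F = closure M I.
  by rewrite /F sD setDDr setDv set0U; apply/setIidPr; exact: closure_ground.
have fF : flat M F by rewrite eF closure_flat.
have [i ia] := atom_neq0 omF ha.
have /setIP[gi iF] : i \in ground M :&: F := mem_atom_ground ha ia.
have ea : a = closure M [set i].
  rewrite -(atom_closure omF llF ha ia) restrict_closure ?ll ?sub1set //.
  by apply/setIidPl; rewrite flat_sub // sub1set.
have ha' : is_atom M a by rewrite ea closure1_atom.
have dDa : [disjoint supp D & a].
  rewrite disjoint_sym disjoints_subset; apply: subset_trans (subsetIr (ground M) _).
  by rewrite -setDE ea flat_sub // sub1set.
split=> // X hX; apply/negP => /eqP nX.
have [C [hC eX nC sC]] := contract_lift omM ll ha' hX ia.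
have posC x : x \in supp C -> x \notin a -> x \in pos C.
  move=> xC xa; have : x \in supp X by rewrite eX supp_sdel inE xa.
  by rewrite mem_supp nX inE orbF eX inE => /andP[].
have noC x : ~~ oppose C D x.
  apply/negP => ox; have /andP[xC xD] := oppose_supp ox.
  have xa : x \notin a by rewrite (disjointFr dDa xD).
  move: ox; rewrite /oppose /agree /= nD in_set0 andbF orbF.
  by rewrite (negPf (circ_posN omM hC (posC x xC xa))).
have CF : supp C \subset F.
  apply/subsetP => x xC; rewrite inE (subsetP (circ_ground omM hC)) // andbT.
  apply/negP => xD; have := supp_agree xC xD; rewrite (negPf (noC x)) orbF.
  by move/(circ_agree omM hC hD) => [j]; rewrite (negPf (noC j)).
have hC' : C \in circuits (restrict M F) by rewrite restrict_circ hC.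
apply: (contract_nonacyclic omF llF ha hC' nC) ac.
apply/subsetP => x xn; apply: contraT => xa.
have : x \in supp C by rewrite mem_supp xn orbT.
by move/posC => /(_ xa); rewrite (negPf (circ_negP omM hC xn)).
Qed.

Lemma ground_neq0 M : oriented_matroid M -> 0 < mrank M -> exists e, e \in ground M.
Proof.
move=> omM; have [I [sI _ cI]] := rk_ex omM (ground M).
rewrite /mrank -cI => /card_gt0P[e eI]; exists e; exact: (subsetP sI).
Qed.

(** Descend to facets until the rank is 1; there M/a is loopless of rank 0, so it has no elements
    and no circuits. *)
Lemma extreme_atom M : oriented_matroid M -> loopless M -> acyclic M -> 0 < mrank M ->
  exists2 a, is_atom M a & acyclic (contract M a).
Proof.
have [n] := ubnP (mrank M); elim: n M => // n IHn M ltn omM ll ac r0.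
have [e ge] := ground_neq0 omM r0.
have [D [hD nD] eD] := acyclic_cocircuit omM ac ge.
have [r1|r1] := eqVneq (mrank M) 1.
  have ha := closure1_atom omM ll ge; exists (closure M [set e]) => // X hX.
  have omMa := contract_om omM ll ha.
  have [x xX] := set0Pn _ (circ_neq0 omMa hX).
  have gx := subsetP (circ_ground omMa hX) x xX.
  have hx := contract_loopless omM ll ha gx.
  have := rk_ge (indep_ground hx) hx; rewrite cards1 -/(mrank _).
  by have := contract_mrank omM ll ha; rewrite r1 => -[->].
have [I [hI cI sD]] := cocircuit_hyper omM hD.
pose F := ground M :\: supp D.
have rF : (mrank (restrict M F)).+1 = mrank M.
  rewrite (restrict_mrank omM) /F sD setDDr setDv set0U.
  by rewrite (setIidPr (closure_ground _ _)) rk_closure // rk_indep.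
have [|||||a haF acF] := IHn (restrict M F).
- by move: ltn; rewrite -rF ltnS.
- exact: restrict_om.
- exact: restrict_loopless.
- exact: restrict_acyclic.
- by move: r1; rewrite -rF eqSS lt0n.
have [|ha _ aca] := facet_extreme omM ll _ haF acF; last by exists a.
by split.
Qed.

(** The induction hypothesis is exactly what [extreme_used] asks for on smaller ground sets. So
    Delta uses an element j of an extreme atom a of the facet; D is still a positive cocircuit of
    M/a, and a ridge of the link of j in it becomes a ridge of Delta when j is added. *)
Lemma facet_ridge M Delta D : oriented_matroid M -> loopless M -> acyclic M ->
  triangulation M Delta -> positive_cocircuit M D -> has_ridge Delta D.
Proof.
have [n] := ubnP #|ground M|; elim: n M Delta D => // n IHn M Delta D ltn omM ll ac hT hD.
have [n0 hB hP hM] := hT; have [hcD nD] := hD.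
have [I [hI cI sD]] := cocircuit_hyper omM hcD.
have [r1|r1] := eqVneq (mrank M) 1.
  have [B hBD] := set0Pn _ n0; have cB := basis_card (hB B hBD).
  have [b eB] : exists b, B = [set b] by apply/cards1P; rewrite cB r1.
  exists B, b; split=> //; rewrite eB ?set11 // setDv.
  by rewrite disjoints_subset sub0set.
pose F := ground M :\: supp D.
have rF : (mrank (restrict M F)).+1 = mrank M.
  rewrite (restrict_mrank omM) /F sD setDDr setDv set0U.
  by rewrite (setIidPr (closure_ground _ _)) rk_closure // rk_indep.
have [|a haF acF] := extreme_atom (restrict_om omM F) (restrict_loopless ll) (restrict_acyclic ac).
  by move: r1; rewrite -rF eqSS lt0n.
have [ha dDa aca] := facet_extreme omM ll hD haF acF.
have [i ia] := atom_neq0 omM ha.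
have [|B [j [hBD jB ja _]]] := extreme_used omM ll _ ha ia aca hT.
  move=> M' omM' llM' acM' lt D' X hD' hX.
  by apply: IHn hX => //; apply: leq_trans lt _.
have [||||||B' [b [/linkP[B1 [hB1 jB1 eB']] bB' dB']]] := IHn (contract M a) (link Delta j) D.
- rewrite ltnS in ltn; apply: leq_trans ltn; apply/proper_card/properP; split.
    exact: subsetDl.
  by exists i; rewrite ?inE ?ia // (mem_atom_ground ha).
- exact: contract_om.
- exact: contract_loopless.
- exact: aca.
- by apply: link_triangulation => //; exists B.
- by split=> //; apply: contract_cocircuit.
exists B1, b; split=> //; first by move: bB'; rewrite eB' => /setD1P[].
apply/pred0P => x /=; apply/negP => /andP[/setD1P[xb xB] xD].
have xj : x != j by apply: contraTneq xD => ->; rewrite (disjointFl dDa ja).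
have : x \in B' :\ b by rewrite eB' !inE xb xj.
by move/(disjointFr dB'); rewrite xD.
Qed.

Lemma extreme_atom_used M Delta a i : oriented_matroid M -> loopless M ->
    is_atom M a -> i \in a -> acyclic (contract M a) -> triangulation M Delta ->
  exists B j, [/\ B \in Delta, j \in B, j \in a & parallel M i j].
Proof.
move=> omM ll ha ia aca hT; apply: extreme_used => //.
by move=> M' omM' llM' acM' _ D' X hD' hX; exact: facet_ridge hD' hX.
Qed.

End Facets.

(** * Lexicographic triangulations *)

Section Lexicographic.
Variables (V : finType) (M : sgsystem V).
Hypothesis omM : oriented_matroid M.
Implicit Types (X Y Z C D : sgset V) (S T I J B F : {set V}) (m x y z e f b : V).

Definition lexmax S m : bool :=
  (m \in S) && [forall x in S, enum_rank x <= enum_rank m].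

Lemma lexmax_ex S : S != set0 -> exists m, lexmax S m.
Proof.
case/set0Pn => x0 x0S; case: (@arg_maxnP V x0 (mem S) (fun x => enum_rank x) x0S) => m mS max.
by exists m; rewrite /lexmax; apply/andP; split => //; apply/forall_inP => x xS; apply: max.
Qed.

Lemma lexmax_uniq S m x : lexmax S m -> lexmax S x -> m = x.
Proof.
case/andP => mS /forall_inP h1 /andP[xS /forall_inP h2].
by apply/enum_rank_inj/val_inj/eqP; rewrite eqn_leq h1 ?h2.
Qed.

Lemma lexmaxS S T m : S \subset T -> m \in S -> lexmax T m -> lexmax S m.
Proof.
move=> sST mS /andP[_ /forall_inP h]; rewrite /lexmax mS; apply/forall_inP => x xS.
exact/h/(subsetP sST).
Qed.

(** With rapidly growing heights the element of largest index dominates the height of the linear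
    dependence X, so this is the sign of that height. *)
Definition maxpos X : bool := [exists m, lexmax (supp X) m && (m \in pos X)].

Lemma maxposP X m : X \in circuits M -> lexmax (supp X) m -> maxpos X = (m \in pos X).
Proof.
move=> hX hm; apply/existsP/idP => [[x /andP[hx]]|mX]; first by rewrite (lexmax_uniq hx hm).
by exists m; rewrite hm.
Qed.

Lemma maxpos_sopp X : X \in circuits M -> maxpos (sopp X) = ~~ maxpos X.
Proof.
move=> hX; have [m hm] := lexmax_ex (circ_neq0 omM hX).
rewrite (maxposP hX hm) (@maxposP _ m) ?circ_opp ?supp_sopp //=.
have : m \in supp X by case/andP: hm.
rewrite mem_supp; case mp: (m \in pos X) => /=; last by move=> ->.
by rewrite (negPf (circ_posN omM hX mp)).
Qed.

(* The lower facets of the lifting of the i-th element to height N ^ i, N large: the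
   circuit in e |: B, positive at e, has a positive top element iff e lies above B. *)
Definition lex_simplex B : bool :=
  basis M B && [forall X in circuits M, [forall e in ground M :\: B,
    (supp X \subset e |: B) && (e \in pos X) ==> maxpos X]].

Lemma lex_simplexP B : reflect (basis M B /\ forall X e, X \in circuits M ->
  e \in ground M -> e \notin B -> supp X \subset e |: B -> e \in pos X -> maxpos X)
  (lex_simplex B).
Proof.
apply: (iffP andP) => [[hB h]|[hB h]]; split=> //.
  move=> X e hX ge eB sX eX; have /forall_inP/(_ e) := forall_inP h X hX.
  by rewrite inE eB ge sX eX => /(_ isT).
apply/forall_inP => X hX; apply/forall_inP => e /setDP[ge eB]; apply/implyP => /andP[sX eX].
exact: h sX eX.
Qed.

(** A basis of least total index works: by exchange, e has the largest index in its fundamental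
    circuit, so the top element is e itself. *)
Lemma lex_exists : exists B, lex_simplex B.
Proof.
have [B0 [sB0 hB0 cB0]] := rk_ex omM (ground M).
have b0 : basis M B0 by rewrite /basis hB0 cB0 eqxx.
case: (@arg_minnP _ B0 (basis M) (fun B => \sum_(x in B) enum_rank x) b0) => B hB min.
exists B; apply/lex_simplexP; split=> // X e hX ge eB sX eX.
have eX' : e \in supp X by rewrite mem_supp eX.
apply/existsP; exists e; rewrite eX andbT /lexmax eX' /=; apply/forall_inP => x xX.
have [->//|xe] := eqVneq x e.
have xB : x \in B by have := subsetP sX x xX; rewrite in_setU1 (negPf xe).
have hi := indep_exchange omM (basis_indep hB) ge hX sX xX.
have eB' : (e |: B) :\ x = e |: (B :\ x).
  by apply/setP => y; rewrite !inE; case: (eqVneq y e) => //= ->; rewrite eq_sym xe.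
have neB : e \notin B :\ x by rewrite inE (negPf eB) andbF.
have hB' : basis M (e |: (B :\ x)).
  by rewrite /basis -eB' hi eB' cardsU1 neB -(basis_card hB) (cardsD1 x B) xB eqxx.
have := min _ hB'; rewrite (big_setU1 _ neB) (big_setD1 x xB) /=.
by rewrite leq_add2r.
Qed.

(** In the realizable case C is, off B, a negative combination of fundamental circuits of B, each of
    positive height. The proof replaces the combination by the top element m of the union U of these
    circuits and shows that C is negative there. *)
Lemma lex_neg B C : lex_simplex B -> C \in circuits M -> pos C \subset B -> ~~ maxpos C.
Proof.
move=> /lex_simplexP[hB hl] hC pC.
have negC e : e \in supp C -> e \notin B -> e \in neg C.
  by rewrite mem_supp => /orP[/(subsetP pC)->|].
have gC e : e \in supp C -> e \in ground M by exact: (subsetP (circ_ground omM hC)).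
pose circB e X := [&& X \in circuits M, supp X \subset e |: B & e \in pos X].
pose U := [set x | [exists e in supp C :\: B, [exists X, circB e X && (x \in supp X)]]].
have inU e X x : e \in supp C -> e \notin B -> circB e X -> x \in supp X -> x \in U.
  move=> eC eB hX xX; rewrite inE; apply/exists_inP; exists e; first by rewrite inE eB.
  by apply/existsP; exists X; rewrite hX.
have fund e : e \in supp C -> e \notin B -> exists X, circB e X.
  move=> eC eB; have [X [h1 h2 h3]] := fund_circ omM hB (gC e eC) eB.
  by exists X; apply/and3P.
(* An element g of C in B is reached through its fundamental cocircuit: orthogonality to C gives
   another element j of C off B, and orthogonality to the circuit of j forces g into that
   circuit. *)
have CU : supp C \subset U.
  apply/subsetP => g gC'; have [gB|gB] := boolP (g \in B); last first.
    have [X hX] := fund g gC' gB; have /and3P[_ _ gX] := hX.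
    by apply: inU hX _ => //; rewrite mem_supp gX.
  have [D [hD sD gD]] := fund_cocircuit omM hB gB.
  have gD' : g \in supp D by rewrite mem_supp gD.
  have [j [jC jD jg]] : exists j, [/\ j \in supp C, j \in supp D & j != g].
    have dC := circ_disj omM hC; have dD := cocircuit_disj hD.
    have /orP[ag|og] := supp_agree gC' gD'.
      have [j oj] := circ_agree omM hC hD ag; have /andP[j1 j2] := oppose_supp oj.
      exists j; split=> //; apply: contraTneq oj => ->; exact: agree_oppose.
    have [j aj] := circ_oppose omM hC hD og; have /andP[j1 j2] := agree_supp aj.
    by exists j; split=> //; apply: contraTneq og => <-; exact: agree_oppose.
  have jB : j \notin B by apply: contra jg => jB; rewrite -(fund_cocircuitP omM hB gB sD jB).
  have [X hX] := fund j jC jB; have /and3P[h1 h2 h3] := hX; apply: (inU j X) => //.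
  have jX : j \in supp X by rewrite mem_supp h3.
  apply: contraT => gX; have dD := cocircuit_disj hD; have dX := circ_disj omM h1.
  have inX k : k \in supp X -> k \in supp D -> k = j.
    move=> kX kD; case/setU1P: (subsetP h2 k kX) => // kB.
    by move: kD; rewrite (fund_cocircuitP omM hB gB sD kB) => /eqP kg; rewrite -kg kX in gX.
  have /orP[aj|oj] := supp_agree jX jD.
    have [k ok] := circ_agree omM h1 hD aj; have /andP[kX kD] := oppose_supp ok.
    by move: (agree_oppose dX dD aj); rewrite -(inX k kX kD) ok.
  have [k ak] := circ_oppose omM h1 hD oj; have /andP[kX kD] := agree_supp ak.
  by move: (agree_oppose dX dD ak); rewrite (inX k kX kD) oj.
have [m hm] : exists m, lexmax U m.
  apply: lexmax_ex; have [x xC] := set0Pn _ (circ_neq0 omM hC).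
  by apply/set0Pn; exists x; exact: (subsetP CU).
have maxX e X : e \in supp C -> e \notin B -> circB e X -> m \in supp X -> m \in pos X.
  move=> eC eB hX mX; have /and3P[h1 h2 h3] := hX.
  have lm : lexmax (supp X) m.
    by apply: lexmaxS mX hm; apply/subsetP => x; exact: inU eC eB hX.
  by rewrite -(maxposP h1 lm); apply: hl h3 => //; exact: gC.
suff mn : m \in neg C.
  have mC : m \in supp C by rewrite mem_supp mn orbT.
  by rewrite (maxposP hC (lexmaxS CU mC hm)) (circ_negP omM hC).
have : m \in U by case/andP: hm.
rewrite inE => /exists_inP[e /setDP[eC eB] /existsP[X /andP[hX mX]]].
have /and3P[h1 h2 h3] := hX.
have [mB|mB] := boolP (m \in B); last first.
  have -> : m = e by case/setU1P: (subsetP h2 m mX) => // mB'; rewrite mB' in mB.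
  exact: negC.
(* The circuit of e makes the cocircuit of m negative at e, so C agrees with it there and opposes it
   at some k. If k is off B, the circuit of k is negative at m, against [maxX]; so k is m, and C is
   negative at m. *)
have [D [hD sD mD]] := fund_cocircuit omM hB mB.
have dis : [disjoint B :\ m & supp D].
  apply/pred0P => x /=; apply/negP => /andP[/setD1P[xm xB]].
  by rewrite (fund_cocircuitP omM hB mB sD xB) (negPf xm).
have mX' := maxX e X eC eB hX mX.
have sX : supp X \subset m |: (e |: B :\ m) by rewrite setUCA setD1K.
have aX : agree X D m by rewrite /agree mX' mD.
have := cocircuit_two omM hD h1 sX dis aX.
rewrite /oppose /agree /= h3 (negPf (circ_posN omM h1 h3)) /= => eD.
have aC : agree C D e by rewrite /agree eD negC // orbT.
have [k ok] := circ_agree omM hC hD aC; have /andP[kC kD] := oppose_supp ok.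
have [kB|kB] := boolP (k \in B).
  move: kD ok; rewrite (fund_cocircuitP omM hB mB sD kB) => /eqP ->.
  by rewrite /oppose /agree /= mD (disj_posF (cocircuit_disj hD) mD) andbF andbT orbF.
have kn := negC k kC kB.
have kp : k \in pos D.
  by move: ok; rewrite /oppose /agree /= kn (negPf (circ_negP omM hC kn)) orbF.
have [Y hY] := fund k kC kB; have /and3P[g1 g2 g3] := hY.
have sY : supp Y \subset k |: (m |: B :\ m) by rewrite setD1K.
have aY : agree Y D k by rewrite /agree g3 kp.
have := cocircuit_two omM hD g1 sY dis aY.
rewrite /oppose /agree /= mD (disj_posF (cocircuit_disj hD) mD) andbF andbT orbF => mY.
have mYs : m \in supp Y by rewrite mem_supp mY orbT.
by have := maxX k Y kC kB hY mYs; rewrite (negPf (circ_negP omM g1 mY)).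
Qed.

(* S with x, y and z has nullity 2, so that Z3 comes from Z1 and Z2 by eliminating y. *)
Lemma maxpos_triple D S x y z Z1 Z2 : cocircuit M D -> indep M S -> #|S|.+1 = mrank M ->
    [disjoint S & supp D] -> x \in supp D -> y \in supp D -> z \in supp D ->
    x != y -> y != z -> x != z -> Z1 \in circuits M -> Z2 \in circuits M ->
    supp Z1 \subset x |: (y |: S) -> supp Z2 \subset y |: (z |: S) ->
    oppose Z1 Z2 y -> maxpos Z1 -> maxpos Z2 ->
  exists Z3, [/\ Z3 \in circuits M, supp Z3 \subset x |: (z |: S), maxpos Z3,
    agree Z3 Z1 x & agree Z3 Z2 z].
Proof.
move=> hD hS cS dS xD yD zD xy yz xz hZ1 hZ2 sZ1 sZ2 oy mp1 mp2.
have sD := cocircuit_supp omM hD hS cS dS.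
have out u : u \in supp D -> u \notin S by move=> uD; rewrite (disjointFl dS uD).
have ind u : u \in supp D -> indep M (u |: S).
  by rewrite sD => /setDP[gu uS]; have /andP[] := closure_nin_indep omM hS gu uS.
have both u v Z : u \in supp D -> v \in supp D -> u != v -> Z \in circuits M ->
    supp Z \subset u |: (v |: S) -> (u \in supp Z) /\ (v \in supp Z).
  move=> uD vD uv hZ sZ; split; first exact: (circ_mem_ext (ind v vD) hZ sZ).
  by rewrite setUCA in sZ; exact: (circ_mem_ext (ind u uD) hZ sZ).
have [xZ1 yZ1] := both x y Z1 xD yD xy hZ1 sZ1.
have [yZ2 zZ2] := both y z Z2 yD zD yz hZ2 sZ2.
have xZ2 : x \notin supp Z2.
  by apply/negP => /(subsetP sZ2); rewrite !in_setU1 (negPf xy) (negPf xz) (negPf (out x xD)).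
have zZ1 : z \notin supp Z1.
  apply/negP => /(subsetP sZ1); rewrite !in_setU1 ![z == _]eq_sym (negPf yz) (negPf xz).
  by rewrite (negPf (out z zD)).
have [|Z3 [hZ3 pZ3 nZ3]] := circ_elim_oppose omM hZ1 hZ2 _ oy.
  by move=> eq; rewrite -supp_sopp -eq xZ1 in xZ2.
have suZ3 := elim_supp pZ3 nZ3.
have sZ3 : supp Z3 \subset x |: (z |: S).
  apply: subset_trans suZ3 _; apply/subsetP => t; rewrite in_setD1 in_setU => /andP[ty].
  by case/orP => [/(subsetP sZ1)|/(subsetP sZ2)]; rewrite !in_setU1 (negPf ty) /= => /orP[->|->];
    rewrite ?orbT.
have [xZ3 zZ3] := both x z Z3 xD zD xz hZ3 sZ3.
have noag W Y t : t \notin supp W -> agree W Y t = false.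
  by move=> tW; apply/negP => /agree_supp/andP[]; rewrite (negPf tW).
have noop W Y t : t \notin supp W -> oppose W Y t = false.
  by move=> tW; apply/negP => /oppose_supp/andP[]; rewrite (negPf tW).
have a31 : agree Z3 Z1 x.
  have /andP[_] := elim_agree pZ3 nZ3 (agree_refl xZ3).
  by rewrite (noag Z2 _ x xZ2) orbF agreeC.
have a32 : agree Z3 Z2 z.
  have /andP[_] := elim_agree pZ3 nZ3 (agree_refl zZ3).
  by rewrite (noag Z1 _ z zZ1) /= agreeC.
have d1 := circ_disj omM hZ1; have d2 := circ_disj omM hZ2; have d3 := circ_disj omM hZ3.
pose U := supp Z1 :|: supp Z2.
have [m hm] : exists m, lexmax U m.
  by apply: lexmax_ex; apply/set0Pn; exists x; rewrite in_setU xZ1.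
have m1 : m \in supp Z1 -> m \in pos Z1.
  by move=> mZ; rewrite -(maxposP hZ1 (lexmaxS (subsetUl _ _) mZ hm)).
have m2 : m \in supp Z2 -> m \in pos Z2.
  by move=> mZ; rewrite -(maxposP hZ2 (lexmaxS (subsetUr _ _) mZ hm)).
have n1 : m \notin neg Z1.
  by apply/negP => mn; have := m1 _; rewrite mem_supp mn orbT (negPf (circ_negP omM hZ1 mn)) => /(_ isT).
have n2 : m \notin neg Z2.
  by apply/negP => mn; have := m2 _; rewrite mem_supp mn orbT (negPf (circ_negP omM hZ2 mn)) => /(_ isT).
have sZ3U : supp Z3 \subset U := subset_trans suZ3 (subD1set _ _).
suff mZ3 : m \in supp Z3.
  exists Z3; split=> //; rewrite (maxposP hZ3 (lexmaxS sZ3U mZ3 hm)).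
  move: mZ3; rewrite mem_supp => /orP[//|/(subsetP nZ3)].
  by rewrite in_setD1 in_setU (negPf n1) (negPf n2) andbF.
apply: contraT => nm3.
(* If m were lost in [Z3], eliminating again would recover one of the original circuits A, up to
   sign uniquely determined, as positive at m; but a positive sign at m can come neither from [Z3]
   nor from the opposite of the other circuit. *)
have recover A A' u v : A \in circuits M -> A' \in circuits M -> u \in supp D -> y != u -> u != v ->
    v \in supp D ->
    supp A \subset u |: (y |: S) -> supp A' \subset y |: (v |: S) ->
    agree Z3 A u -> agree Z3 A' v -> u \notin supp A' -> supp Z3 \subset u |: (v |: S) ->
    m \in pos A -> m \notin neg A' -> False.
  move=> hA hA' uD yu uv vD sA sA' au av uA' s3 mA mA'.
  have dA := circ_disj omM hA; have dA' := circ_disj omM hA'.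
  have uZ3 : u \in supp Z3 by case/andP: (agree_supp au).
  have ov : oppose Z3 (sopp A') v by rewrite /oppose agree_soppr oppose_sopp.
  have [|W [hW pW nW]] := circ_elim_oppose omM hZ3 (circ_opp omM hA') _ ov.
    by rewrite soppK => eq; rewrite -eq uZ3 in uA'.
  have sW : supp W \subset u |: (y |: S).
    apply: subset_trans (elim_supp pW nW) _; rewrite supp_sopp.
    apply/subsetP => t; rewrite in_setD1 in_setU => /andP[tv].
    by case/orP => [/(subsetP s3)|/(subsetP sA')]; rewrite !in_setU1 (negPf tv) /= => /orP[->|->];
      rewrite ?orbT.
  have uy : u != y by rewrite eq_sym.
  have [uW yW] := both u y W uD yD uy hW sW.
  have auW : agree Z3 W u.
    have /andP[_] := elim_agree pW nW (agree_refl uW).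
    by rewrite (noag (sopp A')) ?supp_sopp // orbF.
  have eW : W = A.
    have [//|eq] := circ_ext_uniq omM (ind y yD) hW hA sW sA.
    move: auW; rewrite eq agree_soppr => o.
    by have := agree_oppose d3 dA au; rewrite o.
  have := subsetP pW m; rewrite eW mA => /(_ isT).
  rewrite in_setD1 in_setU /= (negPf mA') orbF => /andP[_ mp].
  by rewrite mem_supp mp in nm3.
have : m \in U by case/andP: hm.
rewrite in_setU => /orP[mZ|mZ]; exfalso.
  by apply: (recover Z1 Z2 x z) => //; [rewrite eq_sym|exact: m1].
have sZ1' : supp Z1 \subset y |: (x |: S) by rewrite setUCA.
have sZ2' : supp Z2 \subset z |: (y |: S) by rewrite setUCA.
have sZ3' : supp Z3 \subset z |: (x |: S) by rewrite setUCA.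
by apply: (recover Z2 Z1 z x) => //; [rewrite eq_sym|exact: m2].
Qed.

(** Properness: a circuit with its two sides in two simplices would have a negative top element both
    for itself and for its opposite. Ridges: across an inner ridge S the next vertex is the lowest
    one, as seen from S, on the other side. *)
Lemma lex_triangulation : triangulation M [set B | lex_simplex B].
Proof.
split.
- by have [B hB] := lex_exists; apply/set0Pn; exists B; rewrite inE.
- by move=> B; rewrite inE => /andP[].
- move=> B B'; rewrite !inE => hB hB' [C hC /andP[pC nC]].
  have := lex_neg hB hC pC; have := lex_neg hB' (circ_opp omM hC) nC.
  by rewrite maxpos_sopp // negbK => ->.
move=> B b; rewrite inE => /lex_simplexP[hB hl] bB.
have [D [hD sD bD]] := fund_cocircuit omM hB bB.
have dD := cocircuit_disj hD.
have [hS cS bS] := basisD1 omM hB bB; set S := B :\ b in hS cS bS sD *.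
have dS : [disjoint S & supp D].
  apply/pred0P => x /=; apply/negP => /andP[/setD1P[xb xB]].
  by rewrite (fund_cocircuitP omM hB bB sD xB) (negPf xb).
have [nD|nD] := eqVneq (neg D) set0; [by left; exists D|right].
have bDs : b \in supp D by rewrite mem_supp bD.
have out u : u \in supp D -> u \notin S by move=> uD; rewrite (disjointFl dS uD).
have gD u : u \in supp D -> u \in ground M by apply: (subsetP (cocircuit_ground hD)).
have ind u : u \in supp D -> indep M (u |: S).
  by rewrite sD => /setDP[gu uS]; have /andP[] := closure_nin_indep omM hS gu uS.
have bas u : u \in supp D -> basis M (u |: S).
  by move=> uD; rewrite /basis ind // cardsU1 out // add1n cS eqxx.
have eB : b |: S = B by rewrite setD1K.
have negS u : u \in neg D -> u \in supp D by rewrite mem_supp orbC => ->.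
(* Read as: e lies above the simplex spanned by f and S. On the negative side of D this is a total
   order, transitive by [maxpos_triple]. *)
pose prec f e := [exists Z in circuits M,
  [&& supp Z \subset e |: (f |: S), e \in pos Z, f \in neg Z & maxpos Z]].
have precP f e : reflect (exists Z, [/\ Z \in circuits M, supp Z \subset e |: (f |: S),
    e \in pos Z, f \in neg Z & maxpos Z]) (prec f e).
  apply: (iffP exists_inP) => [[Z h /and4P[h1 h2 h3 h4]]|[Z [h h1 h2 h3 h4]]]; exists Z => //.
  by apply/and4P.
have total f e : f \in neg D -> e \in neg D -> f != e -> prec f e || prec e f.
  move=> fD eD fe; have [fs es] := (negS f fD, negS e eD).
  have [|Z [hZ sZ eZ]] := fund_circ omM (bas f fs) (gD e es).
    by rewrite in_setU1 negb_or eq_sym fe out.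
  have oZ : oppose Z D e by rewrite /oppose /agree /= eZ eD orbT.
  have := cocircuit_two omM hD (circ_opp omM hZ) _ dS oZ; rewrite supp_sopp => /(_ _ sZ).
  rewrite oppose_sopp /agree fD (disj_negF dD fD) andbF andbT /= => fZ.
  have [mZ|mZ] := boolP (maxpos Z); first by apply/orP; left; apply/precP; exists Z.
  apply/orP; right; apply/precP; exists (sopp Z).
  by rewrite circ_opp // supp_sopp maxpos_sopp // setUCA; split.
have nprec f : prec f f = false.
  by apply/precP => -[Z [hZ _ p n _]]; have := circ_posN omM hZ p; rewrite n.
have trans f f' e : f \in neg D -> f' \in neg D -> e \in neg D -> f' != e -> f' != f -> f != e ->
    prec f' f -> prec f e -> prec f' e.
  move=> fD f'D eD ne1 ne2 ne3 /precP[Z1 [hZ1 sZ1 p1 n1 m1]] /precP[Z2 [hZ2 sZ2 p2 n2 m2]].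
  have o : oppose Z1 Z2 f by rewrite /oppose /agree /= p1 n2 orbT.
  rewrite setUCA in sZ1; rewrite setUCA in sZ2.
  have [Z3 [hZ3 sZ3 m3 a1 a2]] := maxpos_triple hD hS cS dS (negS _ f'D) (negS _ fD) (negS _ eD)
    ne2 ne3 ne1 hZ1 hZ2 sZ1 sZ2 o m1 m2.
  apply/precP; exists Z3; split=> //; first by rewrite setUCA.
    by move: a2; rewrite /agree p2 (negPf (circ_posN omM hZ2 p2)) andbF andbT orbF.
  by move: a1; rewrite /agree n1 (negPf (circ_negP omM hZ1 n1)) andbF andbT.
(* An f below the largest number of others is a minimum: an element e not above f would be below f
   and below everything that f is below. *)
have [f fD fmin] : exists2 f, f \in neg D & forall e, e \in neg D -> e != f -> prec f e.
  have [f0 f0D] := set0Pn _ nD.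
  case: (@arg_maxnP V f0 (mem (neg D)) (fun f => #|[set e in neg D | prec f e]|) f0D) => f fD0 max.
  have fD : f \in neg D := fD0.
  exists f => // e eD ef; have fe : f != e by rewrite eq_sym.
  have /orP[//|pef] := total f e fD eD fe.
  apply: contraT => npfe; have := max e eD; rewrite /= leqNgt => /negP[]; apply/proper_card/properP; split.
    apply/subsetP => x; rewrite !inE => /andP[xD px]; rewrite xD /=.
    have [xe|xe] := eqVneq x e; first by rewrite -xe px in npfe.
    have [xf|xf] := eqVneq x f; first by rewrite xf nprec in px.
    by apply: (trans f e x) => //; rewrite eq_sym.
  exists f; first by rewrite inE fD pef.
  by apply/negP; rewrite inE => /andP[_]; rewrite nprec.
have fs := negS f fD.
have fb : f != b by apply: contraTneq fD => ->; rewrite (disj_posF dD bD).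
have fB : f \notin B by rewrite -eB in_setU1 negb_or fb out.
have [X2 [hX2 sX2 fX2]] := fund_circ omM hB (gD f fs) fB.
have m2 : maxpos X2 := hl X2 f hX2 (gD f fs) fB sX2 fX2.
have bX2 : b \in pos X2.
  have sX2' : supp (sopp X2) \subset f |: (b |: S) by rewrite supp_sopp eB.
  have a : agree (sopp X2) D f by rewrite /agree /= fX2 fD orbT.
  have := cocircuit_two omM hD (circ_opp omM hX2) sX2' dS a.
  by rewrite oppose_sopp /agree bD (disj_posF dD bD) andbF andbT orbF.
exists (f |: S); split; last first.
- exact: subsetUr.
- by move=> eq; move: fB; rewrite -eq setU11.
rewrite inE; apply/lex_simplexP; split; first exact: bas.
have uniqX X Z e : X \in circuits M -> Z \in circuits M -> supp X \subset e |: (f |: S) ->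
    supp Z \subset e |: (f |: S) -> e \in pos X -> e \in pos Z -> X = Z.
  move=> hX hZ sX sZ eX eZ; have [//|eq] := circ_ext_uniq omM (ind f fs) hX hZ sX sZ.
  by move: eX; rewrite eq /= (negPf (circ_posN omM hZ eZ)).
(* The element e is b, or lies in the hyperplane of the ridge, or on the side of f, or on the side
   of b. The first two cases come from B itself and the third from the choice of f. *)
move=> X e hX ge; rewrite in_setU1 negb_or => /andP[ef eS] sX eX.
have [eb|eb] := eqVneq e b.
  rewrite eb in sX eX; have sX' : supp X \subset f |: B by rewrite -eB setUCA.
  apply: (hl X f) => //; first exact: gD.
  have a : agree X D b by rewrite /agree eX bD.
  have := cocircuit_two omM hD hX sX dS a.
  by rewrite /oppose /agree /= fD (disj_negF dD fD) andbF andbT.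
have eB' : e \notin B by rewrite -eB in_setU1 negb_or eb.
have [eD|eD] := boolP (e \in supp D); last first.
  have ecl : e \in closure M S by apply: contraNT eD => ecl; rewrite sD inE ecl.
  have [|Y [hY sY eY]] := ext_circ omM hS ge _.
    by move: ecl; rewrite mem_closure_indep // ge (negPf eS).
  have sY1 : supp Y \subset e |: (f |: S).
    by apply: subset_trans sY _; rewrite setUS // subsetUr.
  rewrite (uniqX X Y e) //; apply: (hl Y e) => //.
  by apply: subset_trans sY _; rewrite -eB setUS // subsetUr.
move: (eD); rewrite mem_supp => /orP[ep|en]; last first.
  have /precP[Z [hZ sZ eZ _ mZ]] := fmin e en ef.
  by rewrite (uniqX X Z e).
(* On the side of b, the circuit of e over B and that of f over B have opposite signs at b;
   eliminating b keeps the top positive and leaves the circuit of e over f and S. *)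
have [X1 [hX1 sX1 eX1]] := fund_circ omM hB ge eB'.
have m1 : maxpos X1 := hl X1 e hX1 ge eB' sX1 eX1.
have sX1' : supp X1 \subset e |: (b |: S) by rewrite eB.
have bX1 : b \in neg X1.
  have a : agree X1 D e by rewrite /agree eX1 ep.
  have := cocircuit_two omM hD hX1 sX1' dS a.
  by rewrite /oppose /agree /= bD (disj_posF dD bD) andbF andbT orbF.
have sX2' : supp X2 \subset b |: (f |: S) by rewrite setUCA eB.
have o : oppose X1 X2 b by rewrite /oppose /agree /= bX1 bX2.
have bf : b != f by rewrite eq_sym.
have [Z3 [hZ3 sZ3 m3 a1 _]] := maxpos_triple hD hS cS dS eD bDs fs eb bf ef hX1 hX2 sX1' sX2' o m1 m2.
rewrite (uniqX X Z3 e) //.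
by move: a1; rewrite /agree eX1 (negPf (circ_posN omM hX1 eX1)) andbF andbT orbF.
Qed.

End Lexicographic.

(** * The exterior algebra *)

Section Alternating.
Import GRing.Theory.
Local Open Scope ring_scope.
Variables (T : eqType).
Implicit Types (s t : seq T).

Definition antisymmetric_seq (W : zmodType) (F : seq T -> W) : Prop :=
  forall s1 a b s2, F (s1 ++ a :: b :: s2) = - F (s1 ++ b :: a :: s2).

Definition alternating_seq (W : zmodType) (F : seq T -> W) : Prop :=
  antisymmetric_seq F /\ forall a s, F [:: a, a & s] = 0.

Lemma antisymmetric_move (W : zmodType) (F : seq T -> W) s1 a s2 : antisymmetric_seq F ->
  F (s1 ++ a :: s2) = if odd (size s1) then - F (a :: s1 ++ s2) else F (a :: s1 ++ s2).
Proof.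
move=> hF; elim/last_ind: s1 s2 => //= s1 x IH s2.
by rewrite size_rcons /= cat_rcons hF IH cat_rcons; case: (odd _); rewrite ?opprK.
Qed.

(** The sign is chosen before the function, so one and the same b serves for a chirotope and for a
    wedge product at once. This is what makes their product independent of the order. *)
Lemma perm_sign s t : perm_eq s t -> exists b : bool, forall (W : zmodType) (F : seq T -> W),
  antisymmetric_seq F -> F t = if b then - F s else F s.
Proof.
elim: s t => [|x s IH] t.
  by rewrite perm_sym => /perm_nilP ->; exists false.
move=> p; have xt : x \in t by rewrite -(perm_mem p) mem_head.
case/splitPr: xt p => t1 t2 p.
have {}p : perm_eq s (t1 ++ t2).
  rewrite -(perm_cons x); apply: perm_trans p _.
  by rewrite -(cat1s x t2) perm_catCA.
have [b hb] := IH _ p; exists (b (+) odd (size t1)) => W F hF.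
have hF' : antisymmetric_seq (fun u => F (x :: u)).
  by move=> s1 a c s2; rewrite -!cat_cons hF.
rewrite antisymmetric_move // (hb _ _ hF').
by case: b {hb}; case: (odd _); rewrite ?opprK.
Qed.

Lemma not_uniq_perm s : ~~ uniq s -> exists a u, perm_eq s [:: a, a & u].
Proof.
elim: s => //= x s IH; rewrite negb_and negbK; have [xs _|_ /=] := boolP (x \in s).
  by exists x, (rem x s); rewrite perm_cons perm_to_rem.
case/IH => a [u p]; exists a, (x :: u).
rewrite -(perm_cons x) in p; apply: (perm_trans p).
by have := perm_refl ([:: a; a] ++ [:: x] ++ u); rewrite perm_catCA.
Qed.

Lemma alternating_not_uniq (W : zmodType) (F : seq T -> W) s :
  alternating_seq F -> ~~ uniq s -> F s = 0.
Proof.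
move=> [hF h0] /not_uniq_perm [a [u p]]; rewrite perm_sym in p.
by have [b hb] := perm_sign p; rewrite (hb _ _ hF) h0 oppr0; case: b {hb}.
Qed.

End Alternating.

Section ExteriorAlgebra.
Import GRing.Theory.
Local Open Scope ring_scope.
Variables (R : comPzRingType) (T : finType).
Implicit Types (x y z : ext R T) (S U W : {set T}) (a b : T) (s t : seq T).

Lemma monE S U : mon R S U = (U == S)%:R.
Proof. by rewrite ffunE. Qed.

Lemma ext_scaleE (c : R) x S : (c *: x) S = c * x S.
Proof. by rewrite ffunE. Qed.

Lemma ext_sum x : x = \sum_S x S *: mon R S.
Proof.
apply/ffunP => U; rewrite sum_ffunE (bigD1 U) //= big1 => [|S SU].
  by rewrite addr0 ext_scaleE monE eqxx mulr1.
by rewrite ext_scaleE monE eq_sym (negPf SU) mulr0.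
Qed.

Lemma wedgeE x y U : wedge x y U =
  \sum_(S : {set T} | S \subset U) (-1) ^+ inversions S (U :\: S) * (x S * y (U :\: S)).
Proof. by rewrite ffunE. Qed.

Lemma wedgeDl : left_distributive (@wedge R T) +%R.
Proof.
move=> x y z; apply/ffunP => U; rewrite [RHS]ffunE !wedgeE -big_split; apply: eq_bigr => S _.
by rewrite ffunE mulrDl mulrDr.
Qed.

Lemma wedgeDr : right_distributive (@wedge R T) +%R.
Proof.
move=> x y z; apply/ffunP => U; rewrite [RHS]ffunE !wedgeE -big_split; apply: eq_bigr => S _.
by rewrite ffunE mulrDr mulrDr.
Qed.

Lemma wedgeZl (c : R) x y : wedge (c *: x) y = c *: wedge x y.
Proof.
apply/ffunP => U; rewrite ext_scaleE !wedgeE mulr_sumr; apply: eq_bigr => S _.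
by rewrite ext_scaleE -mulrA mulrCA.
Qed.

Lemma wedgeZr (c : R) x y : wedge x (c *: y) = c *: wedge x y.
Proof.
apply/ffunP => U; rewrite ext_scaleE !wedgeE mulr_sumr; apply: eq_bigr => S _.
by rewrite ext_scaleE (mulrCA (x S)) [LHS]mulrCA.
Qed.

Lemma wedge_mon S U : wedge (mon R S) (mon R U) =
  if [disjoint S & U] then (-1) ^+ inversions S U *: mon R (S :|: U) else 0.
Proof.
apply/ffunP => W; rewrite wedgeE.
have [d|nd] := boolP [disjoint S & U]; last first.
  rewrite ffunE big1 // => S' S'W; rewrite !monE.
  case: eqP => [->|_]; last by rewrite mul0r mulr0.
  case: eqP => [e|_]; last by rewrite mulr0 mulr0.
  case/negP: nd; rewrite -e; apply/pred0P => x /=; rewrite inE.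
  by case: (x \in S).
rewrite ext_scaleE monE; case: eqP => [->|ne].
  rewrite (bigD1 S) ?subsetUl //= big1 => [|S' /andP[_ nS']]; last first.
    by rewrite monE (negPf nS') mul0r mulr0.
  have -> : (S :|: U) :\: S = U.
    rewrite setDUl setDv set0U; apply/setDidPl; by rewrite disjoint_sym.
  by rewrite !monE !eqxx !mulr1 addr0.
rewrite big1 ?mulr0 // => S' S'W; rewrite !monE.
case: eqP => [eS|_]; last by rewrite mul0r mulr0.
case: eqP => [eU|_]; last by rewrite !mulr0.
by case: ne; rewrite -eU eS; apply/setP => x; rewrite !inE;
  case xS: (x \in S) => //=; rewrite (subsetP S'W) // eS.
Qed.

Lemma inversionsUl S U W : [disjoint S & U] ->
  inversions (S :|: U) W = (inversions S W + inversions U W)%N.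
Proof.
move=> d; rewrite /inversions -cardsUI.
have -> : [set p in setX S W | (enum_rank p.2 < enum_rank p.1)%N] :&:
          [set p in setX U W | (enum_rank p.2 < enum_rank p.1)%N] = set0.
  apply/setP => -[p q]; rewrite !inE /=; apply/negP => /andP[/andP[/andP[pS _] _] /andP[/andP[pU _] _]].
  by rewrite (disjointFr d pS) in pU.
rewrite cards0 addn0; apply: eq_card => -[p q]; rewrite !inE /=.
by rewrite !andb_orl.
Qed.

Lemma inversionsUr S U W : [disjoint U & W] ->
  inversions S (U :|: W) = (inversions S U + inversions S W)%N.
Proof.
move=> d; rewrite /inversions -cardsUI.
have -> : [set p in setX S U | (enum_rank p.2 < enum_rank p.1)%N] :&:
          [set p in setX S W | (enum_rank p.2 < enum_rank p.1)%N] = set0.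
  apply/setP => -[p q]; rewrite !inE /=; apply/negP => /andP[/andP[/andP[_ qU] _] /andP[/andP[_ qW] _]].
  by rewrite (disjointFr d qU) in qW.
rewrite cards0 addn0; apply: eq_card => -[p q]; rewrite !inE /=.
by rewrite andb_orr !andb_orl.
Qed.

Lemma wedge0l x : wedge 0 x = 0.
Proof. by have := wedgeZl 0 0 x; rewrite !scale0r. Qed.

Lemma wedge0r x : wedge x 0 = 0.
Proof. by have := wedgeZr 0 x 0; rewrite !scale0r. Qed.

Lemma ext_ind (P : ext R T -> Prop) : P 0 -> (forall x y, P x -> P y -> P (x + y)) ->
  (forall c x, P x -> P (c *: x)) -> (forall S, P (mon R S)) -> forall x, P x.
Proof.
move=> P0 PD PZ Pm x; rewrite (ext_sum x); elim/big_ind: _ => // S _; exact: PZ.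
Qed.

Lemma wedgeA : associative (@wedge R T).
Proof.
move=> x y z; elim/ext_ind: x => [|x x' IH IH'|c x IH|S].
- by rewrite !wedge0l.
- by rewrite !wedgeDl IH IH'.
- by rewrite !wedgeZl IH.
elim/ext_ind: y => [|y y' IH IH'|c y IH|U].
- by rewrite !(wedge0l, wedge0r).
- by rewrite !(wedgeDl, wedgeDr) IH IH'.
- by rewrite !(wedgeZl, wedgeZr) IH.
elim/ext_ind: z => [|z z' IH IH'|c z IH|W].
- by rewrite !wedge0r.
- by rewrite !wedgeDr IH IH'.
- by rewrite !wedgeZr IH.
rewrite !wedge_mon.
have [dSU|nSU] := boolP [disjoint S & U]; have [dUW|nUW] := boolP [disjoint U & W];
  rewrite ?(wedge0l, wedge0r, wedgeZl, wedgeZr) ?wedge_mon //.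
- rewrite -!setI_eq0 setIUr setIUl !setU_eq0 !setI_eq0 dSU dUW andbT andTb.
  have [dSW|nSW] := boolP [disjoint S & W]; last by rewrite !scaler0.
  rewrite !scalerA setUA inversionsUl // inversionsUr // !exprD; congr (_ *: _).
  by rewrite mulrC -mulrA mulrCA [(-1) ^+ inversions S U * _]mulrC mulrA.
- rewrite -setI_eq0 setIUl setU_eq0 !setI_eq0 (negPf nUW) andbF scaler0 //.
- by rewrite -setI_eq0 setIUr setU_eq0 !setI_eq0 (negPf nSU) scaler0.
Qed.

Lemma wedge1l : left_id (mon R set0) (@wedge R T).
Proof.
elim/ext_ind => [|x y IH IH'|c x IH|S]; first by rewrite wedge0r.
- by rewrite wedgeDr IH IH'.
- by rewrite wedgeZr IH.
rewrite wedge_mon -setI_eq0 set0I eqxx set0U /inversions.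
by rewrite (_ : [set _ in _ | _] = set0) ?cards0 ?scale1r //; apply/setP => p; rewrite !inE.
Qed.

Lemma wedge1r : right_id (mon R set0) (@wedge R T).
Proof.
elim/ext_ind => [|x y IH IH'|c x IH|S]; first by rewrite wedge0l.
- by rewrite wedgeDl IH IH'.
- by rewrite wedgeZl IH.
rewrite wedge_mon -setI_eq0 setI0 eqxx setU0 /inversions.
by rewrite (_ : [set _ in _ | _] = set0) ?cards0 ?scale1r //; apply/setP => p; rewrite !inE andbF.
Qed.

(** The wedge becomes the ring multiplication, so that the generic algebra of rings and big sums
    applies to it; the two stay convertible. *)
HB.instance Definition _ := GRing.Zmodule_isPzRing.Build (ext R T)
  wedgeA wedge1l wedge1r wedgeDl wedgeDr.

Lemma wedgeM x y : wedge x y = x * y.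
Proof. by []. Qed.

Lemma extZl (c : R) x y : (c *: x) * y = c *: (x * y).
Proof. exact: wedgeZl. Qed.

Lemma extZr (c : R) x y : x * (c *: y) = c *: (x * y).
Proof. exact: wedgeZr. Qed.

Definition gen a : ext R T := mon R [set a].

Lemma gen_sq a : gen a * gen a = 0.
Proof. by rewrite -wedgeM wedge_mon -setI_eq0 setIid -cards_eq0 cards1. Qed.

Lemma inversions11 a b : inversions [set a] [set b] = (enum_rank b < enum_rank a)%N.
Proof.
rewrite /inversions; case: (boolP (enum_rank b < enum_rank a)%N) => h /=.
  rewrite -[RHS](cards1 (a, b)); apply: eq_card => -[p q]; rewrite !inE /= xpair_eqE.
  by case: (eqVneq p a) => //= ->; case: (eqVneq q b) => //= ->.
apply/eqP; rewrite cards_eq0; apply/eqP/setP => -[p q]; rewrite !inE /=.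
by apply/negP => /andP[/andP[/eqP -> /eqP ->]]; apply/negP.
Qed.

Lemma gen_anti a b : gen a * gen b = - (gen b * gen a).
Proof.
have [->|ab] := eqVneq a b; first by rewrite gen_sq oppr0.
rewrite -!wedgeM !wedge_mon !disjoints1 !inE (eq_sym b) ab (setUC [set b]) !inversions11.
case: ltngtP => [_|_|/val_inj/enum_rank_inj e] /=; rewrite ?expr0 ?expr1 ?scale1r ?scaleN1r ?opprK //.
by rewrite e eqxx in ab.
Qed.

End ExteriorAlgebra.

Arguments emon : simpl never.
Arguments bdry_seq : simpl never.

(** * Linear extension of alternating functions of sequences *)

Section LinearExtension.
Import GRing.Theory.
Local Open Scope ring_scope.
Variables (R : comPzRingType) (T : finType).
Implicit Types (x y z : ext R T) (S U : {set T}) (a b : T) (s t : seq T).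

Lemma emon_cons a s : emon R (a :: s) = gen R a * emon R s.
Proof. by []. Qed.

Lemma emon_nil : emon R [::] = 1 :> ext R T.
Proof. by []. Qed.

Lemma emon_cat s t : emon R (s ++ t) = emon R s * emon R t.
Proof. by elim: s => [|a s IH]; rewrite ?emon_nil ?mul1r // cat_cons !emon_cons IH mulrA. Qed.

Lemma emon_alternating : alternating_seq (@emon R T).
Proof.
split=> [s1 a b s2|a s]; last by rewrite !emon_cons mulrA gen_sq mul0r.
by rewrite !emon_cat !emon_cons ![gen R _ * (_ * _)]mulrA gen_anti mulNr mulrN.
Qed.

(** This ties the order of [enum] to the one counted by [inversions], so that the monomial of an
    enumerated set carries no sign. *)
Lemma enum_rank_sorted S : sorted (fun a b => enum_rank a < enum_rank b)%N (enum S).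
Proof.
rewrite {1}/enum_mem; apply: sorted_filter => [b a c|]; first exact: ltn_trans.
have -> : (fun a b => enum_rank a < enum_rank b)%N = relpre (fun a : T => nat_of_ord (enum_rank a)) ltn by [].
rewrite -sorted_map; suff -> : map (fun a : T => nat_of_ord (enum_rank a)) (Finite.enum T) = iota 0 #|T|.
  exact: iota_ltn_sorted.
rewrite -enumT; apply: (@eq_from_nth _ 0%N) => [|i]; first by rewrite size_map size_iota cardT.
rewrite size_map -cardT => lt; rewrite nth_iota // add0n.
have a0 : T by case: (enum T) (cardT T) lt => [->|//].
rewrite (nth_map a0) -?cardT //.
by have := enum_valK (Ordinal lt); rewrite (enum_val_nth a0) => ->.
Qed.

Lemma emon_sorted s : sorted (fun a b => enum_rank a < enum_rank b)%N s ->
  emon R s = mon R [set x in s].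
Proof.
elim: s => [|a s IH] h; first by rewrite emon_nil set_nil.
have ha : all (fun b => enum_rank a < enum_rank b)%N s.
  by apply: (order_path_min _ h) => b c d; apply: ltn_trans.
rewrite emon_cons IH; last exact: path_sorted h.
rewrite /gen -wedgeM wedge_mon disjoints1 inE.
have nas : a \notin s by apply/negP => /(allP ha); rewrite ltnn.
rewrite nas set_cons (_ : inversions _ _ = 0%N) ?expr0 ?scale1r //.
apply/eqP; rewrite cards_eq0; apply/eqP/setP => -[p q]; rewrite !inE /=.
apply/negP => /andP[/andP[/eqP -> qs]]; apply/negP; rewrite -leqNgt.
by rewrite ltnW // (allP ha).
Qed.

Lemma emon_enum S : emon R (enum S) = mon R S.
Proof.
rewrite emon_sorted ?enum_rank_sorted //; congr mon; apply/setP => x.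
by rewrite inE mem_enum.
Qed.

Lemma emon_ind (P : ext R T -> Prop) : P 0 -> (forall x y, P x -> P y -> P (x + y)) ->
  (forall c x, P x -> P (c *: x)) -> (forall s, P (emon R s)) -> forall x, P x.
Proof. by move=> P0 PD PZ Pe; apply: ext_ind => // S; rewrite -emon_enum. Qed.

Section LinExt.
Variable W : lmodType R.
Implicit Types F : seq T -> W.

Definition lin_ext F x : W := \sum_S x S *: F (enum S).

Lemma lin_extD F x y : lin_ext F (x + y) = lin_ext F x + lin_ext F y.
Proof. by rewrite -big_split; apply: eq_bigr => S _; rewrite ffunE scalerDl. Qed.

Lemma lin_extZ F (c : R) x : lin_ext F (c *: x) = c *: lin_ext F x.
Proof. by rewrite scaler_sumr; apply: eq_bigr => S _; rewrite ext_scaleE scalerA. Qed.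

Lemma lin_ext0 F : lin_ext F 0 = 0.
Proof. by have := lin_extZ F 0 0; rewrite !scale0r. Qed.

Lemma lin_extN F x : lin_ext F (- x) = - lin_ext F x.
Proof. by rewrite -!scaleN1r lin_extZ. Qed.

Lemma lin_extB F x y : lin_ext F (x - y) = lin_ext F x - lin_ext F y.
Proof. by rewrite lin_extD lin_extN. Qed.

Lemma lin_ext_sum F (I : Type) (r : seq I) (P : pred I) (X : I -> ext R T) :
  lin_ext F (\sum_(i <- r | P i) X i) = \sum_(i <- r | P i) lin_ext F (X i).
Proof. exact: (big_morph _ (lin_extD F) (lin_ext0 F)). Qed.

Lemma lin_ext_mon F S : lin_ext F (mon R S) = F (enum S).
Proof.
rewrite /lin_ext (bigD1 S) //= big1 ?addr0 => [|U US]; rewrite monE.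
  by rewrite eqxx scale1r.
by rewrite (negPf US) scale0r.
Qed.

(** The universal property of the exterior algebra: F prescribes values on enumerated sets only, and
    alternation makes it right on every sequence. Boundary, projection and residue are handled as
    extensions of this kind. *)
Lemma lin_ext_emon F s : alternating_seq F -> lin_ext F (emon R s) = F s.
Proof.
move=> hF; have [us|nus] := boolP (uniq s); last first.
  by rewrite (alternating_not_uniq hF nus) (alternating_not_uniq emon_alternating nus) lin_ext0.
pose S := [set x in s]; have p : perm_eq (enum S) s.
  by apply: uniq_perm => //; [exact: enum_uniq|move=> x; rewrite mem_enum inE].
have [b hb] := perm_sign p; rewrite (hb _ _ (proj1 emon_alternating)) (hb _ _ (proj1 hF)).
rewrite (_ : lin_ext F _ = if b then - lin_ext F (emon R (enum S)) else lin_ext F (emon R (enum S))).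
  by rewrite emon_enum lin_ext_mon.
by case: (b); rewrite ?lin_extN.
Qed.

End LinExt.

Lemma emon_perm s t : perm_eq s t -> exists b : bool, emon R t = (-1) ^+ b *: emon R s.
Proof.
case/perm_sign => b /(_ _ _ (proj1 emon_alternating)) ->; exists b.
by case: b; rewrite ?expr1 ?expr0 ?scaleN1r ?scale1r.
Qed.

Lemma mon_setU1 a S : a \notin S -> exists b : bool, mon R (a |: S) = (-1) ^+ b *: (gen R a * mon R S).
Proof.
move=> aS; rewrite -!emon_enum -emon_cons; apply: emon_perm; apply: uniq_perm.
- by rewrite /= mem_enum aS enum_uniq.
- exact: enum_uniq.
by move=> x; rewrite inE !mem_enum in_setU1.
Qed.

Lemma bdry_seq_nil : bdry_seq R [::] = 0 :> ext R T.
Proof. by rewrite /bdry_seq big_ord0. Qed.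

Lemma bdry_seq_cons a s : bdry_seq R (a :: s) = emon R s - gen R a * bdry_seq R s.
Proof.
rewrite /bdry_seq big_ord_recl expr0 scale1r /= ?take0 ?drop0; congr (_ + _).
rewrite mulr_sumr -sumrN; apply: eq_bigr => i _; rewrite /= /bump /= add1n add0n.
by rewrite emon_cons extZr exprS mulN1r scaleNr.
Qed.

Lemma bdry_seq_cat s t :
  bdry_seq R (s ++ t) = bdry_seq R s * emon R t + (-1) ^+ size s *: (emon R s * bdry_seq R t).
Proof.
elim: s => [|a s IH] /=; first by rewrite bdry_seq_nil mul0r add0r expr0 scale1r emon_nil mul1r.
rewrite !bdry_seq_cons IH emon_cat emon_cons mulrBl -addrA; congr (_ + _).
by rewrite mulrDr opprD -mulrA extZr mulrA exprS mulN1r scaleNr mulrA.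
Qed.

Lemma bdry_seq_alternating : alternating_seq (@bdry_seq R T).
Proof.
have two a b s : bdry_seq R [:: a, b & s] =
    gen R b * emon R s - gen R a * emon R s + gen R a * gen R b * bdry_seq R s.
  by rewrite !bdry_seq_cons emon_cons mulrBr opprB addrA addrAC mulrA.
split=> [s1 a b s2|a s]; last by rewrite two subrr gen_sq mul0r addr0.
have e1 : emon R [:: a, b & s2] = - emon R [:: b, a & s2].
  by have [h _] := emon_alternating; exact: (h [::]).
rewrite !bdry_seq_cat e1 !two (gen_anti R a b).
rewrite mulrN [RHS]opprD; congr (_ + _).
by rewrite -scalerN -[in RHS]mulrN [in RHS]opprD [in RHS]opprB mulNr.
Qed.

Lemma bdryE x : bdry x = lin_ext (@bdry_seq R T) x.
Proof. by []. Qed.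

Lemma bdry_emon s : bdry (emon R s) = bdry_seq R s.
Proof. exact: lin_ext_emon bdry_seq_alternating. Qed.

Lemma bdryD x y : bdry (x + y) = bdry x + bdry y.
Proof. exact: lin_extD. Qed.

Lemma bdryZ (c : R) x : bdry (c *: x) = c *: bdry x.
Proof. exact: lin_extZ. Qed.

Lemma bdry0 : bdry (0 : ext R T) = 0.
Proof. exact: lin_ext0. Qed.

Lemma bdryB x y : bdry (x - y) = bdry x - bdry y.
Proof. exact: lin_extB. Qed.

Lemma bdry_gen a x : bdry (gen R a * x) = x - gen R a * bdry x.
Proof.
elim/emon_ind: x => [|x y IH IH'|c x IH|s].
- by rewrite mulr0 bdry0 mulr0 subr0.
- by rewrite mulrDr !bdryD IH IH' mulrDr opprD addrACA.
- by rewrite extZr !bdryZ IH extZr scalerBr.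
by rewrite -emon_cons !bdry_emon bdry_seq_cons.
Qed.

Lemma bdry1 : bdry (1 : ext R T) = 0.
Proof. by rewrite -emon_nil bdry_emon bdry_seq_nil. Qed.

Lemma bdry_bdry x : bdry (bdry x) = 0.
Proof.
elim/emon_ind: x => [|x y IH IH'|c x IH|s].
- by rewrite !bdry0.
- by rewrite !bdryD IH IH' addr0.
- by rewrite !bdryZ IH scaler0.
elim: s => [|a s IH]; first by rewrite emon_nil bdry1 bdry0.
by rewrite emon_cons bdry_gen bdryB bdry_gen IH mulr0 subr0 subrr.
Qed.

(** The parity involution: the boundary is a derivation twisted by it, and it is the price of moving
    a generator from right to left. *)
Definition sgn_ext x : ext R T := [ffun S : {set T} => (-1) ^+ #|S| * x S].

Lemma sgn_extD x y : sgn_ext (x + y) = sgn_ext x + sgn_ext y.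
Proof. by apply/ffunP => S; rewrite !ffunE mulrDr. Qed.

Lemma sgn_extZ (c : R) x : sgn_ext (c *: x) = c *: sgn_ext x.
Proof. by apply/ffunP => S; rewrite ffunE !ext_scaleE ffunE mulrCA. Qed.

Lemma sgn_ext0 : sgn_ext 0 = 0.
Proof. by have := sgn_extZ 0 0; rewrite !scale0r. Qed.

Lemma sgn_extK x : sgn_ext (sgn_ext x) = x.
Proof. by apply/ffunP => S; rewrite !ffunE mulrA -exprD addnn -signr_odd odd_double mul1r. Qed.

Lemma sgn_ext_homogeneous k x : homogeneous k x -> sgn_ext x = (-1) ^+ k *: x.
Proof.
move=> hx; apply/ffunP => S; rewrite ffunE ext_scaleE.
by have [->|/hx ->] := eqVneq (x S) 0; rewrite ?mulr0.
Qed.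

Lemma homogeneousD k x y : homogeneous k x -> homogeneous k y -> homogeneous k (x + y).
Proof.
move=> hx hy S; rewrite ffunE; have [->|/hx //] := eqVneq (x S) 0.
by rewrite add0r => /hy.
Qed.

Lemma homogeneousZ k (c : R) x : homogeneous k x -> homogeneous k (c *: x).
Proof.
by move=> hx S; rewrite ext_scaleE => h; apply: hx; apply: contraNneq h => ->; rewrite mulr0.
Qed.

Lemma homogeneous0 k : homogeneous k (0 : ext R T).
Proof. by move=> S; rewrite ffunE eqxx. Qed.

Lemma homogeneousN k x : homogeneous k x -> homogeneous k (- x).
Proof. by move=> hx; rewrite -scaleN1r; apply: homogeneousZ. Qed.

Lemma homogeneous_sum k (I : Type) (r : seq I) (P : pred I) (X : I -> ext R T) :
  (forall i, P i -> homogeneous k (X i)) -> homogeneous k (\sum_(i <- r | P i) X i).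
Proof.
move=> h; elim/big_ind: _ => //; [exact: homogeneous0|exact: homogeneousD].
Qed.

Lemma homogeneous_mon S : homogeneous #|S| (mon R S).
Proof. by move=> U; rewrite monE; case: (U =P S) => [->|_] //; rewrite eqxx. Qed.

Lemma homogeneous_emon s : homogeneous (size s) (emon R s).
Proof.
have [us|nus] := boolP (uniq s); last first.
  rewrite (alternating_not_uniq emon_alternating nus); exact: homogeneous0.
pose S := [set x in s]; have p : perm_eq (enum S) s.
  by apply: uniq_perm => //; [exact: enum_uniq|move=> x; rewrite mem_enum inE].
have [b ->] := emon_perm p; rewrite -(perm_size p) -cardE emon_enum.
exact/homogeneousZ/homogeneous_mon.
Qed.

Lemma homogeneous_bdry_seq s : homogeneous (size s).-1 (bdry_seq R s).
Proof.
apply: homogeneous_sum => i _; apply: homogeneousZ.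
have -> : (size s).-1 = size (take i s ++ drop i.+1 s).
  by rewrite size_cat size_take size_drop ltn_ord; have := ltn_ord i; lia.
exact: homogeneous_emon.
Qed.

Lemma sgn_ext_emon s : sgn_ext (emon R s) = (-1) ^+ size s *: emon R s.
Proof. exact/sgn_ext_homogeneous/homogeneous_emon. Qed.

Lemma sgn_ext_gen a x : sgn_ext (gen R a * x) = - (gen R a * sgn_ext x).
Proof.
elim/emon_ind: x => [|x y IH IH'|c x IH|s].
- by rewrite mulr0 sgn_ext0 mulr0 oppr0.
- by rewrite mulrDr !sgn_extD IH IH' mulrDr opprD.
- by rewrite extZr !sgn_extZ IH extZr scalerN.
by rewrite -emon_cons !sgn_ext_emon extZr /= exprS mulN1r scaleNr.
Qed.

Lemma mul_gen x a : x * gen R a = gen R a * sgn_ext x.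
Proof.
elim/emon_ind: x => [|x y IH IH'|c x IH|s].
- by rewrite mul0r sgn_ext0 mulr0.
- by rewrite mulrDl sgn_extD IH IH' mulrDr.
- by rewrite extZl sgn_extZ IH extZr.
elim: s => [|b s IH]; first by rewrite emon_nil mul1r -emon_nil sgn_ext_emon expr0 scale1r emon_nil mulr1.
rewrite emon_cons -mulrA IH sgn_ext_gen mulrN !mulrA gen_anti mulNr //.
Qed.

End LinearExtension.

(** * The Orlik-Solomon ideal and its residues *)

Section OrlikSolomonIdeal.
Import GRing.Theory.
Local Open Scope ring_scope.
Local Open Scope quotient_scope.
Variables (R : comPzRingType) (V : finType) (M : sgsystem V).
Implicit Types (x y z : ext R (atom M)) (I : {set atom M}) (b : atom M) (s t : seq (atom M)).

Lemma os_pi_eq x y : \pi_(OS R M) x = \pi_(OS R M) y <-> os_ideal (x - y).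
Proof.
split=> [/eqP|h].
  by rewrite -Quotient.idealrBE => /asboolP.
by apply/eqP; rewrite -Quotient.idealrBE; apply/asboolP.
Qed.

Lemma os_piD x y : \pi_(OS R M) (x + y) = \pi_(OS R M) x + \pi_(OS R M) y.
Proof. exact: (Quotient.pi_add (GRing.ZmodClosed.clone _ (@os_idealb R V M) _)). Qed.

Lemma os_pi_0 : \pi_(OS R M) 0 = 0.
Proof. by apply: (addrI (\pi_(OS R M) 0)); rewrite -os_piD !addr0. Qed.

Lemma os_piB x y : \pi_(OS R M) (x - y) = \pi_(OS R M) x - \pi_(OS R M) y.
Proof. by apply: (addIr (\pi_(OS R M) y)); rewrite -os_piD !subrK. Qed.

Lemma os_piN x : \pi_(OS R M) (- x) = - \pi_(OS R M) x.
Proof. by rewrite -[- x]sub0r os_piB os_pi_0 sub0r. Qed.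

Lemma os_pi0 x : \pi_(OS R M) x = 0 <-> os_ideal x.
Proof. by rewrite -os_pi_0 os_pi_eq subr0. Qed.

Lemma os_repr x : os_ideal (repr (\pi_(OS R M) x) - x).
Proof. by apply/os_pi_eq; rewrite reprK. Qed.

Lemma os_idealN x : os_ideal x -> os_ideal (- x).
Proof. by move=> h; rewrite -sub0r; apply: os_sub => //; exact: os_0. Qed.

Lemma os_idealD x y : os_ideal x -> os_ideal y -> os_ideal (x + y).
Proof. by move=> hx hy; rewrite -[y]opprK; apply: os_sub => //; exact: os_idealN. Qed.

Lemma os_idealMl z x : os_ideal x -> os_ideal (z * x).
Proof. exact: os_mull. Qed.

Lemma os_idealMr z x : os_ideal x -> os_ideal (x * z).
Proof. exact: os_mulr. Qed.

Lemma os_idealZ (c : R) x : os_ideal x -> os_ideal (c *: x).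
Proof. by move=> h; rewrite -[x]mul1r -extZl; apply: os_idealMl. Qed.

Lemma gen_mon_in b I : b \in I -> gen R b * mon R I = 0.
Proof. by move=> bI; rewrite -wedgeM wedge_mon disjoints1 bI. Qed.

(** For b in I the product of its generator with the monomial of I is 0; taking the boundary writes
    the monomial as the generator times the boundary of the monomial. *)
Lemma os_ideal_mon I : atoms_dependent I -> os_ideal (mon R I).
Proof.
move=> dI; have [b bI] : exists b, b \in I.
  by apply/card_gt0P; apply: leq_ltn_trans dI.
have := bdry_gen b (mon R I); rewrite gen_mon_in // bdry0 => /eqP.
rewrite eq_sym subr_eq0 => /eqP ->; exact/os_idealMl/os_gen.
Qed.

Lemma emon_set s : uniq s -> exists b : bool, emon R s = (-1) ^+ b *: mon R [set x in s].
Proof.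
move=> us; have p : perm_eq (enum [set x in s]) s.
  by apply: uniq_perm => //; [exact: enum_uniq|move=> x; rewrite mem_enum inE].
by have [b ->] := emon_perm R p; exists b; rewrite emon_enum.
Qed.

Lemma os_ideal_emon s : (uniq s -> atoms_dependent [set x in s]) -> os_ideal (emon R s).
Proof.
move=> h; have [us|nus] := boolP (uniq s); last first.
  rewrite (alternating_not_uniq (emon_alternating _ _) nus); exact: os_0.
by have [b ->] := emon_set us; apply/os_idealZ/os_ideal_mon/h.
Qed.

Lemma os_ideal_bdry_emon s : (uniq s -> atoms_dependent [set x in s]) ->
  os_ideal (bdry (emon R s)).
Proof.
move=> h; have [us|nus] := boolP (uniq s); last first.
  rewrite (alternating_not_uniq (emon_alternating _ _) nus) bdry0; exact: os_0.
by have [b ->] := emon_set us; rewrite bdryZ; apply/os_idealZ/os_gen/h.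
Qed.

Lemma sgn_extM z x : sgn_ext (z * x) = sgn_ext z * sgn_ext x.
Proof.
elim/emon_ind: z => [|z z' IH IH'|c z IH|s].
- by rewrite mul0r sgn_ext0 mul0r.
- by rewrite mulrDl !sgn_extD IH IH' mulrDl.
- by rewrite extZl !sgn_extZ IH extZl.
elim: s => [|b s IH].
  by rewrite emon_nil mul1r -emon_nil sgn_ext_emon expr0 scale1r emon_nil mul1r.
by rewrite emon_cons -mulrA !sgn_ext_gen IH mulrA mulNr.
Qed.

Lemma bdryM z x : bdry (z * x) = bdry z * x + sgn_ext z * bdry x.
Proof.
elim/emon_ind: z => [|z z' IH IH'|c z IH|s].
- by rewrite mul0r bdry0 sgn_ext0 !mul0r addr0.
- by rewrite mulrDl !bdryD sgn_extD !mulrDl IH IH' addrACA.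
- by rewrite extZl !bdryZ sgn_extZ !extZl IH scalerDr.
elim: s => [|b s IH].
  by rewrite emon_nil mul1r bdry1 mul0r add0r -emon_nil sgn_ext_emon expr0 scale1r emon_nil mul1r.
rewrite emon_cons -mulrA !bdry_gen sgn_ext_gen IH mulrBl mulrDr opprD addrA.
by rewrite !mulrA mulNr.
Qed.

Lemma homogeneous_bdry_mon I : homogeneous #|I|.-1 (bdry (mon R I)).
Proof. rewrite -emon_enum bdry_emon cardE; exact: homogeneous_bdry_seq. Qed.

(** The generators are homogeneous, so the involution only changes them by a sign. Needed for the
    boundary of a product with an ideal element on the left. *)
Lemma os_ideal_sgn x : os_ideal x -> os_ideal (sgn_ext x).
Proof.
elim=> {x} [I dI||x y _ IHx _ IHy|z x _ IH|z x _ IH].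
- by rewrite (sgn_ext_homogeneous (@homogeneous_bdry_mon I)); apply/os_idealZ/os_gen.
- by rewrite sgn_ext0; exact: os_0.
- by rewrite sgn_extD -scaleN1r sgn_extZ scaleN1r; apply: os_sub.
- by rewrite [wedge z x]wedgeM sgn_extM; apply: os_idealMl.
- by rewrite [wedge x z]wedgeM sgn_extM; apply: os_idealMr.
Qed.

Lemma os_ideal_bdry x : os_ideal x -> os_ideal (bdry x).
Proof.
elim=> {x} [I dI||x y _ IHx _ IHy|z x hx IH|z x hx IH].
- by rewrite bdry_bdry; exact: os_0.
- by rewrite bdry0; exact: os_0.
- by rewrite bdryB; apply: os_sub.
- by rewrite [wedge z x]wedgeM bdryM; apply: os_idealD; exact: os_idealMl.
- rewrite [wedge x z]wedgeM bdryM; apply: os_idealD; apply: os_idealMr => //.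
  exact: os_ideal_sgn.
Qed.

Lemma os_bdry_pi x : os_bdry (\pi_(OS R M) x) = \pi_(OS R M) (bdry x).
Proof. by apply/os_pi_eq; rewrite -bdryB; apply/os_ideal_bdry/os_repr. Qed.

(** Every dependent set has at least two atoms, so the generators have no term of degree 0 and
    products create none. It starts the induction on the degree. *)
Lemma os_ideal_unit x :
  (forall I, atoms_dependent I -> 1 < #|I|)%N -> os_ideal x -> x set0 = 0.
Proof.
move=> h1; elim=> {x} [I dI||x y _ IHx _ IHy|z x _ IH|z x _ IH].
- apply: contraTeq (h1 _ dI) => /homogeneous_bdry_mon; rewrite cards0.
  by case: #|I| => [|[|n]].
- by rewrite ffunE.
- by rewrite !ffunE IHx IHy subr0.
- rewrite wedgeE big1 // => S; rewrite subset0 => /eqP ->.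
  by rewrite setDv IH !mulr0.
- rewrite wedgeE big1 // => S; rewrite subset0 => /eqP ->.
  by rewrite IH mul0r mulr0.
Qed.

End OrlikSolomonIdeal.

Arguments contract_atoms : simpl never.

Section ContractedAtoms.
Variables (V : finType) (M : sgsystem V).
Hypotheses (omM : oriented_matroid M) (ll : loopless M).
Variable a : atom M.
Implicit Types (b : atom M) (s t : seq (atom M)).
Let Ma := contract M (val a).
Let ha : is_atom M (val a) := valP a.

Lemma atom_disj b : b != a -> [disjoint val b & val a].
Proof.
move=> ba; apply/pred0P => x /=; apply/negP => /andP[xb xa].
by case/eqP: ba; apply: val_inj; exact: atoms_eq (valP b) ha xb xa.
Qed.

Lemma atom_sub_contract b : b != a -> val b \subset ground Ma.
Proof.
move=> ba; apply/subsetP => x xb; rewrite inE (mem_atom_ground (valP b) xb) andbT.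
by rewrite (disjointFr (atom_disj ba) xb).
Qed.

Lemma closure_line b x : b != a -> x \in val b -> closure Ma (val b) = closure Ma [set x].
Proof.
move=> ba xb; have gx := subsetP (atom_sub_contract ba) x xb.
have [i ia] := atom_neq0 omM ha.
rewrite !(contract_closure omM ll ha ia) ?sub1set ?(atom_sub_contract ba) //; congr (_ :\: _).
apply/eqP; rewrite eqEsubset; apply/andP; split; last first.
  by apply: closureS => //; rewrite setUS // sub1set.
rewrite -(closure_idem omM (i |: [set x])); apply: closureS => //.
rewrite subUset -(atom_closure omM ll (valP b) xb) closureS ?subsetUr // andbT.
apply: subset_trans (sub_closure _) ; first exact: subsetUl.
by rewrite subUset !sub1set (mem_atom_ground ha ia) (mem_atom_ground (valP b) xb).
Qed.

Lemma line_atom b : b != a -> is_atom Ma (closure Ma (val b)).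
Proof.
move=> ba; have omMa := contract_om omM ll ha; have llMa := contract_loopless omM ll ha.
have [x xb] := atom_neq0 omM (valP b); have gx := subsetP (atom_sub_contract ba) x xb.
by rewrite (closure_line ba xb); exact: closure1_atom.
Qed.

(** The atoms of M/a are the rank-two flats through a with a taken out: b is sent to the flat that
    it spans with a, and a itself to nothing. *)
Definition line b : option (atom Ma) := insub (closure Ma (val b)).

Lemma line_some b : b != a -> exists2 c, line b = Some c & val c = closure Ma (val b).
Proof. by move/line_atom => h; rewrite /line insubT; exists (Sub _ h). Qed.

Lemma line_none : line a = None.
Proof.
apply: insubN; apply/negP => /andP[_ /eqP]; have omMa := contract_om omM ll ha.
rewrite rk_closure // -(rk_ground omMa) /= setIDA setDIl setDv set0I.
by rewrite rk_indep ?cards0 // indep0.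
Qed.

Lemma mem_line b c x : b != a -> line b = Some c -> x \in val b -> x \in val c.
Proof.
move=> ba; have [c' -> vc'] := line_some ba => -[<-] xb; rewrite vc'.
by apply: (subsetP (sub_closure _)) => //; exact: atom_sub_contract.
Qed.

Lemma contract_atoms_cons b s :
  contract_atoms a (b :: s) = if line b is Some c then c :: contract_atoms a s else contract_atoms a s.
Proof. by rewrite /contract_atoms /= -/(line b); case: (line b). Qed.

Lemma size_contract_atoms s : a \notin s -> size (contract_atoms a s) = size s.
Proof.
elim: s => //= b s IH; rewrite inE negb_or eq_sym => /andP[ba /IH {}IH].
by rewrite contract_atoms_cons; have [c -> _] := line_some ba; rewrite /= IH.
Qed.

Lemma mem_contract_atoms s c : (c \in contract_atoms a s) = has (fun b => line b == Some c) s.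
Proof.
elim: s => //= b s IH; rewrite contract_atoms_cons; case e: (line b) => [d|] //=.
by rewrite inE IH -(inj_eq Some_inj) eq_sym.
Qed.

(** The atoms of s, minus a, span the same flat of M/a as the lines through them, and restoring a
    adds one to the rank. Dependence is moved between M and M/a by this equality. *)
Lemma rk_lines s : a \notin s ->
  (rk Ma (\bigcup_(c in [set x in contract_atoms a s]) val c)).+1 =
  rk M (\bigcup_(b in [set x in a :: s]) val b).
Proof.
move=> as_; have omMa := contract_om omM ll ha.
have [i ia] := atom_neq0 omM ha.
have nes b : b \in s -> b != a by move=> bs; apply: contraNneq as_ => <-.
pose U := \bigcup_(b in [set x in s]) val b.
have gU : U \subset ground M :\: val a.
  by apply/bigcupsP => b; rewrite inE => /nes; exact: atom_sub_contract.
have -> : \bigcup_(b in [set x in a :: s]) val b = val a :|: U.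
  by rewrite set_cons bigcup_setU big_set1.
have -> : rk M (val a :|: U) = rk M (i |: U).
  by rewrite -{1}(atom_closure omM ll ha ia) rkU_closure.
rewrite -(contract_rk omM ll ha ia gU); congr _.+1.
set W := \bigcup_(c in _) _.
have sUW : U \subset W.
  apply/bigcupsP => b; rewrite inE => bs; have [c ec vc] := line_some (nes b bs).
  apply: subset_trans (_ : val c \subset _); last first.
    apply: bigcup_sup; rewrite inE mem_contract_atoms; apply/hasP; exists b => //.
    by rewrite ec.
  by rewrite vc; apply: sub_closure; exact/atom_sub_contract/nes.
apply/eqP; rewrite eqn_leq (rkS omMa sUW) andbT -(rk_closure omMa U) rkS //.
apply/bigcupsP => c; rewrite inE mem_contract_atoms => /hasP[b bs /eqP ec].
have [c' ec' vc'] := line_some (nes b bs); move: ec; rewrite ec' => -[<-].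
rewrite vc'; apply: closureS => //; apply: bigcup_sup; by rewrite inE.
Qed.

End ContractedAtoms.

(** * The residue map on the exterior algebra and on the ideal *)

Section Residue.
Import GRing.Theory.
Local Open Scope ring_scope.
Local Open Scope quotient_scope.
Variables (R : comPzRingType) (V : finType) (M : sgsystem V).
Hypotheses (omM : oriented_matroid M) (ll : loopless M).
Variable a : atom M.
Implicit Types (x y z : ext R (atom M)) (I : {set atom M}) (b : atom M) (s t : seq (atom M)).
Let Ma := contract M (val a).

(** The atom a contributes 0 here, whereas [contract_atoms] drops it. Only the former gives an
    alternating function of sequences; the two agree on sequences without a. *)
Definition line_gen b : ext R (atom Ma) := if line a b is Some c then gen R c else 0.

Definition lines s : ext R (atom Ma) := foldr (fun b u => line_gen b * u) 1 s.

Lemma lines_cons b s : lines (b :: s) = line_gen b * lines s.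
Proof. by []. Qed.
Arguments lines : simpl never.

Lemma line_gen_sq b : line_gen b * line_gen b = 0.
Proof. by rewrite /line_gen; case: line => [c|]; rewrite ?gen_sq ?mul0r. Qed.

Lemma line_gen_anti b c : line_gen b * line_gen c = - (line_gen c * line_gen b).
Proof.
rewrite /line_gen; case: line => [b'|]; case: line => [c'|];
  by rewrite ?mul0r ?mulr0 ?oppr0 // gen_anti.
Qed.

Lemma line_gen_a : line_gen a = 0.
Proof. by rewrite /line_gen line_none. Qed.

Lemma lines_alternating : alternating_seq lines.
Proof.
split=> [s1 b c s2|b s]; last by rewrite !lines_cons mulrA line_gen_sq mul0r.
elim: s1 => [|d s1 IH]; last by rewrite !cat_cons !lines_cons IH mulrN.
by rewrite !cat0s !lines_cons !mulrA line_gen_anti mulNr.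
Qed.

Lemma lines_emon s : a \notin s -> lines s = emon R (contract_atoms a s).
Proof.
elim: s => // b s IH; rewrite inE negb_or eq_sym => /andP[ba /IH {}IH].
rewrite contract_atoms_cons lines_cons IH /line_gen.
by have [c -> _] := line_some omM ll ba; rewrite emon_cons.
Qed.

Definition project x := lin_ext lines x.

Lemma project_emon s : project (emon R s) = lines s.
Proof. exact: lin_ext_emon lines_alternating. Qed.

Lemma project0 : project 0 = 0.
Proof. exact: lin_ext0. Qed.

Lemma projectD x y : project (x + y) = project x + project y.
Proof. exact: lin_extD. Qed.

Lemma projectB x y : project (x - y) = project x - project y.
Proof. exact: lin_extB. Qed.

Lemma projectZ c x : project (c *: x) = c *: project x.
Proof. exact: lin_extZ. Qed.

Lemma project_gen b x : project (gen R b * x) = line_gen b * project x.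
Proof.
elim/emon_ind: x => [|x y IH IH'|c x IH|s].
- by rewrite mulr0 project0 mulr0.
- by rewrite mulrDr !projectD IH IH' mulrDr.
- by rewrite extZr !projectZ IH extZr.
by rewrite -emon_cons !project_emon lines_cons.
Qed.

(** The residue on arbitrary sequences: the sign carries the first a past the entries behind it, and
    a second a contributes 0 through [lines]. *)
Fixpoint res_seq s : ext R (atom Ma) :=
  if s is b :: s' then if b == a then (-1) ^+ size s' *: lines s' else line_gen b * res_seq s'
  else 0.

Lemma res_seq_cons b s : res_seq (b :: s) =
  if b == a then (-1) ^+ size s *: lines s else line_gen b * res_seq s.
Proof. by []. Qed.
Arguments res_seq : simpl never.

Lemma res_seq_alternating : alternating_seq res_seq.
Proof.
split=> [s1 b c s2|b s]; last first.
  rewrite !res_seq_cons; case: eqP => [->|_]; last by rewrite mulrA line_gen_sq mul0r.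
  by rewrite lines_cons line_gen_a mul0r scaler0.
elim: s1 => [|d s1 IH]; last first.
  rewrite !cat_cons !res_seq_cons; case: eqP => _; last by rewrite IH mulrN.
  by rewrite (proj1 lines_alternating) !size_cat /= scalerN.
rewrite !cat0s !res_seq_cons /=.
case: (eqVneq b a) => [eb|ba]; case: (eqVneq c a) => [ec|ca] /=.
- by rewrite eb ec lines_cons line_gen_a mul0r scaler0 oppr0.
- by rewrite lines_cons extZr exprS mulN1r scaleNr.
- by rewrite lines_cons extZr exprS mulN1r scaleNr opprK.
- by rewrite !mulrA line_gen_anti mulNr.
Qed.

Lemma res_seq_notin s : a \notin s -> res_seq s = 0.
Proof.
elim: s => // b s IH; rewrite inE negb_or eq_sym => /andP[ba /IH {}IH].
by rewrite res_seq_cons (negPf ba) IH mulr0.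
Qed.

Lemma res_seq_mid s1 s2 : a \notin s1 -> res_seq (s1 ++ a :: s2) = (-1) ^+ size s2 *: lines (s1 ++ s2).
Proof.
elim: s1 => [_|b s1 IH]; first by rewrite cat0s res_seq_cons eqxx.
rewrite inE negb_or eq_sym => /andP[ba /IH {}IH].
by rewrite !cat_cons res_seq_cons (negPf ba) IH extZr lines_cons.
Qed.

Lemma enum_setD1 S : enum (S :\ a) = filter (predC1 a) (enum S).
Proof.
rewrite /enum_mem -filter_predI; apply: eq_filter => b /=.
by rewrite !inE.
Qed.

(** In an increasing enumeration the elements of larger rank than a are those behind it, so both
    signs count the same entries. *)
Lemma ext_resE x : ext_res a x = lin_ext res_seq x.
Proof.
rewrite /ext_res /lin_ext [RHS](bigID (fun S : {set atom M} => a \in S)) /= addrC.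
rewrite [X in _ = X + _]big1 ?add0r => [|S aS]; last by rewrite res_seq_notin ?scaler0 // mem_enum.
apply: eq_bigr => S aS; rewrite -scalerA; congr (_ *: _).
have us := enum_uniq S; have ss := enum_rank_sorted S.
have aS' : a \in enum S by rewrite mem_enum.
have [s1 [s2 eS]] : exists s1 s2, enum S = s1 ++ a :: s2.
  by case/splitPr: aS' => s1 s2; exists s1, s2.
have mS b : (b \in S) = (b \in s1 ++ a :: s2) by rewrite -eS mem_enum.
move: us ss; rewrite eS cat_uniq /= negb_or => /and4P[_ /andP[as1 _] as2 us2] ss.
rewrite res_seq_mid // enum_setD1 eS filter_cat /= eqxx /=.
have f s : a \notin s -> [seq b <- s | b != a] = s.
  by move=> as_; apply/all_filterP/allP => b bs; apply: contraNneq as_ => <-.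
rewrite !f // -lines_emon ?mem_cat ?negb_or ?as1 //; congr (_ ^+ _ *: _).
have tr : transitive (fun b c : atom M => enum_rank b < enum_rank c)%N.
  by move=> b c d; apply: ltn_trans.
move: ss; rewrite (sorted_pairwise tr) pairwise_cat pairwise_cons => /and3P[al _ /andP[al2 pw2]].
rewrite -(card_uniqP us2); apply: eq_card => b; rewrite inE mS mem_cat inE.
apply/andP/idP => [[/or3P[bs1|/eqP ->|//]]|bs2].
- move/allrelP: al => /(_ b a bs1); rewrite mem_head => /(_ isT) h1 h2.
  by have := ltn_trans h1 h2; rewrite ltnn.
- by rewrite ltnn.
- by rewrite bs2 !orbT; split=> //; exact: (allP al2).
Qed.

Lemma ext_resD x y : ext_res a (x + y) = ext_res a x + ext_res a y.
Proof. by rewrite !ext_resE lin_extD. Qed.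

Lemma ext_resB x y : ext_res a (x - y) = ext_res a x - ext_res a y.
Proof. by rewrite !ext_resE lin_extB. Qed.

Lemma ext_resZ c x : ext_res a (c *: x) = c *: ext_res a x.
Proof. by rewrite !ext_resE lin_extZ. Qed.

Lemma ext_res_emon s : ext_res a (emon R s) = res_seq s.
Proof. by rewrite ext_resE; apply: lin_ext_emon res_seq_alternating. Qed.

(** The leading factor a has to travel to the last position, past all of x. *)
Lemma ext_res_gen_a x : ext_res a (gen R a * x) = project (sgn_ext x).
Proof.
elim/emon_ind: x => [|x y IH IH'|c x IH|s].
- by rewrite mulr0 sgn_ext0 ext_resE project0 lin_ext0.
- by rewrite mulrDr ext_resD sgn_extD projectD IH IH'.
- by rewrite extZr ext_resZ sgn_extZ projectZ IH.
by rewrite -emon_cons ext_res_emon res_seq_cons eqxx sgn_ext_emon projectZ project_emon.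
Qed.

Lemma ext_res_gen b x : b != a -> ext_res a (gen R b * x) = line_gen b * ext_res a x.
Proof.
move=> ba; elim/emon_ind: x => [|x y IH IH'|c x IH|s].
- by rewrite mulr0 ext_resE lin_ext0 mulr0.
- by rewrite mulrDr !ext_resD IH IH' mulrDr.
- by rewrite extZr !ext_resZ IH extZr.
by rewrite -emon_cons !ext_res_emon res_seq_cons (negPf ba).
Qed.

Lemma project_bdry_seq s : a \notin s ->
  project (bdry_seq R s) = bdry (emon R (contract_atoms a s)).
Proof.
elim: s => [|b s IH]; first by rewrite !bdry_seq_nil project0 emon_nil bdry1.
rewrite inE negb_or eq_sym => /andP[ba as_].
rewrite bdry_seq_cons projectB project_gen IH // project_emon lines_emon //.
rewrite contract_atoms_cons /line_gen; have [c -> _] := line_some omM ll ba.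
by rewrite emon_cons bdry_gen.
Qed.

Lemma ext_res_bdry_seq_notin s : a \notin s -> ext_res a (bdry_seq R s) = 0.
Proof.
elim: s => [|b s IH]; first by rewrite bdry_seq_nil ext_resE lin_ext0.
rewrite inE negb_or eq_sym => /andP[ba as_].
rewrite bdry_seq_cons ext_resB ext_res_gen // IH // mulr0 subr0 ext_res_emon.
exact: res_seq_notin.
Qed.

(** In the boundary of the product only the terms that keep a survive; these are minus a times the
    boundary of s, of degree one less than s, which accounts for the sign. *)
Lemma ext_res_bdry_cons s : a \notin s ->
  ext_res a (bdry_seq R (a :: s)) = (-1) ^+ size s *: bdry (emon R (contract_atoms a s)).
Proof.
move=> as_; rewrite bdry_seq_cons ext_resB ext_res_emon res_seq_notin // sub0r ext_res_gen_a.
rewrite (sgn_ext_homogeneous (@homogeneous_bdry_seq R _ s)) projectZ project_bdry_seq //.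
case: s as_ => [|b s] as_; first by rewrite emon_nil bdry1 !scaler0 oppr0.
by rewrite /= exprS mulN1r scaleNr.
Qed.

Lemma lines_dependent s : a \notin s ->
  (rk M (\bigcup_(b in [set x in a :: s]) val b) <= size s)%N ->
  uniq (contract_atoms a s) -> atoms_dependent [set x in contract_atoms a s].
Proof.
move=> as_; rewrite -rk_lines // => h us; rewrite /atoms_dependent.
have -> : #|[set x in contract_atoms a s]| = size s; last exact: h.
by rewrite -(size_contract_atoms omM ll as_) -(card_uniqP us); apply: eq_card => x; rewrite inE.
Qed.

(* The residue is a derivation twisted by [project] and [sgn_ext]: only the four
   memberships together are stable under multiplication. *)
Let good x := [/\ os_ideal (project x), os_ideal (project (sgn_ext x)),
  os_ideal (ext_res a x) & os_ideal (ext_res a (sgn_ext x))].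

Let good0 : good 0.
Proof. by rewrite /good sgn_ext0 ext_resE project0 lin_ext0; split; exact: os_0. Qed.

Let goodZ c x : good x -> good (c *: x).
Proof.
by case=> h1 h2 h3 h4; rewrite /good sgn_extZ !projectZ !ext_resZ; split; exact: os_idealZ.
Qed.

Let goodD x y : good x -> good y -> good (x + y).
Proof.
case=> h1 h2 h3 h4 [g1 g2 g3 g4].
by rewrite /good sgn_extD !ext_resD !projectD; split; exact: os_idealD.
Qed.

Let good_sgn x : good x -> good (sgn_ext x).
Proof. by case=> h1 h2 h3 h4; rewrite /good sgn_extK; split. Qed.

Let good_gen b x : good x -> good (gen R b * x).
Proof.
case=> h1 h2 h3 h4; rewrite /good sgn_ext_gen -scaleN1r !projectZ !ext_resZ !project_gen.
have [->|ba] := eqVneq b a.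
  rewrite line_gen_a !mul0r !ext_res_gen_a sgn_extK scaler0.
  by split=> //; rewrite ?scaler0; try exact: os_0; exact: os_idealZ.
by rewrite !ext_res_gen //; split; rewrite -?extZl ?extZl; try apply: os_idealZ; exact: os_idealMl.
Qed.

Let goodMl z x : good x -> good (z * x).
Proof.
move=> hx; elim/emon_ind: z => [|z z' IH IH'|c z IH|s].
- by rewrite mul0r.
- by rewrite mulrDl; exact: goodD.
- by rewrite extZl; exact: goodZ.
elim: s => [|b s IH]; first by rewrite emon_nil mul1r.
by rewrite emon_cons -mulrA; exact: good_gen.
Qed.

Let goodMr z x : good x -> good (x * z).
Proof.
move=> hx; elim/emon_ind: z => [|z z' IH IH'|c z IH|s].
- by rewrite mulr0.
- by rewrite mulrDr; exact: goodD.
- by rewrite extZr; exact: goodZ.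
elim: s x hx => [|b s IH] x hx; first by rewrite emon_nil mulr1.
rewrite emon_cons mulrA; apply: IH; rewrite mul_gen; exact/good_gen/good_sgn.
Qed.

Let good_bdry I : atoms_dependent I -> good (bdry (mon R I)).
Proof.
move=> dI; suff [h1 h2] : os_ideal (project (bdry (mon R I))) /\
    os_ideal (ext_res a (bdry (mon R I))).
  rewrite /good (sgn_ext_homogeneous (@homogeneous_bdry_mon R V M I)) projectZ ext_resZ.
  by split=> //; exact: os_idealZ.
have cE (J : {set atom M}) : [set x in enum J] = J by apply/setP => x; rewrite inE mem_enum.
(* Without a in I the residue is 0 and the projection is a boundary of lines, dependent because
   adding a raises the rank by at most one. With a in I the residue is such a boundary and the
   projection the monomial itself. *)
have [aI|aI] := boolP (a \in I); last first.
  have aE : a \notin enum I by rewrite mem_enum.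
  rewrite -emon_enum bdry_emon ext_res_bdry_seq_notin // project_bdry_seq //.
  split; last exact: os_0; apply: os_ideal_bdry_emon; apply: lines_dependent => //.
  have [i ia] := atom_neq0 omM (valP a).
  rewrite set_cons cE bigcup_setU big_set1 -(atom_closure omM ll (valP a) ia) rkU_closure //.
  by apply: leq_trans (rkU1 omM _ _) _; rewrite -cardE.
have aJ : a \notin I :\ a by rewrite !inE eqxx.
have aE : a \notin enum (I :\ a) by rewrite mem_enum.
have [e ->] : exists e : bool, mon R I = (-1) ^+ e *: (gen R a * mon R (I :\ a)).
  by rewrite -{1}(setD1K aI); exact: mon_setU1.
have dep : uniq (contract_atoms a (enum (I :\ a))) ->
    atoms_dependent [set x in contract_atoms a (enum (I :\ a))].
  apply: lines_dependent => //; rewrite set_cons cE setD1K // -cardE.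
  by move: dI; rewrite /atoms_dependent (cardsD1 a I) aI.
rewrite -emon_enum -emon_cons bdryZ bdry_emon projectZ ext_resZ; split; apply: os_idealZ.
  rewrite bdry_seq_cons projectB project_gen line_gen_a mul0r subr0 project_emon lines_emon //.
  exact: os_ideal_emon.
by rewrite ext_res_bdry_cons //; apply/os_idealZ/os_ideal_bdry_emon.
Qed.

Lemma os_ideal_res x : os_ideal x -> os_ideal (ext_res a x).
Proof.
move=> h; suff [] : good x by [].
elim: {x} h => [I dI||x y _ IHx _ IHy|z x _ IH|z x _ IH].
- exact: good_bdry.
- exact: good0.
- by rewrite -scaleN1r; apply: goodD => //; exact: goodZ.
- exact: goodMl.
- exact: goodMr.
Qed.

Lemma os_res_pi x : os_res a (\pi_(OS R M) x) = \pi_(OS R Ma) (ext_res a x).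
Proof. by apply/os_pi_eq; rewrite -ext_resB; apply/os_ideal_res/os_repr. Qed.

End Residue.

(** * Elements without residues *)

Section NoBrokenCircuit.
Import GRing.Theory.
Local Open Scope ring_scope.
Local Open Scope quotient_scope.
Variables (R : comPzRingType) (V : finType).
Implicit Types (M : sgsystem V).

(* No broken circuit: S contains no circuit deprived of its l-smallest element. *)
Definition nbc M (l : atom M -> nat) (S : {set atom M}) : bool :=
  [forall t, ~~ atoms_dependent (t |: [set s in S | (l t < l s)%N])].

Definition nbc_supported M (l : atom M -> nat) (y : ext R (atom M)) : Prop :=
  forall S, y S != 0 -> nbc l S.

Section Spanning.
Variables (M : sgsystem V) (l : atom M -> nat).
Implicit Types (x y : ext R (atom M)) (s : seq (atom M)).

Let spans k x := exists y, [/\ homogeneous k y, nbc_supported l y & os_ideal (x - y)].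

Let spans0 k : spans k 0.
Proof.
exists 0; split; [exact: homogeneous0|by move=> S; rewrite ffunE eqxx|].
rewrite subr0; exact: os_0.
Qed.

Let spansD k x x' : spans k x -> spans k x' -> spans k (x + x').
Proof.
case=> y [h1 h2 h3] [y' [g1 g2 g3]]; exists (y + y'); split; first exact: homogeneousD.
  move=> S; rewrite ffunE; have [->|/h2 //] := eqVneq (y S) 0.
  by rewrite add0r => /g2.
by rewrite opprD addrACA; exact: os_idealD.
Qed.

Let spansZ k c x : spans k x -> spans k (c *: x).
Proof.
case=> y [h1 h2 h3]; exists (c *: y); split; first exact: homogeneousZ.
  by move=> S; rewrite ext_scaleE => h; apply: h2; apply: contraNneq h => ->; rewrite mulr0.
by rewrite -scalerBr; exact: os_idealZ.
Qed.

Let spans_mod k x x' : os_ideal (x - x') -> spans k x' -> spans k x.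
Proof.
move=> hx [y [h1 h2 h3]]; exists y; split=> //.
by rewrite -(subrK x' x) -addrA; exact: os_idealD.
Qed.

(* If t together with the elements of s above t is dependent, its boundary rewrites e_s
   in terms of monomials in which one of these elements is replaced by the smaller t. *)
Lemma nbc_spans_emon s : spans (size s) (emon R s).
Proof.
have [n] := ubnP (\sum_(b <- s) l b)%N; elim: n s => // n IHn s ltn.
have [us|nus] := boolP (uniq s); last first.
  by rewrite (alternating_not_uniq (emon_alternating _ _) nus); exact: spans0.
have [b eb] := emon_set R us.
have [nb|] := boolP (nbc l [set x in s]).
  rewrite eb; apply: spansZ; exists (mon R [set x in s]); split.
  - have -> : size s = #|[set x in s]| by rewrite -(card_uniqP us); apply: eq_card => x; rewrite inE.
    exact: homogeneous_mon.
  - by move=> S; rewrite monE; case: (S =P _) => [->//|_]; rewrite eqxx.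
  - rewrite subrr; exact: os_0.
rewrite negb_forall => /existsP[t]; rewrite negbK => dep.
pose U := [seq b <- s | (l t < l b)%N]; pose L := [seq b <- s | ~~ (l t < l b)%N].
have pLU : perm_eq (L ++ U) s by rewrite perm_catC perm_filterC.
have [e ->] := emon_perm R pLU; apply: spansZ; rewrite emon_cat.
have dU : os_ideal (emon R U - gen R t * bdry_seq R U).
  have := @os_ideal_bdry_emon R V M (t :: U); rewrite bdry_emon bdry_seq_cons; apply=> _.
  suff -> : [set x in t :: U] = t |: [set x in [set x in s] | (l t < l x)%N] by [].
  by apply/setP => x; rewrite !inE mem_filter andbC.
apply: (spans_mod (x' := emon R L * (gen R t * bdry_seq R U))).
  by rewrite -mulrBr; exact: os_idealMl.
rewrite /bdry_seq !mulr_sumr; elim/big_ind: _ => //; first exact: spansD.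
move=> i _; rewrite !extZr; apply: spansZ; rewrite -emon_cons -emon_cat.
have iU := ltn_ord i; set u := nth t U i.
have eU : U = take i U ++ u :: drop i.+1 U by rewrite -drop_nth // cat_take_drop.
have -> : size s = size (L ++ t :: (take i U ++ drop i.+1 U)).
  by rewrite -(perm_size pLU) {1}eU !size_cat /= size_cat !addnS.
apply: IHn; rewrite ltnS in ltn; apply: leq_trans ltn.
have sU : (\sum_(b <- U) l b = \sum_(b <- take i U) l b + (l u + \sum_(b <- drop i.+1 U) l b))%N.
  by rewrite {1}eU big_cat big_cons.
rewrite -(perm_big _ pLU) /= !big_cat /= !big_cons big_cat /= sU.
rewrite ltn_add2l addnCA ltn_add2l ltn_add2r.
have : u \in U by rewrite mem_nth.
by rewrite mem_filter => /andP[].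
Qed.

Lemma nbc_spans k x : homogeneous k x ->
  exists y, [/\ homogeneous k y, nbc_supported l y & os_ideal (x - y)].
Proof.
move=> hx; rewrite (ext_sum x); suff : spans k (\sum_S x S *: mon R S) by [].
elim/big_ind: _ => // [|S _]; first exact: spansD.
have [->|/hx <-] := eqVneq (x S) 0; first by rewrite scale0r.
by apply: spansZ; rewrite -emon_enum cardE; exact: nbc_spans_emon.
Qed.

End Spanning.

Section AtomRank.
Variable M : sgsystem V.
Hypotheses (omM : oriented_matroid M) (ll : loopless M).
Implicit Types I J : {set atom M}.

Lemma rk_bigcup_atomU1 (b : atom M) J :
  (rk M (\bigcup_(c in b |: J) val c) <= (rk M (\bigcup_(c in J) val c)).+1)%N.
Proof.
have [i ib] := atom_neq0 omM (valP b).
rewrite bigcup_setU big_set1 -(atom_closure omM ll (valP b) ib) rkU_closure //.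
exact: rkU1.
Qed.

Lemma atoms_dependentS I J : I \subset J -> atoms_dependent I -> atoms_dependent J.
Proof.
have [n] := ubnP #|J :\: I|; elim: n J => // n IHn J ltn sIJ dI.
have [/eqP|[b /setDP[bJ bI]]] := set_0Vmem (J :\: I).
  by rewrite setD_eq0 => sJI; have -> : J = I by apply/eqP; rewrite eqEsubset sJI.
have : atoms_dependent (J :\ b).
  apply: IHn dI; last by rewrite subsetD1 sIJ.
  rewrite ltnS in ltn; apply: leq_trans ltn; apply/proper_card/properP; split.
    by rewrite setSD // subD1set.
  by exists b; rewrite !inE ?bJ ?bI ?eqxx.
rewrite /atoms_dependent => h; rewrite -(setD1K bJ) cardsU1 !inE eqxx /=.
by apply: leq_ltn_trans (rk_bigcup_atomU1 _ _) _.
Qed.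

Lemma atoms_dependent_gt1 I : atoms_dependent I -> (1 < #|I|)%N.
Proof.
rewrite /atoms_dependent; case eI: #|I| => [|[|n]] //.
have /cards1P[b ->] : #|I| == 1%N by rewrite eI.
by rewrite big_set1 (atom_rk (valP b)).
Qed.

End AtomRank.

Section Contraction.
Variables (M : sgsystem V) (l : atom M -> nat) (a : atom M).
Hypotheses (omM : oriented_matroid M) (ll : loopless M) (linj : injective l).
Let Ma := contract M (val a).
Implicit Types (c d : atom Ma) (b s t : atom M).

Lemma line_surj c : exists b, line a b == Some c.
Proof.
have omMa := contract_om omM ll (valP a); have llMa := contract_loopless omM ll (valP a).
have [x xc] := atom_neq0 omMa (valP c).
have := mem_atom_ground (valP c) xc; rewrite inE => /andP[xa gx].
have hb := closure1_atom omM ll gx; pose b : atom M := Sub _ hb.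
have xb : x \in val b by exact: mem_closure1.
have ba : b != a by apply: contraNneq xa => <-.
exists b; have [c' ec vc'] := line_some omM ll ba; rewrite ec; apply/eqP; congr Some.
have xc' : x \in val c' := mem_line omM ll ba ec xb.
by apply: val_inj; exact: (atoms_eq omMa llMa (valP c') (valP c) xc' xc).
Qed.

(** The atoms of M/a are ordered by the smallest atom on each line: with this order a set without
    broken circuits and with top element a goes to a set without broken circuits. *)
Definition line_rep c : atom M := [arg min_(b < xchoose (line_surj c) | line a b == Some c) l b].

Lemma line_repP c :
  line a (line_rep c) = Some c /\ forall b, line a b = Some c -> (l (line_rep c) <= l b)%N.
Proof.
rewrite /line_rep; case: arg_minnP => [|b /eqP hb min]; first exact: (xchooseP (line_surj c)).
by split=> // b' hb'; apply: min; rewrite hb'.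
Qed.

Definition line_label c : nat := l (line_rep c).

Lemma line_label_inj : injective line_label.
Proof.
move=> c d /linj e; have [h _] := line_repP c; have [h' _] := line_repP d.
by move: h; rewrite e h' => -[].
Qed.

Lemma line_rep_neq c : line_rep c != a.
Proof. by apply/eqP => e; have [] := line_repP c; rewrite e line_none. Qed.

Lemma same_line_dependent b t c : b != t -> line a b = Some c -> line a t = Some c ->
  atoms_dependent [set b; t; a].
Proof.
move=> bt eb et; have na u : line a u = Some c -> u != a.
  by move=> eu; apply: contra_eqN eu => /eqP->; rewrite line_none.
have [ba ta] := (na b eb, na t et).
have as_ : a \notin [:: b; t] by rewrite !inE ![a == _]eq_sym negb_or ba.
have := rk_lines omM ll as_; rewrite !contract_atoms_cons eb et /=.
have -> : [set x in [:: c, c & contract_atoms a [::]]] = [set c].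
  by apply/setP => x; rewrite /contract_atoms /= !inE orbb.
have -> : [set x in [:: a; b; t]] = [set b; t; a].
  by apply/setP => x; rewrite !inE; case: (x == a); rewrite ?orbT ?orbF.
rewrite big_set1 (atom_rk (valP c)) /atoms_dependent => <-.
by rewrite setUC cardsU1 cards2 !inE negb_or ![a == _]eq_sym ba ta bt.
Qed.

Section Top.
Variable S : {set atom M}.
Hypotheses (aS : a \in S) (atop : forall s, s \in S -> (l s <= l a)%N) (hS : nbc l S).

(** A smaller atom on the line through s and a would be dependent with s and a, both in S and above
    it: a broken circuit. *)
Lemma line_rep_top s c : s \in S -> line a s = Some c -> line_rep c = s.
Proof.
move=> sS es; have [et min] := line_repP c; apply/eqP; apply: contraT => ne.
have := min s es; rewrite leq_eqVlt => /orP[/eqP/linj e|lt]; first by rewrite e eqxx in ne.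
have := forallP hS (line_rep c) => /negP[].
apply: (atoms_dependentS omM ll _ (same_line_dependent ne et es)).
apply/subsetP => x; rewrite !inE => /orP[/orP[->//|/eqP ->]|/eqP ->].
  by rewrite sS lt orbT.
by rewrite aS (leq_trans lt (atop sS)) orbT.
Qed.

Let es := enum (S :\ a).
Let a_es : a \notin es. Proof. by rewrite mem_enum !inE eqxx. Qed.
Definition line_set : {set atom Ma} := [set c in contract_atoms a es].

Lemma line_uniq : uniq (contract_atoms a es).
Proof.
have : {subset es <= S} by move=> b; rewrite mem_enum => /setD1P[].
have : uniq es by exact: enum_uniq.
move: a_es; elim: es => // b s IH.
rewrite inE negb_or eq_sym => /andP[ba as_] /= /andP[bs us] sub.
have sub' : {subset s <= S} by move=> x xs; apply: sub; rewrite inE xs orbT.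
rewrite contract_atoms_cons; have [c ec _] := line_some omM ll ba; rewrite ec /= IH // andbT.
rewrite mem_contract_atoms; apply/hasP => -[b' b's /eqP eb'].
have bS : b \in S by apply: sub; rewrite mem_head.
by case/negP: bs; rewrite -(line_rep_top bS ec) (line_rep_top (sub' _ b's) eb').
Qed.

Lemma mem_line_set c : (c \in line_set) = (line_rep c \in S :\ a).
Proof.
rewrite inE mem_contract_atoms; apply/hasP/idP => [[b]|h].
  by rewrite mem_enum => /setD1P[ba bS] /eqP ec; rewrite (line_rep_top bS ec) !inE ba.
by exists (line_rep c); [rewrite mem_enum|have [-> _] := line_repP c].
Qed.

(** A broken circuit among the lines, with representative t of its smallest line, lifts to t with
    the elements of S above it. These include a, which makes up for the rank lost by contraction. *)
Lemma line_set_nbc : nbc line_label line_set.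
Proof.
apply/forallP => c; set t := line_rep c; have ta : t != a := line_rep_neq c.
(* If t lies above the top of S, nothing of the line set is above c, and a single atom is
   independent. *)
have [la|la] := ltnP (l a) (l t).
  suff -> : [set d in line_set | (line_label c < line_label d)%N] = set0.
    rewrite setU0; apply/negP => /(atoms_dependent_gt1 ); by rewrite cards1.
  apply/setP => d; rewrite in_set0 in_set mem_line_set; apply/negP => /andP[/setD1P[_ dS]].
  by apply/negP; rewrite -leqNgt; apply: leq_trans (atop dS) (ltnW la).
have {}la : (l t < l a)%N.
  by rewrite ltn_neqAle la andbT; apply: contraNneq ta => /linj ->.
pose u := [seq s <- es | (l t < l s)%N].
have tu : a \notin t :: u by rewrite inE negb_or eq_sym ta mem_filter (negPf a_es) andbF.
have [et _] := line_repP c.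
have eset : c |: [set d in line_set | (line_label c < line_label d)%N]
    = [set x in contract_atoms a (t :: u)].
  apply/setP => d; rewrite in_setU1 in_set mem_line_set [RHS]in_set contract_atoms_cons et in_cons.
  case: eqP => //= _; rewrite mem_contract_atoms.
  apply/andP/hasP => [[dS lt]|[b]].
    exists (line_rep d); last by have [-> _] := line_repP d.
    by rewrite mem_filter mem_enum dS andbT; exact: lt.
  rewrite mem_filter mem_enum => /andP[lt /setD1P[ba bS]] /eqP ed.
  by rewrite /line_label (line_rep_top bS ed) !inE ba.
rewrite eset; have nd := forallP hS t.
have sz : (size (contract_atoms a (t :: u)) = size (t :: u))%N by rewrite size_contract_atoms.
have rkl := rk_lines omM ll tu.
have eS : [set b in a :: t :: u] = t |: [set s in S | (l t < l s)%N].
  apply/setP => b; rewrite !inE mem_filter mem_enum !inE.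
  have [->|ba] := eqVneq b a; first by rewrite aS la orbT.
  by rewrite andbC.
rewrite eS in rkl; rewrite /atoms_dependent -leqNgt -ltnS rkl.
move: nd; rewrite /atoms_dependent -leqNgt; apply: leq_trans.
have ut : uniq [:: a, t & u].
  rewrite /= tu mem_filter ltnn filter_uniq //; exact: enum_uniq.
rewrite -eS; have -> : #|[set b in [:: a, t & u]]| = size [:: a, t & u].
  by rewrite -(card_uniqP ut); apply: eq_card => b; rewrite inE.
rewrite (_ : size [:: a, t & u] = (size (contract_atoms a (t :: u))).+1); last by rewrite sz.
rewrite ltnS; apply: leq_trans (card_size _); apply: subset_leq_card.
by apply/subsetP => d; rewrite inE.
Qed.

End Top.
End Contraction.

End NoBrokenCircuit.

Section ResidueInjective.
Import GRing.Theory.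
Local Open Scope ring_scope.
Local Open Scope quotient_scope.
Variables (R : comPzRingType) (V : finType).
Implicit Types (M : sgsystem V).

(** The matroid and the labelling are quantified here because the residue leads to M/a with its own
    labelling. *)
Let nbc_free k := forall M (l : atom M -> nat), oriented_matroid M -> loopless M ->
  injective l -> forall y : ext R (atom M),
  homogeneous k y -> nbc_supported l y -> os_ideal y -> y = 0.

(* Let a be the largest element occurring in y: the monomials of y containing a are still
   distinct nbc monomials after taking the residue at a. *)
Lemma nbc_residue k M (l : atom M -> nat) (y : ext R (atom M)) : nbc_free k ->
  oriented_matroid M -> loopless M -> injective l ->
  homogeneous k.+1 y -> nbc_supported l y ->
  (forall a : atom M, os_ideal (ext_res a y)) -> y = 0.
Proof.
move=> IH omM ll linj hy ny hres; apply/ffunP => S0; rewrite ffunE; apply/eqP.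
apply: contraT => y0; exfalso.
pose occurs (a : atom M) := [exists S : {set atom M}, (y S != 0) && (a \in S)].
have [a0 occ0] : exists a, occurs a.
  have : (0 < #|S0|)%N by rewrite (hy _ y0).
  by case/card_gt0P => a aS; exists a; apply/existsP; exists S0; rewrite y0.
case: (@arg_maxnP _ a0 occurs l occ0) => a /existsP[S1 /andP[y1 aS1]] max.
have top (S : {set atom M}) : y S != 0 -> forall s, s \in S -> (l s <= l a)%N.
  by move=> yS s sS; apply: max; apply/existsP; exists S; rewrite yS.
have aE (S : {set atom M}) : a \notin enum (S :\ a) by rewrite mem_enum !inE eqxx.
pose J (S : {set atom M}) := line_set a S.
have eJ (S : {set atom M}) : a \in S -> y S != 0 -> exists b : bool,
    emon R (contract_atoms a (enum (S :\ a))) = (-1) ^+ b *: mon R (J S).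
  by move=> aS yS; apply: emon_set; exact: line_uniq (top S yS) (ny S yS).
have cJ (S : {set atom M}) : a \in S -> y S != 0 -> #|J S| = k.
  move=> aS yS; have us := line_uniq omM ll linj aS (top S yS) (ny S yS).
  rewrite (_ : #|J S| = size (contract_atoms a (enum (S :\ a)))); last first.
    by rewrite -(card_uniqP us); apply: eq_card => c; rewrite inE.
  rewrite size_contract_atoms // -cardE; have := hy S yS.
  by rewrite (cardsD1 a S) aS => -[].
have Jinj (S S' : {set atom M}) : a \in S -> y S != 0 -> a \in S' -> y S' != 0 -> J S = J S' -> S = S'.
  have sub (T T' : {set atom M}) : a \in T -> y T != 0 -> a \in T' -> y T' != 0 -> J T = J T' -> T \subset T'.
    move=> aT yT aT' yT' e; apply/subsetP => b bT.
    have [->//|ba] := eqVneq b a; have [c ec _] := line_some omM ll ba.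
    have rb := line_rep_top omM ll linj aT (top T yT) (ny T yT) bT ec.
    have : c \in J T by rewrite (mem_line_set omM ll linj) ?(top T yT) ?(ny T yT) // ?rb ?inE ?ba //; exact: top.
    rewrite e (mem_line_set omM ll linj) ?(ny T' yT') // ?rb; first by case/setD1P.
    exact: top.
  by move=> aS yS aS' yS' e; apply/eqP; rewrite eqEsubset !sub.
pose sg (S : {set atom M}) : R := (-1) ^+ #|[set b in S | (enum_rank a < enum_rank b)%N]|.
have resE U : ext_res a y U = \sum_(S : {set atom M} | a \in S)
    y S * sg S * emon R (contract_atoms a (enum (S :\ a))) U.
  by rewrite /ext_res sum_ffunE; apply: eq_bigr => S _; rewrite ext_scaleE.
have ha : is_atom M (val a) := valP a.
have r0 : ext_res a y = 0.
  apply: (IH _ (line_label l omM ll)) => //.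
  - exact: (contract_om omM ll ha).
  - exact: (contract_loopless omM ll ha).
  - exact: line_label_inj.
  - apply: homogeneous_sum => S aS; have [->|yS] := eqVneq (y S) 0.
      by rewrite mul0r scale0r; exact: homogeneous0.
    apply: homogeneousZ; have [b ->] := eJ S aS yS.
    by rewrite -(cJ S aS yS); apply/homogeneousZ/homogeneous_mon.
  - move=> U; rewrite resE => nz.
    have [S aS] : exists2 S : {set atom M}, a \in S &
        y S * sg S * emon R (contract_atoms a (enum (S :\ a))) U != 0.
      apply/exists_inP; apply: contraNT nz; rewrite negb_exists_in => /forall_inP h.
      by rewrite big1 // => S /h; rewrite negbK => /eqP.
    have [->|yS] := eqVneq (y S) 0; first by rewrite !mul0r eqxx.
    have [b ->] := eJ S aS yS; rewrite ext_scaleE monE.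
    case: (U =P J S) => [-> _|_]; last by rewrite !mulr0 eqxx.
    by apply: line_set_nbc => //; [exact: top|exact: ny].
(* By injectivity of [J] only the set S1 contributes to this coefficient, which is therefore its own
   coefficient up to sign. *)
have := resE (J S1); rewrite r0 ffunE (bigD1 S1) //= big1 ?addr0 => [|S /andP[aS neS]]; last first.
  have [->|yS] := eqVneq (y S) 0; first by rewrite !mul0r.
  have [b ->] := eJ S aS yS; rewrite ext_scaleE monE.
  case: eqP => [e|_]; last by rewrite !mulr0.
  by case/eqP: neS; apply: Jinj.
have [b ->] := eJ S1 aS1 y1; rewrite ext_scaleE monE eqxx mulr1 => /esym/eqP.
rewrite /sg -mulrA -exprD -signr_odd; case: (odd _); rewrite ?expr1 ?mulrN1 ?expr0 ?mulr1 ?oppr_eq0;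
  by rewrite (negPf y1).
Qed.

Lemma nbc_freeP k : nbc_free k.
Proof.
elim: k => [|k IH] M l omM ll linj y hy ny iy.
  apply/ffunP => S; rewrite ffunE; have [->|S0] := eqVneq S set0.
    by apply: (os_ideal_unit _ iy) => I; exact: atoms_dependent_gt1.
  by apply/eqP; apply: contraNT S0 => /hy/eqP; rewrite cards_eq0.
apply: (nbc_residue IH omM ll linj hy ny) => a.
exact: os_ideal_res.
Qed.

Lemma os_res_inj M (k : nat) (x : ext R (atom M)) : oriented_matroid M -> loopless M ->
  homogeneous k.+1 x -> (forall a, os_res a (\pi_(OS R M) x) = 0) -> \pi_(OS R M) x = 0.
Proof.
move=> omM ll hx h0.
have linj : injective (fun a : atom M => nat_of_ord (enum_rank a)).
  by move=> b c /val_inj/enum_rank_inj.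
have [y [hy ny ixy]] := nbc_spans (fun a : atom M => nat_of_ord (enum_rank a)) hx.
have exy : \pi_(OS R M) x = \pi_(OS R M) y by apply/os_pi_eq.
suff y0 : y = 0 by rewrite exy y0 os_pi_0.
apply: (nbc_residue (@nbc_freeP k) omM ll linj hy ny) => a.
by apply/os_pi0; rewrite -os_res_pi // -exy h0.
Qed.

End ResidueInjective.

(** * Chirotopes and forms of triangulations *)

Section Chirotopes.
Import GRing.Theory.
Local Open Scope ring_scope.
Variables (V : finType).
Implicit Types (M : sgsystem V) (i j : V) (s : seq V).

Lemma sval_posE (C : sgset V) i : [disjoint pos C & neg C] -> i \in pos C -> sval_at C i = 1.
Proof. by move=> d ip; rewrite /sval_at ip (disj_posF d ip). Qed.

Lemma sval_negE (C : sgset V) i : [disjoint pos C & neg C] -> i \in neg C -> sval_at C i = -1.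
Proof. by move=> d ip; rewrite /sval_at ip (disj_negF d ip). Qed.

(** Extension by 0 to sequences of any length, so that the sign lemmas for sequences apply to
    chirotopes. *)
Definition chiseq r (chi : {ffun r.-tuple V -> int}) s : int :=
  if insub s is Some t then chi t else 0.

Lemma chiseq_tuple r (chi : {ffun r.-tuple V -> int}) (t : r.-tuple V) : chiseq chi t = chi t.
Proof. by rewrite /chiseq valK. Qed.

Lemma chiseq_size r (chi : {ffun r.-tuple V -> int}) s : size s != r -> chiseq chi s = 0.
Proof. by move=> h; rewrite /chiseq insubF ?(negPf h). Qed.

Lemma chiseq_antisym M r (chi : {ffun r.-tuple V -> int}) :
  chirotope M chi -> antisymmetric_seq (chiseq chi).
Proof.
move=> [_ _ hs _] s1 a b s2.
have [e|e] := eqVneq (size (s1 ++ a :: b :: s2)) r; last first.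
  rewrite !chiseq_size ?oppr0 //; move: e; rewrite !size_cat //.
have e' : size (s1 ++ b :: a :: s2) == r by move: e; rewrite !size_cat /= => ->.
have l1 : (size s1 < r)%N by move: e; rewrite size_cat /=; lia.
have l2 : ((size s1).+1 < r)%N by move: e; rewrite size_cat /=; lia.
pose t : r.-tuple V := Tuple e'.
rewrite -[s1 ++ b :: a :: s2]/(tval t) chiseq_tuple.
pose p := tperm (Ordinal l1) (Ordinal l2).
have := hs t p; rewrite /p odd_tperm -val_eqE /= neq_ltn leqnn /= expr1 mulN1r => <-.
rewrite -chiseq_tuple; congr chiseq.
apply: (@eq_from_nth _ a) => [|k lk]; first by rewrite size_tuple e.
rewrite e in lk; have -> : nth a [tuple tnth t (tperm (Ordinal l1) (Ordinal l2) k0) | k0 < r] k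
    = nth a t (tperm (Ordinal l1) (Ordinal l2) (Ordinal lk)).
  by rewrite -[k in LHS]/(val (Ordinal lk)) -tnth_nth tnth_mktuple (tnth_nth a).
rewrite /t /=; case: tpermP => [/(congr1 val)/= ->|/(congr1 val)/= ->|].
- by rewrite !nth_cat ltnn subnn ltnNge leqnSn /= subSnn.
- by rewrite !nth_cat ltnn subnn ltnNge leqnSn /= subSnn.
move=> /eqP; rewrite -val_eqE /= => n1 /eqP; rewrite -val_eqE /= => n2.
rewrite !nth_cat; case: ltnP => // le.
have : (1 < k - size s1)%N.
  by rewrite ltn_subRL addn1 ltn_neqAle eq_sym n2 /= ltn_neqAle eq_sym n1.
by case: (k - size s1)%N => [|[|m]].
Qed.

Lemma chirotope_values M r (chi : {ffun r.-tuple V -> int}) (t : r.-tuple V) :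
  chirotope M chi -> [\/ chi t = 0, chi t = 1 | chi t = -1].
Proof.
by move=> [h _ _ _]; have := h t; rewrite !inE => /or3P[] /eqP ->; [apply: Or31|apply: Or32|apply: Or33].
Qed.

Section ContractChi.
Variables (M : sgsystem V) (r : nat) (chi : {ffun r.+1.-tuple V -> int}).
Hypotheses (omM : oriented_matroid M) (ll : loopless M) (hchi : chirotope M chi).
Variable a : {set V}.
Hypothesis ha : is_atom M a.
Let Ma := contract M a.

Lemma chi_contractE i (t : r.-tuple V) : chi_contract chi i t = chiseq chi (rcons t i).
Proof. by rewrite ffunE -chiseq_tuple. Qed.

Lemma chi_contract_neq0 i (t : r.-tuple V) : i \in a ->
  (chi_contract chi i t != 0) = uniq t && basis Ma [set k in tval t].
Proof.
move=> ia; rewrite ffunE; case: hchi => _ -> _ _ /=; rewrite rcons_uniq.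
rewrite (contract_basis omM ll ha _ ia).
have -> : [set k in rcons t i] = i |: [set k in tval t].
  by apply/setP => k; rewrite !inE mem_rcons inE.
case: (boolP (uniq t)) => [ut|]; last by rewrite andbF.
rewrite andbT /=; apply/andP/andP => [[it hB]|[gt hB]]; split=> //.
  apply/subsetP => k; rewrite inE => kt; rewrite inE.
  have kB : k \in i |: [set k in tval t] by rewrite !inE kt orbT.
  rewrite (basis_ground hB kB) andbT; apply: contra it => ka.
  by rewrite (indep_atom1 omM ll ha (basis_indep hB) (setU11 _ _) kB ia ka).
by apply/negP => it; have := subsetP gt i; rewrite !inE it ia => /(_ isT).
Qed.

Lemma chirotope_contract i : i \in a -> chirotope Ma (chi_contract chi i).
Proof.
move=> ia; have [h1 h2 h3 h4] := hchi; split.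
- by move=> t; rewrite ffunE.
- by move=> t; exact: chi_contract_neq0.
(* A permutation of the first r positions is extended by fixing the last one, which has the same
   sign. *)
- move=> t s; rewrite !ffunE; have := h3 [tuple of rcons t i] (lift_perm ord_max ord_max s).
  rewrite odd_lift_perm ?addbA addbb /= => <-; congr (chi _).
  apply: eq_from_tnth => k; rewrite tnth_mktuple.
  have tR (u : r.-tuple V) (m : 'I_r) : tnth [tuple of rcons u i] (lift ord_max m) = tnth u m.
    have e : nat_of_ord (lift ord_max m) = m by rewrite /= /bump leqNgt ltn_ord.
    by rewrite !(tnth_nth i) e /= nth_rcons size_tuple ltn_ord.
  have tM (u : r.-tuple V) : tnth [tuple of rcons u i] ord_max = i.
    by rewrite (tnth_nth i) /= nth_rcons size_tuple ltnn eqxx.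
  case: (unliftP ord_max k) => [m ->|->]; last by rewrite lift_perm_id !tM.
  by rewrite lift_perm_lift !tR tnth_mktuple.
move=> t u i0 j0 x C et eu nt nu hC sC.
have [C' [hC' eC nC sC']] := contract_lift omM ll ha hC ia.
have nat_ (v : r.-tuple V) k : chi_contract chi i v != 0 -> k \in tval v -> k \notin a.
  rewrite chi_contract_neq0 // => /andP[_ /basis_indep/indep_ground/subsetP h] kv.
  by have := h k; rewrite !inE kv => /(_ isT) /andP[].
have i0a : i0 \notin a by apply: (nat_ t) => //; rewrite et mem_head.
have j0a : j0 \notin a by apply: (nat_ u) => //; rewrite eu mem_head.
have sv k : k \notin a -> sval_at C k = sval_at C' k.
  by move=> ka; rewrite eC /sval_at /= !inE ka.
rewrite !sv //; move: nt nu; rewrite !ffunE => nt nu.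
apply: (h4 _ _ _ _ (rcons x i)) => //=; rewrite ?et ?eu ?rcons_cons //.
apply: subset_trans sC' _; rewrite subUset; apply/andP; split.
  by rewrite sub1set !inE mem_rcons mem_head !orbT.
apply: subset_trans sC _; apply/subsetP => k; rewrite !inE => /or3P[->|->|kx]; rewrite ?orbT //.
by rewrite mem_rcons inE kx !orbT.
Qed.

(** The circuit on i and j compares bases that differ by exchanging them, so its relative sign is
    the ratio of the two contracted chirotopes. *)
Lemma chi_pair i j : i \in a -> j \in a -> i != j ->
  (([set i], [set j]) \in circuits M /\ chi_contract chi i = chi_contract chi j) \/
  (([set i; j], set0) \in circuits M /\
   forall t, chi_contract chi j t = - chi_contract chi i t).
Proof.
move=> ia ja ij; have [P [hP sP iP]] := atom_pair omM ll ha ia ja ij.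
have dP := circ_disj omM hP.
have piv t : chi_contract chi j t = - (sval_at P i * sval_at P j) * chi_contract chi i t.
  have [e|ne] := eqVneq (chi_contract chi i t) 0.
    rewrite e mulr0; apply/eqP; apply: contraT; rewrite chi_contract_neq0 // => h.
    by move: h; rewrite -(chi_contract_neq0 t ia) e eqxx.
  have ne' : chi_contract chi j t != 0 by rewrite chi_contract_neq0 // -(chi_contract_neq0 t ia).
  (* The pivoting relation exchanges the first entry, while contraction appends the last one; the
     signs of the two moves are the same and cancel. *)
  move: ne ne'; rewrite !chi_contractE -!cats1 !(antisymmetric_move _ _ _ (chiseq_antisym hchi)) cats0.
  pose ti : r.+1.-tuple V := [tuple of i :: t]; pose tj : r.+1.-tuple V := [tuple of j :: t].
  have -> : chiseq chi (i :: t) = chi ti by rewrite -chiseq_tuple.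
  have -> : chiseq chi (j :: t) = chi tj by rewrite -chiseq_tuple.
  have [_ _ _ h4] := hchi.
  have key : chi ti != 0 -> chi tj != 0 -> chi tj = - (sval_at P i * sval_at P j) * chi ti.
    move=> n1 n2; apply: (h4 ti tj i j (tval t) P) => //.
    by rewrite sP; apply/subsetP => k; rewrite !inE orbA => /orP[->|->]; rewrite ?orbT.
  case: (odd _); rewrite ?oppr_eq0 => n1 n2; last exact: key.
  by rewrite (key n1 n2) mulrN.
have jP : j \in supp P by rewrite sP !inE eqxx orbT.
have in_P k : k \in supp P -> (k == i) || (k == j) by rewrite sP !inE.
rewrite (sval_posE dP iP) mul1r in piv.
move: jP; rewrite mem_supp => /orP[jp|jn]; [right|left].
  have eP : P = ([set i; j], set0).
    apply: sgset_eq => /=; apply/setP => k; rewrite !inE.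
      apply/idP/orP => [kP|[] /eqP -> //]; apply/orP/in_P; by rewrite mem_supp kP.
    apply/negP => kn; have : k \in supp P by rewrite mem_supp kn orbT.
    by case/in_P/orP => /eqP ek; move: kn; rewrite ek (disj_posF dP).
  by split=> [|t]; [rewrite -eP|rewrite piv (sval_posE dP jp) mulN1r].
have eP : P = ([set i], [set j]).
  apply: sgset_eq => /=; apply/setP => k; rewrite !inE.
    apply/idP/eqP => [kP|-> //]; have : k \in supp P by rewrite mem_supp kP.
    by case/in_P/orP => /eqP // ek; move: kP; rewrite ek (disj_negF dP jn).
  apply/idP/eqP => [kP|-> //]; have : k \in supp P by rewrite mem_supp kP orbT.
  by case/in_P/orP => /eqP // ek; move: kP; rewrite ek (disj_posF dP iP).
by split; [rewrite -eP|apply/ffunP => t; rewrite piv (sval_negE dP jn) opprK mul1r].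
Qed.

End ContractChi.

Lemma oriented_pair_contract M r (chi : {ffun r.+2.-tuple V -> int}) a i :
  oriented_pair M chi -> is_atom M a -> i \in a ->
  oriented_pair (contract M a) (chi_contract chi i).
Proof.
move=> [omM ll rM _ hchi] ha ia; split=> //.
- exact: contract_om.
- exact: contract_loopless.
- by have := contract_mrank omM ll ha; rewrite rM => -[].
- exact: chirotope_contract.
Qed.

End Chirotopes.

Section Forms.
Import GRing.Theory.
Local Open Scope ring_scope.
Local Open Scope quotient_scope.
Variables (R : comPzRingType) (V : finType).
Implicit Types (M : sgsystem V) (i j : V) (s t : seq V) (Delta : {set {set V}}).

(** A loop gives 0, whereas [atom_seq] would drop it; only with 0 is the product antisymmetric on
    all sequences. *)
Definition elt_gen M i : ext R (atom M) :=
  if insub (closure M [set i]) is Some c then gen R c else 0.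

Definition elt_prod M s : ext R (atom M) := foldr (fun i u => elt_gen M i * u) 1 s.

Lemma elt_prod_cons M i s : elt_prod M (i :: s) = elt_gen M i * elt_prod M s.
Proof. by []. Qed.
Arguments elt_prod : simpl never.

Lemma elt_prod_antisym M : antisymmetric_seq (elt_prod M).
Proof.
move=> s1 i j s2; elim: s1 => [|k s1 IH]; last by rewrite !cat_cons !elt_prod_cons IH mulrN.
rewrite !cat0s !elt_prod_cons !mulrA /elt_gen; case: insub => [c|]; case: insub => [d|];
  by rewrite ?mul0r ?mulr0 ?mul0r ?oppr0 // gen_anti mulNr.
Qed.

Lemma atom_seq_cons M i s : oriented_matroid M -> loopless M -> i \in ground M ->
  exists c : atom M, [/\ atom_seq M (i :: s) = c :: atom_seq M s, val c = closure M [set i]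
    & elt_gen M i = gen R c].
Proof.
move=> omM ll gi; have h := closure1_atom omM ll gi.
by exists (Sub _ h); split=> //; rewrite /atom_seq /elt_gen /= insubT.
Qed.

Lemma elt_prodE M s : oriented_matroid M -> loopless M -> {subset s <= ground M} ->
  elt_prod M s = emon R (atom_seq M s) /\ size (atom_seq M s) = size s.
Proof.
move=> omM ll; elim: s => // i s IH sg.
have [|e1 e2] := IH; first by move=> k ks; apply: sg; rewrite inE ks orbT.
have [|c [-> _ eg]] := atom_seq_cons s omM ll (_ : i \in ground M); first by apply: sg; rewrite mem_head.
by rewrite elt_prod_cons eg e1 /= e2.
Qed.

Definition basis_form M r (chi : {ffun r.-tuple V -> int}) s : ext R (atom M) :=
  (chiseq chi s)%:~R *: bdry (elt_prod M s).

Lemma basis_form_perm M N r (chi : {ffun r.-tuple V -> int}) s t : chirotope N chi ->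
  perm_eq s t -> basis_form M chi t = basis_form M chi s.
Proof.
move=> hchi /perm_sign [b hb]; rewrite /basis_form (hb _ _ (chiseq_antisym hchi)).
rewrite (hb _ _ (@elt_prod_antisym M)); case: b {hb} => //.
by rewrite rmorphN -[- elt_prod _ _]scaleN1r bdryZ scaleN1r scalerN scaleNr opprK.
Qed.

Definition form_of M r (chi : {ffun r.-tuple V -> int}) (Delta : {set {set V}}) : ext R (atom M) :=
  \sum_(B in Delta) basis_form M chi (enum B).

Lemma enum_ground M (B : {set V}) : indep M B -> {subset enum B <= ground M}.
Proof. by move=> /indep_ground/subsetP h k; rewrite mem_enum => /h. Qed.

Lemma homogeneous_basis_form M r (chi : {ffun r.-tuple V -> int}) (B : {set V}) :
  oriented_matroid M -> loopless M -> indep M B -> homogeneous #|B|.-1 (basis_form M chi (enum B)).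
Proof.
move=> omM ll hB; rewrite /basis_form; have [-> sz] := elt_prodE omM ll (enum_ground hB).
rewrite cardE -sz bdry_emon; exact/homogeneousZ/homogeneous_bdry_seq.
Qed.

Lemma homogeneous_form M r (chi : {ffun r.-tuple V -> int}) Delta : oriented_pair M chi ->
  (forall B, B \in Delta -> basis M B) -> homogeneous r.-1 (form_of M chi Delta).
Proof.
move=> [omM ll rM _ _] hB; apply: homogeneous_sum => B /hB hb.
have := homogeneous_basis_form (chi := chi) omM ll (basis_indep hb).
by rewrite (basis_card hb) rM.
Qed.

Lemma form_ofN M r (chi chi' : {ffun r.-tuple V -> int}) Delta :
  (forall u : r.-tuple V, chi' u = - chi u) -> form_of M chi' Delta = - form_of M chi Delta.
Proof.
move=> h; rewrite -sumrN; apply: eq_bigr => B _; rewrite /basis_form -scaleNr; congr (_ *: _).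
rewrite /chiseq; case: insub => [t|]; last by rewrite oppr0.
by rewrite h rmorphN.
Qed.

Lemma form_of_set0 M r (chi : {ffun r.-tuple V -> int}) : form_of M chi set0 = 0.
Proof. by rewrite /form_of big_set0. Qed.

Lemma bdry_form M r (chi : {ffun r.-tuple V -> int}) Delta : bdry (form_of M chi Delta) = 0.
Proof.
rewrite bdryE lin_ext_sum big1 // => B _; rewrite -bdryE bdryZ bdry_bdry scaler0 //.
Qed.

Lemma triangulation_formE M r (chi : {ffun r.-tuple V -> int}) Delta ord :
    oriented_pair M chi -> triangulation M Delta ->
    (forall B, B \in Delta -> [set i in tval (ord B)] = B) ->
  triangulation_form R M chi Delta ord = \pi_(OS R M) (form_of M chi Delta).
Proof.
move=> [omM ll rM _ hchi] [_ hB _ _] hord.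
rewrite /form_of (big_morph (\pi_(OS R M)) (@os_piD R V M) (@os_pi_0 R V M)).
apply: eq_bigr => B hBD; have hb := hB B hBD; have eB := hord B hBD.
have us : uniq (ord B).
  apply/card_uniqP; rewrite size_tuple.
  transitivity #|B|; last by rewrite (basis_card hb).
  by rewrite -[in RHS]eB; apply: eq_card => k; rewrite inE.
have p : perm_eq (ord B) (enum B).
  by apply: uniq_perm => //; [exact: enum_uniq|move=> k; rewrite mem_enum -[in RHS]eB inE].
rewrite (basis_form_perm _ hchi p) /basis_form chiseq_tuple /os_elt os_bdry_pi.
have [|-> _] := elt_prodE omM ll (_ : {subset ord B <= ground M}).
  by move=> k kB; apply: (basis_ground hb); rewrite -eB inE.
case: (chirotope_values (ord B) hchi) => ->.
- by rewrite mulr0z scale0r os_pi_0.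
- by rewrite mulr1z scale1r.
- by rewrite mulrN1z rmorphN1 scaleN1r os_piN.
Qed.

Section ResidueOfForm.
Variables (M : sgsystem V) (a : atom M).
Hypotheses (omM : oriented_matroid M) (ll : loopless M).
Let Ma := contract M (val a).
Let ha : is_atom M (val a) := valP a.

Lemma atom_seq_notin s : {subset s <= ground M} -> (forall i, i \in s -> i \notin val a) ->
  a \notin atom_seq M s /\ contract_atoms a (atom_seq M s) = atom_seq Ma s.
Proof.
elim: s => // i s IH sg sa.
have sg' : {subset s <= ground M} by move=> k ks; apply: sg; rewrite inE ks orbT.
have sa' k : k \in s -> k \notin val a by move=> ks; apply: sa; rewrite inE ks orbT.
have [n1 e1] := IH sg' sa'.
have gi : i \in ground M by apply: sg; rewrite mem_head.
have ia : i \notin val a by apply: sa; rewrite mem_head.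
have [c [-> vc _]] := atom_seq_cons s omM ll gi.
have ic : i \in val c by rewrite vc mem_closure1.
have ca : c != a by apply: contraNneq ia => <-.
split; first by rewrite inE negb_or eq_sym ca.
rewrite contract_atoms_cons /line (closure_line omM ll ca ic) e1 {2}/atom_seq /=.
by case: insub.
Qed.

(** Moving a to the front and taking the residue there give the same sign twice. *)
Lemma ext_res_rcons (t : seq (atom M)) : a \notin t ->
  ext_res a (bdry (emon R (rcons t a))) = bdry (emon R (contract_atoms a t)).
Proof.
move=> at_; rewrite -cats1 emon_cat [emon R [:: a]]emon_cons emon_nil mulr1 mul_gen sgn_ext_emon.
rewrite extZr -emon_cons bdryZ bdry_emon ext_resZ // ext_res_bdry_cons // scalerA -exprD addnn.
by rewrite -signr_odd odd_double expr0 scale1r.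
Qed.

(** A basis has at most one element in the atom, so the sum has at most one nonzero term; in this
    shape it can be exchanged with the sum over Delta. *)
Lemma ext_res_basis_form r (chi : {ffun r.+1.-tuple V -> int}) (B : {set V}) :
    chirotope M chi -> indep M B ->
  ext_res a (basis_form M chi (enum B)) =
  \sum_(i in val a) if i \in B then basis_form Ma (chi_contract chi i) (enum (B :\ i)) else 0.
Proof.
move=> hchi hB; case: (pickP [pred i | (i \in val a) && (i \in B)]) => [i /andP[/= ia iB]|no].
  rewrite (bigD1 i) //= iB big1 ?addr0 => [|j /andP[ja ji]]; last first.
    case: ifP => // jB; case/eqP: ji; exact: (indep_atom1 omM ll ha hB jB iB ja ia).
  have gi : i \in ground M := mem_atom_ground ha ia.
  have hBi : indep M (B :\ i) by apply: indepS hB; exact: subD1set.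
  have p : perm_eq (rcons (enum (B :\ i)) i) (enum B).
    apply: uniq_perm; rewrite ?rcons_uniq ?mem_enum ?enum_uniq ?setD11 //.
    move=> k; rewrite mem_rcons inE !mem_enum in_setD1.
    by case: eqP => [->|].
  rewrite (basis_form_perm _ hchi p) /basis_form ext_resZ //.
  have -> : chiseq (chi_contract chi i) (enum (B :\ i)) = chiseq chi (rcons (enum (B :\ i)) i).
    have [e|ne] := eqVneq (size (enum (B :\ i))) r; last by rewrite !chiseq_size ?size_rcons.
    pose t : r.-tuple V := Tuple (introT eqP e).
    by rewrite -[enum (B :\ i)]/(tval t) chiseq_tuple chi_contractE.
  congr (_ *: _); set s := enum (B :\ i).
  have sg : {subset s <= ground M} by exact: enum_ground.
  have sa k : k \in s -> k \notin val a.
    rewrite mem_enum => /setD1P[ki kB]; apply: contra ki => ka.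
    by rewrite (indep_atom1 omM ll ha hB kB iB ka ia).
  have [n1 e1] := atom_seq_notin sg sa.
  have omMa := contract_om omM ll ha; have llMa := contract_loopless omM ll ha.
  have [|-> _] := elt_prodE omMa llMa (_ : {subset s <= ground Ma}).
    by move=> k ks; rewrite inE sg // sa.
  have [|-> _] := elt_prodE omM ll (_ : {subset rcons s i <= ground M}).
    by move=> k; rewrite mem_rcons inE => /predU1P[->|/sg].
  rewrite -e1 -ext_res_rcons //; congr (ext_res _ (bdry (emon _ _))).
  rewrite -!cats1 /atom_seq pmap_cat; congr (_ ++ _) => /=.
  by rewrite (atom_closure omM ll ha ia) valK.
rewrite big1 => [|i ia]; last by have := no i; rewrite /= ia /= => ->.
have [n1 _] : a \notin atom_seq M (enum B) /\ contract_atoms a (atom_seq M (enum B)) = atom_seq Ma (enum B).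
  apply: atom_seq_notin; first exact: enum_ground.
  by move=> i; rewrite mem_enum => iB; have := no i; rewrite /= iB andbT => ->.
rewrite /basis_form ext_resZ //; have [-> _] := elt_prodE omM ll (enum_ground hB).
by rewrite bdry_emon ext_res_bdry_seq_notin // scaler0.
Qed.

Lemma ext_res_form r (chi : {ffun r.+1.-tuple V -> int}) Delta : chirotope M chi ->
    (forall B, B \in Delta -> basis M B) ->
  ext_res a (form_of M chi Delta) =
  \sum_(i in val a) form_of Ma (chi_contract chi i) (link Delta i).
Proof.
move=> hchi hB; rewrite ext_resE // lin_ext_sum.
under eq_bigr => B hBD do rewrite -ext_resE // ext_res_basis_form // ?basis_indep ?hB //.
rewrite exchange_big /=; apply: eq_bigr => i ia; rewrite -big_mkcondr /=.
rewrite /form_of big_imset /=; last first.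
  move=> B B'; rewrite !inE => /andP[_ iB] /andP[_ iB'] e.
  by rewrite -(setD1K iB) e setD1K.
by apply: eq_bigl => B; rewrite inE.
Qed.

End ResidueOfForm.
End Forms.

(** * Residues of the forms *)

Section Canonical.
Import GRing.Theory.
Local Open Scope ring_scope.
Local Open Scope quotient_scope.
Variables (R : comPzRingType) (V : finType).
Implicit Types (M : sgsystem V) (i j : V) (Delta : {set {set V}}).

Lemma triangulation_no_parallel M Delta i j (B B' : {set V}) : triangulation M Delta ->
  B \in Delta -> B' \in Delta -> i \in B -> j \in B' -> ([set i], [set j]) \notin circuits M.
Proof.
move=> [_ _ hP _] hB hB' iB jB'; apply/negP => hC; apply: (hP B B') => //.
by exists ([set i], [set j]); rewrite //= !sub1set iB.
Qed.

Section UsedElements.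
Variables (M : sgsystem V) (r : nat) (chi : {ffun r.+1.-tuple V -> int}) (Delta : {set {set V}}).
Hypotheses (omM : oriented_matroid M) (ll : loopless M) (rM : mrank M = r.+1).
Hypotheses (hchi : chirotope M chi) (hT : triangulation M Delta).
Variable a : {set V}.
Hypothesis ha : is_atom M a.

Definition used i : bool := [exists B in Delta, i \in B].

Lemma used_opposite i j : i \in a -> j \in a -> i != j -> used i -> used j ->
  ([set i; j], set0) \in circuits M /\ forall t, chi_contract chi j t = - chi_contract chi i t.
Proof.
move=> ia ja ij /exists_inP[B hB iB] /exists_inP[B' hB' jB'].
have [[hC _]|//] := chi_pair omM ll hchi ha ia ja ij.
by have := triangulation_no_parallel hT hB hB' iB jB'; rewrite hC.
Qed.

Lemma used_chi_neq0 i : i \in a -> used i -> exists t, chi_contract chi i t != 0.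
Proof.
move=> ia /exists_inP[B hBD iB]; have [_ hB _ _] := hT; have hb := hB B hBD.
have sz : size (enum (B :\ i)) == r.
  by rewrite -cardE; have := basis_card hb; rewrite rM (cardsD1 i B) iB add1n => -[->].
exists (Tuple sz); rewrite (chi_contract_neq0 omM ll hchi ha) //= enum_uniq /=.
have -> : [set k in enum (B :\ i)] = B :\ i by apply/setP => k; rewrite inE mem_enum.
exact: (basis_contract omM ll ha hb iB ia).
Qed.

(** Three pairwise opposite elements would make the contracted chirotope equal to its own negative,
    against its nonzero value at a basis. *)
Lemma used_two i j k : i \in a -> j \in a -> k \in a -> i != j -> k != i -> k != j ->
  used i -> used j -> ~~ used k.
Proof.
move=> ia ja ka ij ki kj ui uj; apply/negP => uk.
have [t nz] := used_chi_neq0 ia ui; have [_ h1] := used_opposite ia ja ij ui uj.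
have [_ h2] : ([set i; k], set0) \in circuits M /\ forall t, chi_contract chi k t = - chi_contract chi i t.
  by apply: used_opposite => //; rewrite eq_sym.
have [_ h3] : ([set j; k], set0) \in circuits M /\ forall t, chi_contract chi k t = - chi_contract chi j t.
  by apply: used_opposite => //; rewrite eq_sym.
have e : - chi_contract chi i t = chi_contract chi i t by rewrite -h2 h3 h1 opprK.
by move: nz; have [||] := chirotope_values t (chirotope_contract omM ll hchi ha ia); move=> h0; move: e; rewrite h0.
Qed.

Lemma link_unused i : ~~ used i -> link Delta i = set0.
Proof.
move=> ui; apply/setP => B; rewrite inE; apply/negP => /linkP[B' [hB' iB' _]].
by case/negP: ui; apply/exists_inP; exists B'.
Qed.

End UsedElements.

Lemma basis_form1 M (chi : {ffun 1.-tuple V -> int}) i : oriented_matroid M -> loopless M ->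
  i \in ground M -> basis_form R M chi (enum [set i]) = (chi [tuple i])%:~R *: (1 : ext R (atom M)).
Proof.
move=> omM ll gi; rewrite enum_set1 /basis_form -chiseq_tuple; congr (_ *: _).
have [c [_ _ ec]] := atom_seq_cons R [::] omM ll gi.
by rewrite elt_prod_cons ec bdry_gen bdry1 mulr0 subr0.
Qed.

Lemma rank1_atom M : oriented_matroid M -> mrank M = 1%N -> is_atom M (ground M).
Proof.
move=> omM rM; rewrite /is_atom /=; apply/andP; split; last by rewrite -/(mrank M) rM.
rewrite /flat subxx /= eqEsubset closure_ground; exact: sub_closure.
Qed.

(** A triangulation in rank 1 is one point or two opposite points. Two points form a positive
    circuit and their terms cancel. *)
Lemma rank1_form M (chi : {ffun 1.-tuple V -> int}) Delta : oriented_pair M chi ->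
  triangulation M Delta ->
  (acyclic M /\ forall i, i \in ground M -> form_of R M chi Delta = (chi [tuple i])%:~R *: (1 : ext R (atom M))) \/
  (~ acyclic M /\ form_of R M chi Delta = 0).
Proof.
move=> [omM ll rM _ hchi] hT; have [n0 hB _ hM] := hT.
have ha := rank1_atom omM rM.
have one B : B \in Delta -> exists2 i, B = [set i] & i \in ground M.
  move=> hBD; have /eqP/cards1P[i ei] : #|B| = 1%N by rewrite (basis_card (hB B hBD)).
  by exists i => //; apply: (basis_ground (hB B hBD)); rewrite ei set11.
have u i : [set i] \in Delta -> used Delta i.
  by move=> h; apply/exists_inP; exists [set i]; rewrite ?set11.
have cE i : chi [tuple i] = chi_contract chi i [tuple].
  by rewrite ffunE; congr (chi _); apply: val_inj.
have [B0 hB0] := set0Pn _ n0; have [i0 e0 g0] := one B0 hB0; rewrite e0 in hB0.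
have [/existsP[B1 /andP[hB1 ne]]|none] := boolP [exists B, (B \in Delta) && (B != [set i0])].
  right; have [j0 e1 g1] := one B1 hB1; rewrite e1 in hB1 ne.
  have ij : i0 != j0 by apply: contraNneq ne => ->.
  have [hC hj] := used_opposite omM ll hchi hT ha g0 g1 ij (u _ hB0) (u _ hB1).
  split; first by move/(_ _ hC); rewrite eqxx.
  have eD : Delta = [set [set i0]; [set j0]].
    apply/setP => B; rewrite !inE; apply/idP/orP => [hBD|[] /eqP -> //].
    have [k ek gk] := one B hBD; rewrite ek in hBD *.
    have [->|ki] := eqVneq k i0; first by left.
    have [->|kj] := eqVneq k j0; first by right.
    have := used_two omM ll rM hchi hT ha g0 g1 gk ij ki kj (u _ hB0) (u _ hB1).
    by rewrite u.
  rewrite /form_of eD big_setU1 /=; last by rewrite inE eqEcard sub1set inE (negPf ij).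
  by rewrite big_set1 !basis_form1 // !cE hj rmorphN scaleNr subrr.
have eD : Delta = [set [set i0]].
  apply/setP => B; rewrite inE; apply/idP/eqP => [hBD|-> //].
  by apply/eqP; apply: contraNT none => ne; apply/existsP; exists B; rewrite hBD.
(* With a single point the empty ridge has no second simplex, so it lies in a positive cocircuit; in
   rank 1 its support is the whole ground set, which excludes positive circuits. *)
left; have ac : acyclic M.
  move=> C hC; apply/negP => /eqP nC.
  have [[D [hD nD] _]|[B' [hB' ne _]]] := hM [set i0] i0 hB0 (set11 _); last first.
    by case/existsP: none; exists B'; rewrite hB'; apply/eqP.
  have sD : supp D = ground M :\: closure M set0.
    apply: cocircuit_supp => //; rewrite ?indep0 ?cards0 ?rM //.
    by rewrite disjoints_subset sub0set.
  have cl0 : closure M set0 = set0.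
    apply/setP => x; rewrite mem_closure_indep ?indep0 // inE setU0.
    by apply/negP => /andP[gx]; rewrite ll.
  have [x xC] := set0Pn _ (circ_neq0 omM hC).
  have xD : x \in supp D by rewrite sD cl0 setD0 (subsetP (circ_ground omM hC)).
  have ag : agree C D x.
    by move: xC xD; rewrite !mem_supp nC nD !inE !orbF /agree => -> ->.
  have [y] := circ_agree omM hC hD ag.
  by rewrite /oppose /agree /= nC nD !in_set0 andbF.
split=> // i gi; rewrite /form_of eD big_set1 basis_form1 //; congr (_%:~R *: _).
have [->//|ii0] := eqVneq i i0; rewrite !cE.
have [[_ ->//]|[hC _]] := chi_pair omM ll hchi ha gi g0 ii0.
by have := ac _ hC; rewrite eqxx.
Qed.

Let main n := forall M (chi : {ffun n.+1.-tuple V -> int}), oriented_pair M chi ->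
  forall Delta, triangulation M Delta ->
  (~ acyclic M -> os_ideal (form_of R M chi Delta)) /\
  forall Delta', triangulation M Delta' ->
    os_ideal (form_of R M chi Delta - form_of R M chi Delta').

Let main0 : main 0.
Proof.
move=> M chi hp Delta hT; have [omM ll rM _ _] := hp.
have [g gM] : exists g, g \in ground M by apply: ground_neq0; rewrite ?rM.
have [[ac e]|[nac e]] := rank1_form hp hT.
  split=> // Delta' hT'; have [[ac' e']|[nac' _]] := rank1_form hp hT'; last by case: nac'.
  by rewrite (e g gM) (e' g gM) subrr; exact: os_0.
split=> [_|Delta' hT']; rewrite e; first exact: os_0.
have [[ac' _]|[_ e']] := rank1_form hp hT'; first by case: nac.
by rewrite e' subrr; exact: os_0.
Qed.

(* The elements of a used by Delta are at most two; if two, they are opposite and their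
   links give forms that cancel by the induction hypothesis; if one, its link is a
   triangulation of M/a; if none, M/a is not acyclic. *)
Lemma residue_of_form n M (chi : {ffun n.+2.-tuple V -> int}) Delta (a : atom M) : main n ->
  oriented_pair M chi -> triangulation M Delta ->
  (~ acyclic_set M (val a) -> os_ideal (ext_res a (form_of R M chi Delta))) /\
  (acyclic_set M (val a) -> forall i Delta2, i \in val a ->
     triangulation (contract M (val a)) Delta2 ->
     os_ideal (ext_res a (form_of R M chi Delta) -
               form_of R (contract M (val a)) (chi_contract chi i) Delta2)).
Proof.
move=> IH hp hT; have [omM ll rM _ hchi] := hp; have [n0 hB _ _] := hT.
have ha : is_atom M (val a) := valP a.
set Ma := contract M (val a).
rewrite ext_res_form //; pose Y i := form_of R Ma (chi_contract chi i) (link Delta i).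
have Y0 i : ~~ used Delta i -> Y i = 0 by move/link_unused => e; rewrite /Y e form_of_set0.
have hpi i : i \in val a -> oriented_pair Ma (chi_contract chi i).
  by move=> ia; exact: oriented_pair_contract.
have hTi i : i \in val a -> used Delta i -> triangulation Ma (link Delta i).
  by move=> ia /exists_inP[B hBD iB]; apply: link_triangulation => //; exists B.
have anti i j : i \in val a -> j \in val a -> i != j -> used Delta i -> used Delta j ->
    ~ acyclic_set M (val a).
  move=> ia ja ij ui uj ac; have [hC _] := used_opposite omM ll hchi hT ha ia ja ij ui uj.
  have := ac ([set i; j], set0); rewrite restrict_circ hC /= eqxx.
  by rewrite /supp /= setU0 subUset !sub1set ia ja => /(_ isT).
have vis i : i \in val a -> acyclic Ma -> exists j, [/\ j \in val a, used Delta j & parallel M i j].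
  move=> ia ac; have [B [j [hBD jB ja pj]]] := extreme_atom_used omM ll ha ia ac hT.
  by exists j; split=> //; apply/exists_inP; exists B.
have par i j : i \in val a -> j \in val a -> parallel M i j -> chi_contract chi i = chi_contract chi j.
  move=> ia ja /predU1P[->//|hC]; have [->//|ij] := eqVneq i j.
  have [[_ //]|[hC' _]] := chi_pair omM ll hchi ha ia ja ij.
  have [||//] := circ_eq omM hC hC'; first by rewrite /supp /= setU0.
    by move=> [e _]; have : j \in [set i]; [rewrite e !inE eqxx orbT|rewrite inE eq_sym (negPf ij)].
  by move=> [e _]; have : i \in [set i]; [rewrite set11|rewrite e inE].
case: (pickP [pred i | (i \in val a) && used Delta i]) => [i /andP[/= ia ui]|no]; last first.
  have none i : i \in val a -> ~~ used Delta i.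
    by move=> ia; have := no i; rewrite /= ia /= => ->.
  rewrite big1 => [|i ia]; last by rewrite -/(Y i) Y0 // none.
  split=> [_|ac i Delta2 ia hT2]; first exact: os_0.
  (* In an acyclic M/a the element i would have a used parallel, so M/a is not acyclic and its form
     vanishes by induction. *)
  rewrite sub0r; apply: os_idealN; have [h _] := IH _ _ (hpi i ia) _ hT2; apply: h => acMa.
  by have [j [ja uj _]] := vis i ia acMa; have := none j ja; rewrite uj.
rewrite (bigD1 i) //=.
case: (pickP [pred j | [&& j \in val a, used Delta j & j != i]]) => [j /and3P[/= ja uj ji]|no2].
  have ij : i != j by rewrite eq_sym.
  have nac := anti i j ia ja ij ui uj; split=> [_|//].
  rewrite (bigD1 j) ?ja //= big1 ?addr0 => [|k /andP[/andP[ka ki] kj]]; last first.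
    by rewrite -/(Y k) Y0 // (used_two omM ll rM hchi hT ha ia ja ka ij ki kj ui uj).
  have [_ hj] := used_opposite omM ll hchi hT ha ia ja ij ui uj.
  rewrite (form_ofN _ _ _ hj); have [_ h] := IH _ _ (hpi i ia) _ (hTi i ia ui).
  exact: h (hTi j ja uj).
have only j : j \in val a -> used Delta j -> j = i.
  by move=> ja uj; apply/eqP; have := no2 j; rewrite /= ja uj /= => /negbFE.
rewrite big1 ?addr0 => [|j /andP[ja ji]]; last first.
  by rewrite -/(Y j) Y0 //; apply: contra ji => uj; apply/eqP/only.
have [hn hI] := IH _ _ (hpi i ia) _ (hTi i ia ui); split=> [nac|ac j Delta2 ja hT2].
  (* Were M/a acyclic, every element of the atom would be parallel to a used one, that is to i. But
     a positive circuit in the atom holds two opposite elements, whose contracted chirotopes differ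
     by a sign. *)
  apply: hn => acMa; have [C] := nonacyclicP nac; rewrite restrict_circ => /andP[hC sC] nC.
  have [x xC] := set0Pn _ (circ_neq0 omM hC).
  have /subsetPn[y yC] := loopless_circ1 omM ll x hC; rewrite inE eq_sym => xy.
  have [xa ya] := (subsetP sC x xC, subsetP sC y yC).
  have parallel_i z : z \in val a -> chi_contract chi z = chi_contract chi i.
    move=> za; have [j [ja uj pj]] := vis z za acMa.
    by rewrite (par z j za ja pj) (only j ja uj).
  have [[hC' _]|[_ h]] := chi_pair omM ll hchi ha xa ya xy.
    have sC' : supp ([set x], [set y]) \subset supp C.
      by rewrite /supp /= subUset !sub1set xC yC.
    have [e|e] := circ_eq omM hC' hC sC'; move: nC; rewrite -?e.
      by move=> /= e2; have := set11 y; rewrite e2 inE.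
    by rewrite -[C]soppK -e /= => e2; have := set11 x; rewrite e2 inE.
  have [t nz] := used_chi_neq0 omM ll rM hchi hT ha ia ui.
  have := h t; rewrite !parallel_i // => e.
  by move: nz; have [||] := chirotope_values t (chirotope_contract omM ll hchi ha ia); move=> h0; move: e; rewrite h0.
have -> : chi_contract chi j = chi_contract chi i.
  have [->//|ji] := eqVneq j i; have [[_ //]|[hC _]] := chi_pair omM ll hchi ha ja ia ji.
  have := ac ([set j; i], set0); rewrite restrict_circ hC /= eqxx.
  by rewrite /supp /= setU0 subUset !sub1set ia ja => /(_ isT).
exact: hI.
Qed.

Let main_all n : main n.
Proof.
elim: n => [|n IH]; first exact: main0.
move=> M chi hp Delta hT; have [omM ll rM _ hchi] := hp.
have hom Delta1 : triangulation M Delta1 -> homogeneous n.+1 (form_of R M chi Delta1).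
  by move=> [_ hB _ _]; exact: (homogeneous_form hp hB).
split=> [nac|Delta' hT'].
  apply/os_pi0; apply: (os_res_inj omM ll (hom _ hT)) => a.
  have ha : is_atom M (val a) := valP a.
  rewrite os_res_pi //; apply/os_pi0; have [h1 h2] := residue_of_form a IH hp hT.
  have [ac|nac'] := pselect (acyclic_set M (val a)); last exact: h1.
  have [i ia] := atom_neq0 omM ha; have hpi := oriented_pair_contract hp ha ia.
  have [omMa _ _ _ _] := hpi.
  (* A triangulation of M/a is needed here independently of Delta, whose links in the atom may all
     be empty. *)
  have hT2 := lex_triangulation omMa.
  have [h3 _] := IH _ _ hpi _ hT2.
  have nacMa : ~ acyclic (contract M (val a)) := nonacyclic_contract omM ll ha nac ac.
  rewrite -[ext_res _ _](subrK (form_of R (contract M (val a)) (chi_contract chi i)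
    [set B | lex_simplex (contract M (val a)) B])).
  by apply: os_idealD; [exact: h2|exact: h3].
apply/os_pi0; apply: (@os_res_inj R V M n) => // [|a].
  by apply: homogeneousD; [exact: hom|apply/homogeneousN/hom].
have ha : is_atom M (val a) := valP a.
rewrite os_res_pi // ext_resB //; apply/os_pi0.
have [h1 h2] := residue_of_form a IH hp hT; have [h1' h2'] := residue_of_form a IH hp hT'.
have [ac|nac] := pselect (acyclic_set M (val a)); last by apply: os_sub; [exact: h1|exact: h1'].
have [i ia] := atom_neq0 omM ha; have [omMa _ _ _ _] := oriented_pair_contract hp ha ia.
have hT2 := lex_triangulation omMa.
have := os_sub (h2 ac i _ ia hT2) (h2' ac i _ ia hT2).
by rewrite opprB addrA subrK.
Qed.

Lemma form_independent M r (chi : {ffun r.-tuple V -> int}) Delta Delta' : oriented_pair M chi ->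
  triangulation M Delta -> triangulation M Delta' ->
  \pi_(OS R M) (form_of R M chi Delta) = \pi_(OS R M) (form_of R M chi Delta').
Proof.
case: r chi => [|r] chi hp hT hT'; first by case: hp.
by apply/os_pi_eq; have [_ h] := main_all hp hT; exact: h.
Qed.

Lemma form_nonacyclic M r (chi : {ffun r.-tuple V -> int}) Delta : oriented_pair M chi ->
  triangulation M Delta -> ~ acyclic M -> os_ideal (form_of R M chi Delta).
Proof.
case: r chi => [|r] chi hp hT nac; first by case: hp.
by have [h _] := main_all hp hT; exact: h.
Qed.

Lemma residue_form M r (chi : {ffun r.+2.-tuple V -> int}) Delta (a : atom M) :
  oriented_pair M chi -> triangulation M Delta ->
  (~ acyclic_set M (val a) -> os_ideal (ext_res a (form_of R M chi Delta))) /\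
  (acyclic_set M (val a) -> forall i Delta2, i \in val a ->
     triangulation (contract M (val a)) Delta2 ->
     os_ideal (ext_res a (form_of R M chi Delta) -
               form_of R (contract M (val a)) (chi_contract chi i) Delta2)).
Proof. exact: residue_of_form (@main_all r). Qed.

End Canonical.

(** * Existence and uniqueness of the canonical assignment *)

Section CanonicalAssignment.
Import GRing.Theory.
Local Open Scope ring_scope.
Local Open Scope quotient_scope.
Variable R : comPzRingType.

Lemma os_resB V (M : sgsystem V) (a : atom M) (w w' : OS R M) : oriented_matroid M -> loopless M ->
  os_res a (w - w') = os_res a w - os_res a w'.
Proof.
move=> omM ll; rewrite -[w]reprK -[w']reprK -os_piB !os_res_pi // ext_resB //; exact: os_piB.
Qed.

(** An explicit triangulation gives a formula for all arguments, so no choice of triangulations has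
    to be made over all matroids. *)
Definition lex_assignment : assignment R := fun V M r chi =>
  \pi_(OS R M) (form_of R M chi [set B | lex_simplex M B]).

Lemma lex_assignmentE (V : finType) (M : sgsystem V) r (chi : {ffun r.-tuple V -> int}) Delta ord :
  oriented_pair M chi -> triangulation M Delta ->
  (forall B, B \in Delta -> [set i in tval (ord B)] = B) ->
  lex_assignment M chi = triangulation_form R M chi Delta ord.
Proof.
move=> hp hT hord; rewrite triangulation_formE //; have [omM _ _ _ _] := hp.
exact: form_independent hp (lex_triangulation omM) hT.
Qed.

Lemma lex_assignment_canonical : canonical_assignment lex_assignment.
Proof.
split=> [V M r chi hp|V M chi hp|V M r chi a hp]; have [omM ll _ _ hchi] := hp;
  have hT := lex_triangulation omM.
- split; last by rewrite os_bdry_pi bdry_form os_pi_0.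
  exists (form_of R M chi [set B | lex_simplex M B]) => //.
  by have [_ hB _ _] := hT; exact: homogeneous_form.
- have [[ac e]|[nac e]] := rank1_form R hp hT; split=> //; last first.
    by rewrite /lex_assignment e os_pi_0.
  move=> _ i gi; rewrite /lex_assignment (e i gi).
  case: (chirotope_values [tuple i] hchi) => ->.
  + by rewrite mulr0z scale0r os_pi_0.
  + by rewrite mulr1z scale1r.
  by rewrite !mulrN1z scaleN1r os_piN.
have ha : is_atom M (val a) := valP a.
rewrite os_res_pi //; case: r chi hp hchi => [|r] chi hp hchi.
  (* In rank 1 an atom that is not acyclic holds a positive circuit of M, so the form itself already
     vanishes. *)
  split=> // nac; apply/os_pi0/os_ideal_res => //; apply: form_nonacyclic => // ac.
  by apply: nac => C; rewrite restrict_circ => /andP[/ac].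
have [h1 h2] := residue_form R a hp hT; split=> [nac|ac _ i ia]; first by apply/os_pi0/h1.
apply/os_pi_eq/h2 => //; have [omMa _ _ _ _] := oriented_pair_contract hp ha ia.
exact: lex_triangulation.
Qed.

(** Induction on the rank: the difference of two values is homogeneous of positive degree from rank
    2 on, and its residues are 0 or differences in rank one less. *)
Lemma canonical_assignment_unique (Om Om' : assignment R) :
  canonical_assignment Om -> canonical_assignment Om' ->
  forall (V : finType) (M : sgsystem V) r (chi : {ffun r.-tuple V -> int}),
  oriented_pair M chi -> Om V M r chi = Om' V M r chi.
Proof.
move=> [homO oneO resO] [homO' oneO' resO'] V M r.
elim: r M => [|[_|r IH]] M chi hp; first by case: hp.
  have [z1 h1] := oneO _ _ _ hp; have [z2 h2] := oneO' _ _ _ hp.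
  have [ac|nac] := pselect (acyclic M); last by rewrite z1 ?z2.
  have [g gM] : exists g, g \in ground M by case: hp => omM _ rM _ _; apply: ground_neq0; rewrite ?rM.
  by rewrite (h1 ac g gM) (h2 ac g gM).
have [omM ll _ _ _] := hp.
have [[[x hx ex] _] [[x' hx' ex'] _]] := (homO _ _ _ _ hp, homO' _ _ _ _ hp).
apply/eqP; rewrite -subr_eq0; apply/eqP; rewrite ex ex' -os_piB.
apply: os_res_inj => // [|a].
  by apply: homogeneousD; [exact: hx|apply/homogeneousN/hx'].
have ha : is_atom M (val a) := valP a.
rewrite os_piB -ex -ex' os_resB //.
have [[n1 h1] [n2 h2]] := (resO _ _ _ _ a hp, resO' _ _ _ _ a hp).
have [ac|nac] := pselect (acyclic_set M (val a)); last by rewrite n1 // n2 // subrr.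
have [i ia] := atom_neq0 omM ha.
by rewrite (h1 ac isT i ia) (h2 ac isT i ia) IH ?subrr //; exact: oriented_pair_contract.
Qed.

End CanonicalAssignment.

Theorem theorem2p5 (R : comPzRingType) :
  (forall (V : finType) (M : sgsystem V) (r : nat)
     (chi : {ffun r.-tuple V -> int}),
     oriented_pair M chi -> exists Delta, triangulation M Delta) /\
  exists Om : assignment R,
    [/\ forall (V : finType) (M : sgsystem V) (r : nat)
          (chi : {ffun r.-tuple V -> int}) (Delta : {set {set V}})
          (ord : {set V} -> r.-tuple V),
          oriented_pair M chi -> triangulation M Delta ->
          (forall B, B \in Delta -> [set i in tval (ord B)] = B) ->
          Om V M r chi = triangulation_form R M chi Delta ord,
        canonical_assignment Om
      & forall Om' : assignment R, canonical_assignment Om' ->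
          forall (V : finType) (M : sgsystem V) (r : nat)
            (chi : {ffun r.-tuple V -> int}),
            oriented_pair M chi -> Om' V M r chi = Om V M r chi].
Proof.
split=> [V M r chi [omM _ _ _ _]|].
  by exists [set B | lex_simplex M B]; exact: lex_triangulation.
exists (@lex_assignment R); split; first by move=> *; exact: lex_assignmentE.
  exact: lex_assignment_canonical.
by move=> Om' hOm' *; apply: canonical_assignment_unique => //; exact: lex_assignment_canonical.
Qed.
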